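(* Let $\Phi(s,z,c)=\sum_{n=0}^{\infty} z^n (n+c)^{-s}$ be the Lerch transcendent, holomorphic on $\mathcal D_0=\{\Re s>1\}\times\{|z|<1\}\times\{0<\Re c<1\}$. Let $\mathcal N=\mathbb C\times(\mathbb P^1(\mathbb C)\setminus\{0,1,\infty\})\times(\mathbb C\setminus\mathbb Z)$ with base point $x_0'=(\tfrac12,-1,\tfrac12)$. Then: (1) $\Phi$ analytically continues to a single-valued holomorphic function $\tilde Z(s,z,c,[\gamma])$ on the universal cover $\tilde{\mathcal N}$ of $\mathcal N$. (2) $\tilde Z$ becomes single-valued on a two-step solvable regular (Galois) covering manifold of $\mathcal N$, which can be taken to be the covering corresponding to the second commutator subgroup $\pi_1(\mathcal N,x_0')''$; that is, $\tilde Z([\tau\gamma])=\tilde Z([\gamma])$ for all $[\tau]\in\pi_1(\mathcal N,x_0')''$ and all paths $\gamma$ from $x_0'$. *)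

(* Defs.v *)
From Stdlib Require Import Reals.
From Coquelicot Require Import Coquelicot.

Open Scope R_scope.

Definition C3 : Type := (C * C * C)%type.

Definition dist3 (p q : C3) : R :=
  match p, q with
  | (s, z, c), (s', z', c') => Rmax (Cmod (s - s')%C) (Rmax (Cmod (z - z')%C) (Cmod (c - c')%C))
  end.

(** The manifold N = C x (P^1(C) \ {0,1,oo}) x (C \ Z), viewed as an open
    subset of C^3 (P^1 \ {0,1,oo} = C \ {0,1}). *)
Definition inN (p : C3) : Prop :=
  match p with
  | (s, z, c) => z <> RtoC 0 /\ z <> RtoC 1 /\ (forall k : Z, c <> RtoC (IZR k))
  end.

Definition inD0 (p : C3) : Prop :=
  match p with
  | (s, z, c) => 1 < Re s /\ Cmod z < 1 /\ 0 < Re c < 1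
  end.

Definition x0' : C3 := (RtoC (1/2), RtoC (-1), RtoC (1/2)).

Definition Cexp (w : C) : C :=
  (exp (Re w) * cos (Im w), exp (Re w) * sin (Im w)).

Definition Carg (w : C) : R :=
  let x := Re w in let y := Im w in
  if Rlt_dec 0 x then atan (y / x)
  else if Rlt_dec x 0 then
    (if Rle_dec 0 y then atan (y / x) + PI else atan (y / x) - PI)
  else if Rlt_dec 0 y then PI / 2
  else if Rlt_dec y 0 then - (PI / 2) else 0.

Definition Clog (w : C) : C := (ln (Cmod w), Carg w).

Definition Cpow (w a : C) : C := Cexp (a * Clog w)%C.

Fixpoint Cpown (z : C) (n : nat) : C :=
  match n with O => RtoC 1 | S m => (z * Cpown z m)%C end.

Definition lerch_term (s z c : C) (n : nat) : C :=
  (Cpown z n * Cpow (RtoC (INR n) + c) (- s))%C.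

(** Holomorphy of g : C^3 -> C on an open set U: continuous and complex
    differentiable in each variable separately (equivalent to holomorphy,
    Osgood's lemma). *)
Definition holo3 (U : C3 -> Prop) (g : C3 -> C) : Prop :=
  forall p, U p ->
    (forall eps, 0 < eps -> exists delta, 0 < delta /\
        forall q, dist3 p q < delta -> Cmod (g q - g p)%C < eps) /\
    match p with
    | (s, z, c) =>
        @ex_derive C_AbsRing C_NormedModule (fun w => g (w, z, c)) s /\
        @ex_derive C_AbsRing C_NormedModule (fun w => g (s, w, c)) z /\
        @ex_derive C_AbsRing C_NormedModule (fun w => g (s, z, w)) c
    end.

(** Paths are maps R -> C^3, only their restriction to [0,1] matters. *)
Definition path : Type := R -> C3.

Definition path_in (U : C3 -> Prop) (g : path) : Prop :=
  (forall t, 0 <= t <= 1 -> U (g t)) /\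
  (forall t, 0 <= t <= 1 -> forall eps, 0 < eps -> exists delta, 0 < delta /\
     forall t', 0 <= t' <= 1 -> Rabs (t' - t) < delta -> dist3 (g t) (g t') < eps).

Definition pathN (g : path) : Prop := path_in inN g.

Definition loopN (g : path) : Prop := pathN g /\ g 0 = x0' /\ g 1 = x0'.

Definition concat (g h : path) : path :=
  fun t => if Rle_dec t (1/2) then g (2 * t) else h (2 * t - 1).

Definition rev (g : path) : path := fun t => g (1 - t).

Definition cst (x : C3) : path := fun _ => x.

Definition homotopic (g h : path) : Prop :=
  pathN g /\ pathN h /\ g 0 = h 0 /\ g 1 = h 1 /\
  exists H : R -> R -> C3,
    (forall u t, 0 <= u <= 1 -> 0 <= t <= 1 -> inN (H u t)) /\
    (forall u t, 0 <= u <= 1 -> 0 <= t <= 1 -> forall eps, 0 < eps ->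
       exists delta, 0 < delta /\ forall u' t', 0 <= u' <= 1 -> 0 <= t' <= 1 ->
         Rabs (u' - u) < delta -> Rabs (t' - t) < delta ->
         dist3 (H u t) (H u' t') < eps) /\
    (forall t, 0 <= t <= 1 -> H 0 t = g t /\ H 1 t = h t) /\
    (forall u, 0 <= u <= 1 -> H u 0 = g 0 /\ H u 1 = g 1).

Definition commutator (a b : path) : path :=
  concat (concat a b) (concat (rev a) (rev b)).

(** Loops at x0' representing elements of the subgroup of pi_1(N, x0')
    generated by the commutators [a, b] with a, b loops satisfying P
    (products of such commutators, closed under homotopy). *)
Inductive comm_gen (P : path -> Prop) : path -> Prop :=
  | comm_gen_cst : comm_gen P (cst x0')
  | comm_gen_step : forall l a b, comm_gen P l -> P a -> P b ->
      comm_gen P (concat l (commutator a b))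
  | comm_gen_htpy : forall l l', comm_gen P l -> homotopic l l' -> comm_gen P l'.

Definition derived1 : path -> Prop := comm_gen loopN.
Definition derived2 : path -> Prop := comm_gen derived1.

(** paths starting at the base point x0' (points of the universal cover) *)
Definition cover_pt (g : path) : Prop := pathN g /\ g 0 = x0'.

(** Zt : paths from x0' -> C is a single-valued holomorphic function on the
    universal cover of N: homotopy invariant, and locally given by
    holomorphic functions on balls contained in N. *)
Definition holo_on_cover (Zt : path -> C) : Prop :=
  (forall g h, cover_pt g -> homotopic g h -> Zt g = Zt h) /\
  (forall g, cover_pt g -> exists r, 0 < r /\
     (forall q, dist3 (g 1) q < r -> inN q) /\
     exists F : C3 -> C, holo3 (fun q => dist3 (g 1) q < r) F /\
       forall d, path_in (fun q => dist3 (g 1) q < r) d -> d 0 = g 1 ->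
         Zt (concat g d) = F (d 1)).

(** Zt is an analytic continuation of the Lerch series from D_0 \cap N:
    along some path g0 from x0' to a point of D_0 \cap N, Zt coincides on
    D_0 \cap N with the sum of the series. *)
Definition continues_lerch (Zt : path -> C) : Prop :=
  exists g0, cover_pt g0 /\ inD0 (g0 1) /\
    forall d, path_in (fun q => inN q /\ inD0 q) d -> d 0 = g0 1 ->
      match d 1 with
      | (s, z, c) => @is_series C_AbsRing C_NormedModule (lerch_term s z c) (Zt (concat g0 d))
      end.

(* Main.v *)
Require Import Defs.
From Stdlib Require Import Reals Lra Lia Psatz Classical ClassicalEpsilon FunctionalExtensionality.
From Coquelicot Require Import Coquelicot.

(** Write [w = log z] and [v_k = w + 2 pi i k] for [k : Z].  For [0 < Im w < 2 pi]
    and [Re c > 1/2] the residue theorem turns the integral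
    [W(s,w,c)] of [exp(w x) (x + c)^(-s) / (1 - exp(2 pi i x))] over the line
    [Re x = -1/2] into a solution of [W(c) - z W(c+1) = c^(-s)].  Moving [w] out
    of that strip makes [W] shed incomplete Gamma functions: by
      [exp(a v) int_0^oo exp(j v y) (a + j y)^(-s) j dy
          = h_j(s, log v) + (an entire function of v)],  [j = i, -i],
    with [h_j(s, L)] entire in [L].  Hence for large [N] and [n]
      [sum_(l<N) z^l (c+l)^(-s) + sum_(-n<=k<n) exp(-c v_k) h_j(s, log v_k)
          + z^N W_n(s,w,c+N)],
    with [j = i] for [k >= 0] and [j = -i] for [k < 0], is independent of [N] and [n]
    and holomorphic in [s], [c] and the logarithms of [z], of all [v_k] and of all [c + l].
    For [|z| < 1] and [Re s > 1] all but the first sum vanish as [N -> oo],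
    so this continues the Lerch series along every path.  A loop in the first
    derived subgroup does not change the logarithms of [z] and of [c + l], so it
    lifts to a loop in the [w]-plane; a product of commutators of such loops does
    not change the logarithms of the [v_k] either. *)

Open Scope R_scope.
Open Scope C_scope.

(** Moving the line of integration is expressed by differentiating in its abscissa, and the pole at
    0 is handled by comparison: subtracting [c^(-s)] times the integrand with [s = 0] and [v = pi i]
    cancels it, and the jump of the comparison integral is explicit, through an arctangent. The
    incomplete Gamma functions come from [1/(1+q) + q/(1+q) = 1] with [q = exp(-2 pi y)], which
    relates the half-line integrals for [v] and [v + 2 pi j]. Each [h_j] is given by variation of
    constants for a linear differential equation in [L = log v] with entire coefficients, so that it
    is entire in [L] by construction. No finite set of logarithms describes all paths, since [z = 1]
    lifts to infinitely many punctures of the [w]-plane. A given path leaves the principal branches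
    for finitely many [k] and [l] only, and principal branches are exactly what the recursions in
    [N] and [n] require. The truncated expression is therefore eventually constant, and its eventual
    value is the definition of the continuation. *)

Lemma C_ext (x y : C) : Re x = Re y -> Im x = Im y -> x = y.
Proof. destruct x, y; simpl; intros; subst; reflexivity. Qed.

Lemma Cmod_sub_sym (x y : C) : Cmod (x - y) = Cmod (y - x).
Proof. rewrite <- (Cmod_opp (x - y)); f_equal; ring. Qed.

Lemma Cmod_sub_triangle (x y z : C) : (Cmod (x - z) <= Cmod (x - y) + Cmod (y - z))%R.
Proof. replace (x - z) with ((x - y) + (y - z)) by ring; apply Cmod_triangle. Qed.

Lemma Cmod_triangle_rev (x y : C) : (Cmod x <= Cmod y + Cmod (x - y))%R.
Proof. replace x with (y + (x - y)) at 1 by ring; apply Cmod_triangle. Qed.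

Lemma Cmod_zero_sub (x : C) : Cmod (x - x) = 0%R.
Proof. replace (x - x) with (RtoC 0) by ring; apply Cmod_0. Qed.

Lemma Cmod_pos_sub (x y : C) : x <> y -> (0 < Cmod (x - y))%R.
Proof.
intro H; apply Cmod_gt_0; intro E; apply H.
replace x with ((x - y) + y) by ring; rewrite E; ring.
Qed.

Lemma Cmod_sub_lt_neq (x y : C) : (Cmod (x - y) < Cmod y)%R -> x <> 0.
Proof.
intros H E; subst x; rewrite Cmod_sub_sym in H.
replace (y - 0) with y in H by ring; lra.
Qed.

Lemma im_le_Cmod (x : C) : (Rabs (Im x) <= Cmod x)%R.
Proof. eapply Rle_trans; [apply Rmax_r | apply Rmax_Cmod]. Qed.

Lemma Re_le_Cmod (x : C) : (Re x <= Cmod x)%R.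
Proof. eapply Rle_trans; [apply Rle_abs | apply re_le_Cmod]. Qed.

Lemma Cmod_le_Re_Im (x : C) : (Cmod x <= Rabs (Re x) + Rabs (Im x))%R.
Proof.
replace x with (RtoC (Re x) + Ci * RtoC (Im x)) at 1.
- eapply Rle_trans; [apply Cmod_triangle|].
  rewrite Cmod_mult, Cmod_Ci, !Cmod_R; lra.
- destruct x; apply C_ext; simpl; ring.
Qed.

(** * Limits with respect to a distance function *)

(** The neighbourhoods are not punctured: points with [d p = 0] are included, so that [tends d f l]
    forces [f p = l] there. With [d] the distance to a point this is continuity, and the same
    definition serves [C], [R], [C3] and products of these with a parameter. *)
Definition tends {T : Type} (d : T -> R) (f : T -> C) (l : C) : Prop :=
  forall eps, (0 < eps)%R ->
  exists delta, (0 < delta)%R /\ forall p, (d p < delta)%R -> (Cmod (f p - l) < eps)%R.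

Definition at_pt (z : C) : C -> R := fun w => Cmod (w - z).

Section Tends.
Context {T : Type} (d : T -> R).

Lemma tends_ext (f g : T -> C) l : (forall p, f p = g p) -> tends d f l -> tends d g l.
Proof.
intros E H eps He; destruct (H eps He) as [r [Hr H1]]; exists r; split; auto.
intros p Hp; rewrite <- E; auto.
Qed.

Lemma tends_eq (f : T -> C) l l' : tends d f l -> l = l' -> tends d f l'.
Proof. intros H E; subst; auto. Qed.

Lemma tends_ext_loc (f g : T -> C) l r : (0 < r)%R ->
  (forall p, (d p < r)%R -> f p = g p) -> tends d f l -> tends d g l.
Proof.
intros Hr E H eps He; destruct (H eps He) as [r' [Hr' H1]].
exists (Rmin r r'); split; [apply Rmin_pos; auto|].
intros p Hp; rewrite <- E; [apply H1|]; eapply Rlt_le_trans; eauto using Rmin_l, Rmin_r.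
Qed.

Lemma tends_const (l : C) : tends d (fun _ => l) l.
Proof. intros eps He; exists 1%R; split; [lra|]; intros; rewrite Cmod_zero_sub; auto. Qed.

Lemma tends_le (f : T -> C) (l : C) (K : R) :
  (forall p, Cmod (f p - l) <= K * d p)%R -> (forall p, 0 <= d p)%R -> tends d f l.
Proof.
intros H Hd eps He.
assert (0 < Rabs K + 1)%R by (pose proof (Rabs_pos K); lra).
exists (eps / (Rabs K + 1))%R; split; [apply Rdiv_lt_0_compat; auto|].
intros p Hp; eapply Rle_lt_trans; [apply H|].
apply Rle_lt_trans with ((Rabs K + 1) * d p)%R.
- apply Rmult_le_compat_r; auto; pose proof (Rle_abs K); lra.
- replace eps with ((Rabs K + 1) * (eps / (Rabs K + 1)))%R by (field; lra).
  apply Rmult_lt_compat_l; auto.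
Qed.

Lemma tends_plus (f g : T -> C) l m :
  tends d f l -> tends d g m -> tends d (fun p => f p + g p) (l + m).
Proof.
intros Hf Hg eps He.
destruct (Hf (eps / 2)%R) as [r [Hr H1]]; [lra|].
destruct (Hg (eps / 2)%R) as [r' [Hr' H2]]; [lra|].
exists (Rmin r r'); split; [apply Rmin_pos; auto|].
intros p Hp; replace (f p + g p - (l + m)) with ((f p - l) + (g p - m)) by ring.
eapply Rle_lt_trans; [apply Cmod_triangle|].
specialize (H1 p (Rlt_le_trans _ _ _ Hp (Rmin_l _ _))).
specialize (H2 p (Rlt_le_trans _ _ _ Hp (Rmin_r _ _))); lra.
Qed.

Lemma tends_mult (f g : T -> C) l m :
  tends d f l -> tends d g m -> tends d (fun p => f p * g p) (l * m).
Proof.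
intros Hf Hg eps He.
pose proof (Cmod_ge_0 l); pose proof (Cmod_ge_0 m).
set (K := (Cmod l + Cmod m + 1)%R).
assert (HK : (0 < K)%R) by (unfold K; lra).
assert (He1 : (0 < Rmin 1 (eps / K))%R).
{ apply Rmin_pos; [lra | apply Rdiv_lt_0_compat; auto]. }
destruct (Hf _ He1) as [r [Hr H1]]; destruct (Hg _ He1) as [r' [Hr' H2]].
exists (Rmin r r'); split; [apply Rmin_pos; auto|].
intros p Hp.
specialize (H1 p (Rlt_le_trans _ _ _ Hp (Rmin_l _ _))).
specialize (H2 p (Rlt_le_trans _ _ _ Hp (Rmin_r _ _))).
replace (f p * g p - l * m) with ((f p - l) * (g p - m) + (l * (g p - m) + m * (f p - l))) by ring.
eapply Rle_lt_trans; [apply Cmod_triangle|].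
eapply Rle_lt_trans; [apply Rplus_le_compat_l, Cmod_triangle|].
rewrite !Cmod_mult.
set (e := Rmin 1 (eps / K)) in *.
assert (e <= 1)%R by apply Rmin_l.
assert (e * K <= eps)%R.
{ replace eps with (eps / K * K)%R by (field; lra).
  apply Rmult_le_compat_r; [lra|apply Rmin_r]. }
pose proof (Cmod_ge_0 (f p - l)); pose proof (Cmod_ge_0 (g p - m)).
unfold K in *; nra.
Qed.

Lemma tends_opp (f : T -> C) l : tends d f l -> tends d (fun p => - f p) (- l).
Proof.
intros Hf eps He; destruct (Hf eps He) as [r [Hr H1]]; exists r; split; auto.
intros p Hp; replace (- f p - - l) with (- (f p - l)) by ring; rewrite Cmod_opp; auto.
Qed.

Lemma tends_minus (f g : T -> C) l m :
  tends d f l -> tends d g m -> tends d (fun p => f p - g p) (l - m).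
Proof. intros; apply tends_plus; auto using tends_opp. Qed.

Lemma tends_comp (g : C -> C) (f : T -> C) l m :
  tends (at_pt l) g m -> tends d f l -> tends d (fun p => g (f p)) m.
Proof.
intros Hg Hf eps He; destruct (Hg eps He) as [r [Hr H1]].
destruct (Hf r Hr) as [r' [Hr' H2]]; exists r'; split; auto.
intros p Hp; apply H1, H2; auto.
Qed.

Lemma tends_compR (g : R -> R) (f : T -> R) (l : R) :
  continuity_pt g l -> tends d (fun p => RtoC (f p)) l -> tends d (fun p => RtoC (g (f p))) (g l).
Proof.
intros Hg Hf eps He; destruct (Hg eps He) as [r [Hr H1]].
destruct (Hf r Hr) as [r' [Hr' H2]]; exists r'; split; auto.
intros p Hp; rewrite <- RtoC_minus, Cmod_R.
specialize (H2 p Hp); rewrite <- RtoC_minus, Cmod_R in H2.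
destruct (Req_dec (f p) l) as [E|E].
- rewrite E, Rminus_eq_0, Rabs_R0; auto.
- apply (H1 (f p)); split; [split; [exact I | auto]|exact H2].
Qed.

Lemma tends_Re (f : T -> C) l : tends d f l -> tends d (fun p => RtoC (Re (f p))) (Re l).
Proof.
intros Hf eps He; destruct (Hf eps He) as [r [Hr H1]]; exists r; split; auto.
intros p Hp; rewrite <- RtoC_minus, Cmod_R.
eapply Rle_lt_trans; [|apply (H1 p Hp)].
replace (Re (f p) - Re l)%R with (Re (f p - l)) by reflexivity; apply re_le_Cmod.
Qed.

Lemma tends_Im (f : T -> C) l : tends d f l -> tends d (fun p => RtoC (Im (f p))) (Im l).
Proof.
intros Hf eps He; destruct (Hf eps He) as [r [Hr H1]]; exists r; split; auto.
intros p Hp; rewrite <- RtoC_minus, Cmod_R.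
eapply Rle_lt_trans; [|apply (H1 p Hp)].
replace (Im (f p) - Im l)%R with (Im (f p - l)) by reflexivity; apply im_le_Cmod.
Qed.

Lemma tends_Cmod (f : T -> C) l : tends d f l -> tends d (fun p => RtoC (Cmod (f p))) (Cmod l).
Proof.
intros Hf eps He; destruct (Hf eps He) as [r [Hr H1]]; exists r; split; auto.
intros p Hp; rewrite <- RtoC_minus, Cmod_R.
specialize (H1 p Hp); pose proof (Cmod_triangle_rev (f p) l).
pose proof (Cmod_triangle_rev l (f p)); rewrite (Cmod_sub_sym l) in *.
apply Rabs_def1; lra.
Qed.

Lemma tends_neq (f : T -> C) l a : tends d f l -> l <> a ->
  exists r, (0 < r)%R /\ forall p, (d p < r)%R -> f p <> a.
Proof.
intros H Hl; destruct (H (Cmod (l - a))) as [r [Hr H1]]; [apply Cmod_pos_sub; auto|].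
exists r; split; auto; intros p Hp E; specialize (H1 p Hp); rewrite E, Cmod_sub_sym in H1; lra.
Qed.

End Tends.

Lemma at_pt_ge0 z w : (0 <= at_pt z w)%R.
Proof. apply Cmod_ge_0. Qed.

Lemma tends_id (z : C) : tends (at_pt z) (fun w => w) z.
Proof. apply tends_le with 1%R; [intro; unfold at_pt; lra | apply at_pt_ge0]. Qed.

Lemma tends_inv_pt (l : C) : l <> 0 -> tends (at_pt l) Cinv (/ l).
Proof.
intros Hl eps He.
assert (Hl0 : (0 < Cmod l)%R) by (apply Cmod_gt_0; auto).
set (K := (Cmod l * Cmod l / 2)%R).
assert (HK : (0 < K)%R) by (unfold K; nra).
exists (Rmin (Cmod l / 2) (eps * K)); split; [apply Rmin_pos; [lra|nra]|].
unfold at_pt; intros w Hw.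
assert (H1 : (Cmod (w - l) < Cmod l / 2)%R) by (eapply Rlt_le_trans; [apply Hw|apply Rmin_l]).
assert (H2 : (Cmod (w - l) < eps * K)%R) by (eapply Rlt_le_trans; [apply Hw|apply Rmin_r]).
assert (Hw0 : (Cmod l / 2 < Cmod w)%R).
{ pose proof (Cmod_triangle_rev l w); rewrite (Cmod_sub_sym l) in *; lra. }
assert (w <> 0) by (apply Cmod_gt_0; lra).
replace (/ w - / l) with ((l - w) * (/ w * / l)) by (field; auto).
rewrite !Cmod_mult, !Cmod_inv, Cmod_sub_sym by auto.
replace eps with (eps * (Cmod w * Cmod l) * (/ Cmod w * / Cmod l))%R by (field; lra).
apply Rmult_lt_compat_r; [apply Rmult_lt_0_compat; apply Rinv_0_lt_compat; lra|].
apply Rlt_le_trans with (eps * K)%R; auto; apply Rmult_le_compat_l; unfold K; nra.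
Qed.

Lemma tends_inv {T} (d : T -> R) (f : T -> C) (l : C) :
  l <> 0 -> tends d f l -> tends d (fun p => / f p) (/ l).
Proof. intros; apply tends_comp with (g := Cinv) (l := l); auto using tends_inv_pt. Qed.

(** [i] is the coordinate with respect to which one differentiates: the
    identity of [C] or the inclusion of [R] in [C] in what follows. *)
Definition der {T : Type} (i : T -> C) (f : T -> C) (p : T) (l : C) : Prop :=
  exists phi, (forall q, f q = f p + (i q - i p) * phi q) /\
              tends (fun q => Cmod (i q - i p)) phi l.

Notation cder := (der (fun w : C => w)).
Notation rder := (der RtoC).

Section Der.
Context {T : Type} (i : T -> C).

Lemma der_eq f p l l' : der i f p l -> l = l' -> der i f p l'.
Proof. intros H E; subst; auto. Qed.

(** Passage from the little-o form of differentiability to the slope function: the latter is the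
    difference quotient, completed by [l] where [i q = i p]. *)
Lemma der_of_eps f p l :
  (forall q, i q = i p -> f q = f p) ->
  (forall eps, (0 < eps)%R -> exists delta, (0 < delta)%R /\ forall q, (Cmod (i q - i p) < delta)%R ->
    (Cmod (f q - f p - (i q - i p) * l) <= eps * Cmod (i q - i p))%R) ->
  der i f p l.
Proof.
intros Hi H.
exists (fun q => if excluded_middle_informative (i q = i p) then l else (f q - f p) / (i q - i p)).
split.
- intro q; destruct (excluded_middle_informative (i q = i p)) as [E|E].
  + rewrite (Hi _ E), E; ring.
  + field. intro E1; apply E; replace (i q) with ((i q - i p) + i p) by ring; rewrite E1; ring.
- intros eps He; destruct (H (eps / 2)%R) as [r [Hr H1]]; [lra|]; exists r; split; auto.
  intros q Hq; destruct (excluded_middle_informative (i q = i p)) as [E|E].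
  + rewrite Cmod_zero_sub; auto.
  + pose proof (Cmod_pos_sub _ _ E) as H2.
    assert (H3 : i q - i p <> 0) by (apply Cmod_gt_0; auto).
    replace ((f q - f p) / (i q - i p) - l) with ((f q - f p - (i q - i p) * l) * / (i q - i p))
      by (field; auto).
    rewrite Cmod_mult, Cmod_inv by auto.
    specialize (H1 q Hq).
    apply Rmult_le_compat_r with (r := (/ Cmod (i q - i p))%R) in H1.
    * rewrite Rmult_assoc, Rinv_r in H1; lra.
    * left; apply Rinv_0_lt_compat; auto.
Qed.

Lemma der_ext_loc f g p l r : (0 < r)%R -> (forall q, i q = i p -> q = p) ->
  (forall q, (Cmod (i q - i p) < r)%R -> f q = g q) -> der i f p l -> der i g p l.
Proof.
intros Hr Hi E [phi [H1 H2]].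
assert (Ep : f p = g p) by (apply E; rewrite Cmod_zero_sub; auto).
apply der_of_eps.
- intros q Hq; rewrite (Hi q); auto.
- intros eps He; destruct (H2 eps He) as [r' [Hr' H3]].
  exists (Rmin r r'); split; [apply Rmin_pos; auto|].
  intros q Hq; rewrite <- E, <- Ep, H1 by (eapply Rlt_le_trans; [apply Hq|apply Rmin_l]).
  replace (f p + (i q - i p) * phi q - f p - (i q - i p) * l)
    with ((phi q - l) * (i q - i p)) by ring.
  rewrite Cmod_mult; apply Rmult_le_compat_r; [apply Cmod_ge_0|].
  left; apply H3; eapply Rlt_le_trans; [apply Hq|apply Rmin_r].
Qed.

Lemma der_tends f p l : der i f p l -> tends (fun q => Cmod (i q - i p)) f (f p).
Proof.
intros [phi [H1 H2]].
apply tends_ext with (fun q => f p + (i q - i p) * phi q); [auto|].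
apply tends_eq with (f p + (i p - i p) * l); [|ring].
apply tends_plus; [apply tends_const|].
apply tends_mult; auto.
apply tends_minus; [|apply tends_const].
apply tends_le with 1%R; intros; [lra | apply Cmod_ge_0].
Qed.

Lemma der_const c p : der i (fun _ => c) p 0.
Proof. exists (fun _ => 0); split; [intro; ring | apply tends_const]. Qed.

Lemma der_id p : der i i p 1.
Proof. exists (fun _ => 1); split; [intro; ring | apply tends_const]. Qed.

Lemma der_plus f g p l m : der i f p l -> der i g p m -> der i (fun q => f q + g q) p (l + m).
Proof.
intros [phi [H1 H2]] [psi [H3 H4]]; exists (fun q => phi q + psi q); split.
- intro q; rewrite (H1 q), (H3 q); ring.
- apply tends_plus; auto.
Qed.

Lemma der_mult f g p l m : der i f p l -> der i g p m ->
  der i (fun q => f q * g q) p (l * g p + f p * m).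
Proof.
intros Hf Hg; pose proof (der_tends _ _ _ Hg) as H5.
destruct Hf as [phi [H1 H2]], Hg as [psi [H3 H4]].
exists (fun q => phi q * g q + f p * psi q); split.
- intro q; rewrite (H1 q); rewrite (H3 q) at 1 ; rewrite (H3 q); ring.
- apply tends_plus; apply tends_mult; auto using tends_const.
Qed.

Lemma der_opp f p l : der i f p l -> der i (fun q => - f q) p (- l).
Proof.
intros [phi [H1 H2]]; exists (fun q => - phi q); split.
- intro q; rewrite (H1 q); ring.
- apply tends_opp; auto.
Qed.

Lemma der_minus f g p l m : der i f p l -> der i g p m -> der i (fun q => f q - g q) p (l - m).
Proof. intros; apply der_plus; auto using der_opp. Qed.

Lemma der_comp g f p l m : cder g (f p) m -> der i f p l -> der i (fun q => g (f q)) p (m * l).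
Proof.
intros [psi [H3 H4]] Hf; pose proof (der_tends _ _ _ Hf) as H5; destruct Hf as [phi [H1 H2]].
exists (fun q => psi (f q) * phi q); split.
- intro q; rewrite (H3 (f q)); rewrite (H1 q) at 1; ring.
- apply tends_mult; auto; apply tends_comp with (g := psi) (l := f p); auto.
Qed.

End Der.

Lemma der_inv {T} (i : T -> C) (f : T -> C) (p : T) (l : C) : f p <> 0 -> der i f p l ->
  der i (fun q => / f q) p (- l / (f p * f p)).
Proof.
intros Hp Hf.
apply der_eq with (- / (f p * f p) * l); [|field; auto].
apply der_comp with (g := Cinv); auto.
assert (H0 : (0 < Cmod (f p))%R) by (apply Cmod_gt_0; auto).
apply der_ext_loc with (f := fun w => / f p + (w - f p) * (- / (f p * w))) (r := Cmod (f p)); auto.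
- intros q Hq; assert (q <> 0) by (eapply Cmod_sub_lt_neq; eauto).
  field; auto.
- exists (fun w => - / (f p * w)); split.
  + intro q; ring.
  + apply tends_opp, tends_inv.
    * apply Cmult_neq_0; auto.
    * apply tends_mult; [apply tends_const | apply tends_id].
Qed.

Lemma rder_is_derive f t l : rder f t l ->
  is_derive (fun x => Re (f x)) t (Re l) /\ is_derive (fun x => Im (f x)) t (Im l).
Proof.
intros [phi [H1 H2]]; split; apply is_derive_Reals; intros eps He;
destruct (H2 eps He) as [r [Hr H3]]; exists (mkposreal r Hr); intros h Hh Hhr; simpl in Hhr;
(assert (H4 : (Cmod (phi (t + h) - l) < eps)%R)
  by (apply H3; rewrite <- RtoC_minus, Cmod_R; replace (t + h - t)%R with h by ring; auto));
rewrite (H1 (t + h)%R); (eapply Rle_lt_trans; [|apply H4]).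
- replace ((Re (f t + (RtoC (t + h) - RtoC t) * phi (t + h)%R) - Re (f t)) / h - Re l)%R
    with (Re (phi (t + h)%R - l)); [apply re_le_Cmod|].
  simpl; unfold Re; field; auto.
- replace ((Im (f t + (RtoC (t + h) - RtoC t) * phi (t + h)%R) - Im (f t)) / h - Im l)%R
    with (Im (phi (t + h)%R - l)); [apply im_le_Cmod|].
  simpl; unfold Im; field; auto.
Qed.

Lemma cder_ex_derive f z l : cder f z l -> @ex_derive C_AbsRing C_NormedModule f z.
Proof.
intros [phi [H1 H2]]; exists l; split; [apply is_linear_scal_l|].
intros x Hx eps.
assert (x = z) by (symmetry; exact (@is_filter_lim_locally_unique C_AbsRing (AbsRing_NormedModule C_AbsRing) z x Hx)); subst x.
destruct (H2 eps (cond_pos eps)) as [r [Hr H3]].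
exists (mkposreal r Hr); intros y Hy; simpl in Hy.
change (Cmod (f y - f z - (y - z) * l) <= eps * Cmod (y - z))%R.
rewrite (H1 y).
replace (f z + (y - z) * phi y - f z - (y - z) * l) with ((phi y - l) * (y - z)) by ring.
rewrite Cmod_mult; apply Rmult_le_compat_r; [apply Cmod_ge_0|left; apply H3; exact Hy].
Qed.

Lemma exp_mono (a b : R) : (a <= b)%R -> (exp a <= exp b)%R.
Proof. intros [H|H]; [left; apply exp_increasing; auto | subst; lra]. Qed.

Lemma Cmod_sqr (x : C) : (Cmod x * Cmod x = Re x * Re x + Im x * Im x)%R.
Proof.
unfold Cmod; rewrite sqrt_sqrt; [unfold Re, Im; ring|].
pose proof (pow2_ge_0 (fst x)); pose proof (pow2_ge_0 (snd x)); lra.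
Qed.

Lemma Re_Im_Cauchy (x y : C) : (Re x * Re y + Im x * Im y <= Cmod x * Cmod y)%R.
Proof.
replace (Re x * Re y + Im x * Im y)%R with (Re (x * Cconj y)) by (simpl; unfold Re, Im; ring).
rewrite <- (Cmod_conj y), <- Cmod_mult; apply Re_le_Cmod.
Qed.

(** The mean value theorem fails for complex values. It is applied to the real function
    [Re (conj w * f)] with [w = f b - f a], whose increment is [|w|^2]; division by [|w|] gives the
    bound. *)
Lemma Cbounded_variation_ReIm (f df : R -> C) (D a b : R) : (a <= b)%R ->
  (forall t, a <= t <= b -> is_derive (fun x => Re (f x)) t (Re (df t)) /\
     is_derive (fun x => Im (f x)) t (Im (df t)) /\ Cmod (df t) <= D)%R ->
  (Cmod (f b - f a) <= D * (b - a))%R.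
Proof.
intros Hab H; set (w := f b - f a).
set (g := fun t => (Re w * Re (f t) + Im w * Im (f t))%R).
destruct (MVT_gen g a b (fun t => Re w * Re (df t) + Im w * Im (df t))%R) as [c [Hc E]].
- rewrite Rmin_left, Rmax_right by auto; intros t Ht.
  destruct (H t) as [H1 [H2 _]]; [lra|].
  apply @is_derive_plus; apply @is_derive_scal; auto.
- rewrite Rmin_left, Rmax_right by auto; intros t Ht.
  destruct (H t) as [H1 [H2 _]]; [lra|].
  apply derivable_continuous_pt; eexists; apply is_derive_Reals.
  apply @is_derive_plus; apply @is_derive_scal; eauto.
- rewrite Rmin_left, Rmax_right in Hc by auto.
  destruct (H c Hc) as [_ [_ H3]].
  assert (E1 : (g b - g a = Cmod w * Cmod w)%R).
  { rewrite Cmod_sqr; unfold g, w; simpl; unfold Re, Im; ring. }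
  pose proof (Re_Im_Cauchy w (df c)); pose proof (Cmod_ge_0 w).
  rewrite E1 in E; destruct (Req_dec (Cmod w) 0) as [E0|E0].
  + rewrite E0; pose proof (Cmod_ge_0 (df c)); nra.
  + assert (Cmod w * Cmod w <= Cmod w * (D * (b - a)))%R.
    { rewrite E; apply Rle_trans with (Cmod w * Cmod (df c) * (b - a))%R.
      - apply Rmult_le_compat_r; lra.
      - rewrite Rmult_assoc; apply Rmult_le_compat_l; auto; apply Rmult_le_compat_r; lra. }
    apply Rmult_le_reg_l with (Cmod w); lra.
Qed.

Lemma Cbounded_variation (f df : R -> C) (D a b : R) : (a <= b)%R ->
  (forall t, a <= t <= b -> rder f t (df t) /\ Cmod (df t) <= D)%R ->
  (Cmod (f b - f a) <= D * (b - a))%R.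
Proof.
intros Hab H; apply Cbounded_variation_ReIm with df; auto.
intros t Ht; destruct (H t Ht) as [H1 H2]; destruct (rder_is_derive _ _ _ H1); auto.
Qed.

(** * Exponential and logarithm *)

Lemma Cexp_plus a b : Cexp (a + b) = Cexp a * Cexp b.
Proof.
unfold Cexp; simpl; rewrite exp_plus, cos_plus, sin_plus; apply C_ext; simpl; unfold Re, Im; ring.
Qed.

Lemma Cexp_0 : Cexp 0 = 1.
Proof. unfold Cexp; simpl; rewrite exp_0, cos_0, sin_0; apply C_ext; simpl; ring. Qed.

Lemma Cmod_Cexp w : Cmod (Cexp w) = exp (Re w).
Proof.
unfold Cmod, Cexp; simpl fst; simpl snd.
replace ((exp (Re w) * cos (Im w)) ^ 2 + (exp (Re w) * sin (Im w)) ^ 2)%R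
  with ((exp (Re w))² * ((sin (Im w))² + (cos (Im w))²))%R by (unfold Rsqr; ring).
rewrite sin2_cos2, Rmult_1_r; apply sqrt_Rsqr; left; apply exp_pos.
Qed.

Lemma Cexp_neq_0 w : Cexp w <> 0.
Proof. apply Cmod_gt_0; rewrite Cmod_Cexp; apply exp_pos. Qed.

Lemma Cexp_opp a : Cexp (- a) = / Cexp a.
Proof.
pose proof (Cexp_neq_0 a).
replace (/ Cexp a) with (Cexp (a + - a) / Cexp a).
- rewrite Cexp_plus; field; auto.
- replace (a + - a) with (RtoC 0) by ring; rewrite Cexp_0; field; auto.
Qed.

Lemma Cexp_minus a b : Cexp (a - b) = Cexp a / Cexp b.
Proof. unfold Cminus; rewrite Cexp_plus, Cexp_opp; reflexivity. Qed.

(** Two applications of the mean value inequality on [[0, 1]], to [exp(t h)] and then to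
    [exp(t h) - t h]. The derivatives are computed on real and imaginary parts because the complex
    derivative of [Cexp] is deduced from this bound. *)
Lemma Cexp_scal_sub_bound (h : C) :
  (Cmod (Cexp h - 1 - h) <= Cmod h * Cmod h * exp (Cmod h))%R.
Proof.
assert (D : forall t, is_derive (fun x : R => Re (Cexp (x * h))) t (Re (h * Cexp (t * h))) /\
                 is_derive (fun x : R => Im (Cexp (x * h))) t (Im (h * Cexp (t * h)))).
{ intro t; destruct h as [a b]; split.
  - apply is_derive_ext with (fun x : R => exp (x * a) * cos (x * b))%R.
    + intro x; simpl; unfold Re, Im; simpl; f_equal; f_equal; ring.
    + auto_derive; auto; unfold Cexp; simpl; unfold Re, Im; simpl.
      replace (t * a - 0 * b)%R with (t * a)%R by ring; replace (t * b + 0 * a)%R with (t * b)%R by ring; ring.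
  - apply is_derive_ext with (fun x : R => exp (x * a) * sin (x * b))%R.
    + intro x; simpl; unfold Re, Im; simpl; f_equal; f_equal; ring.
    + auto_derive; auto; unfold Cexp; simpl; unfold Re, Im; simpl.
      replace (t * a - 0 * b)%R with (t * a)%R by ring; replace (t * b + 0 * a)%R with (t * b)%R by ring; ring. }
assert (B1 : forall t, (0 <= t <= 1)%R -> (Cmod (Cexp (t * h)) <= exp (Cmod h))%R).
{ intros t Ht; rewrite Cmod_Cexp.
  apply exp_mono.
  replace (Re (t * h)) with (t * Re h)%R by (simpl; unfold Re; ring).
  pose proof (re_le_Cmod h); pose proof (Rle_abs (Re h)); pose proof (Cmod_ge_0 h); nra. }
pose proof (Cmod_ge_0 h); pose proof (exp_pos (Cmod h)).
assert (B2 : forall t, (0 <= t <= 1)%R -> (Cmod (Cexp (t * h) - 1) <= Cmod h * exp (Cmod h))%R).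
{ intros t Ht.
  apply Rle_trans with (Cmod h * exp (Cmod h) * (t - 0))%R;
    [|assert (0 <= Cmod h * exp (Cmod h))%R by (apply Rmult_le_pos; lra); nra].
  replace (Cexp (t * h) - 1) with (Cexp (t * h) - Cexp (0%R * h)).
  - apply Cbounded_variation_ReIm with (f := fun t : R => Cexp (t * h))
      (df := fun t : R => h * Cexp (t * h)); [lra|].
    intros u Hu; split; [apply D|split; [apply D|]].
    rewrite Cmod_mult; apply Rmult_le_compat_l; auto; apply B1; lra.
  - replace (0%R * h) with (RtoC 0) by ring; rewrite Cexp_0; reflexivity. }
apply Rle_trans with (Cmod h * Cmod h * exp (Cmod h) * (1 - 0))%R; [|lra].
replace (Cexp h - 1 - h) with ((Cexp (1%R * h) - 1%R * h) - (Cexp (0%R * h) - 0%R * h)).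
- apply Cbounded_variation_ReIm with (f := fun t : R => Cexp (t * h) - t * h)
    (df := fun t : R => h * (Cexp (t * h) - 1)); [lra|].
  intros u Hu; destruct (D u) as [D1 D2]; split; [|split].
  + apply is_derive_ext with (fun x : R => Re (Cexp (x * h)) - x * Re h)%R.
    { intro; simpl; unfold Re; ring. }
    replace (Re (h * (Cexp (u * h) - 1))) with (Re (h * Cexp (u * h)) - Re h)%R
      by (simpl; unfold Re; ring).
    apply @is_derive_minus; auto; auto_derive; auto; ring.
  + apply is_derive_ext with (fun x : R => Im (Cexp (x * h)) - x * Im h)%R.
    { intro; simpl; unfold Im; ring. }
    replace (Im (h * (Cexp (u * h) - 1))) with (Im (h * Cexp (u * h)) - Im h)%R
      by (simpl; unfold Im; ring).
    apply @is_derive_minus; auto; auto_derive; auto; ring.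
  + rewrite Cmod_mult, Rmult_assoc; apply Rmult_le_compat_l; auto; apply B2; lra.
- replace (0%R * h) with (RtoC 0) by ring; replace (1%R * h) with h by ring; rewrite Cexp_0; ring.
Qed.

Lemma cder_Cexp z : cder Cexp z (Cexp z).
Proof.
apply der_of_eps; [intros; subst; auto|].
intros eps He; set (K := (Cmod (Cexp z) * exp 1)%R).
assert (HK : (0 < K)%R).
{ apply Rmult_lt_0_compat; [apply Cmod_gt_0, Cexp_neq_0 | apply exp_pos]. }
exists (Rmin 1 (eps / K)); split; [apply Rmin_pos; [lra|apply Rdiv_lt_0_compat; auto]|].
intros w Hw; set (h := w - z) in *.
assert (H1 : (Cmod h < 1)%R) by (eapply Rlt_le_trans; [apply Hw|apply Rmin_l]).
assert (H2 : (Cmod h < eps / K)%R) by (eapply Rlt_le_trans; [apply Hw|apply Rmin_r]).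
replace (Cexp w - Cexp z - h * Cexp z) with (Cexp z * (Cexp h - 1 - h)).
- rewrite Cmod_mult.
  apply Rle_trans with (Cmod (Cexp z) * (Cmod h * Cmod h * exp 1))%R.
  + apply Rmult_le_compat_l; [apply Cmod_ge_0|].
    eapply Rle_trans; [apply Cexp_scal_sub_bound|].
    apply Rmult_le_compat_l; [pose proof (Cmod_ge_0 h); nra|].
    apply exp_mono; lra.
  + replace (Cmod (Cexp z) * (Cmod h * Cmod h * exp 1))%R with (Cmod h * K * Cmod h)%R
      by (unfold K; ring).
    apply Rmult_le_compat_r; [apply Cmod_ge_0|].
    replace eps with (eps / K * K)%R by (field; lra).
    apply Rmult_le_compat_r; lra.
- replace w with (z + h) by (unfold h; ring); rewrite Cexp_plus; ring.
Qed.

Lemma der_Cexp {T} (i : T -> C) f p l : der i f p l ->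
  der i (fun q => Cexp (f q)) p (Cexp (f p) * l).
Proof. intro; apply der_comp; auto using cder_Cexp. Qed.

Lemma tends_Cexp {T} (d : T -> R) f l : tends d f l -> tends d (fun q => Cexp (f q)) (Cexp l).
Proof. apply tends_comp, der_tends with (1 := cder_Cexp l). Qed.

Lemma Cexp_2PI (k : Z) : Cexp (2 * PI * IZR k * Ci) = 1.
Proof.
unfold Cexp; simpl.
replace (((2 * PI - 0 * 0) * IZR k - (2 * 0 + 0 * PI) * 0) * 0 -
   ((2 * PI - 0 * 0) * 0 + (2 * 0 + 0 * PI) * IZR k) * 1)%R with 0%R by ring.
replace (((2 * PI - 0 * 0) * IZR k - (2 * 0 + 0 * PI) * 0) * 1 +
   ((2 * PI - 0 * 0) * 0 + (2 * 0 + 0 * PI) * IZR k) * 0)%R with (2 * IZR k * PI)%R by ring.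
rewrite exp_0, sin_eq_0_1 by (exists (2 * k)%Z; rewrite mult_IZR; reflexivity).
replace (2 * IZR k * PI)%R with (2 * (IZR k * PI))%R by ring.
rewrite cos_2a_sin, sin_eq_0_1 by (exists k; reflexivity).
apply C_ext; simpl; ring.
Qed.

Lemma Cexp_eq_1 w : Cexp w = 1 -> exists k : Z, w = 2 * PI * IZR k * Ci.
Proof.
intro H; assert (E : Re w = 0%R).
{ apply exp_inv; rewrite exp_0, <- Cmod_Cexp, H; apply Cmod_1. }
assert (Hc : cos (Im w) = 1%R) by (apply (f_equal Re) in H; simpl in H; rewrite E, exp_0 in H; lra).
assert (Hs : sin (Im w / 2) = 0%R).
{ replace (Im w) with (2 * (Im w / 2))%R in Hc by field; rewrite cos_2a_sin in Hc; nra. }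
destruct (sin_eq_0_0 _ Hs) as [k Hk]; exists k.
apply C_ext; simpl; [rewrite E; ring|].
replace (Im w) with (2 * (Im w / 2))%R by field; rewrite Hk; ring.
Qed.

Lemma Cexp_eq a b : Cexp a = Cexp b -> exists k : Z, a = b + 2 * PI * IZR k * Ci.
Proof.
intro H; destruct (Cexp_eq_1 (a - b)) as [k Hk].
- rewrite Cexp_minus, H; field; apply Cexp_neq_0.
- exists k; rewrite <- Hk; ring.
Qed.

(** The logarithm is used on the right half-plane only, away from the cut of [Carg]; every other
    branch is obtained by first rotating or rescaling the argument into that half-plane. *)
Lemma Clog_pos (z : C) : (0 < Re z)%R -> Clog z = (ln (Cmod z), atan (Im z / Re z)).
Proof. intro H; unfold Clog, Carg; destruct (Rlt_dec 0 (Re z)); [reflexivity|contradiction]. Qed.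

Lemma Re_pos_neq_0 (z : C) : (0 < Re z)%R -> z <> 0.
Proof. intros H E; subst; simpl in H; lra. Qed.

Lemma Im_Clog_bound (z : C) : (0 < Re z)%R -> (Rabs (Im (Clog z)) < PI / 2)%R.
Proof.
intro H; rewrite Clog_pos by auto; simpl.
pose proof (atan_bound (Im z / Re z)); apply Rabs_def1; lra.
Qed.

Lemma Re_Clog (z : C) : Re (Clog z) = ln (Cmod z).
Proof. reflexivity. Qed.

Lemma Cexp_Clog (z : C) : (0 < Re z)%R -> Cexp (Clog z) = z.
Proof.
intro H; rewrite Clog_pos by auto.
assert (Hz : (0 < Cmod z)%R) by (apply Cmod_gt_0, Re_pos_neq_0; auto).
unfold Cexp; simpl; rewrite exp_ln by auto.
rewrite cos_atan, sin_atan.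
assert (E : Cmod z = (Re z * sqrt (1 + (Im z / Re z)²))%R).
{ rewrite <- (sqrt_Rsqr (Re z)) at 1 by lra; rewrite <- sqrt_mult_alt by apply Rle_0_sqr.
  unfold Cmod; f_equal; unfold Rsqr, Re, Im in *; field; lra. }
assert (Hs : (0 < sqrt (1 + (Im z / Re z)²))%R).
{ apply sqrt_lt_R0; pose proof (Rle_0_sqr (Im z / Re z)); lra. }
rewrite E; apply C_ext; simpl; field; lra.
Qed.

Lemma Clog_Cexp (w : C) : (Rabs (Im w) < PI / 2)%R -> Clog (Cexp w) = w.
Proof.
intro H; apply Rabs_def2 in H.
assert (Hc : (0 < cos (Im w))%R) by (apply cos_gt_0; lra).
pose proof (exp_pos (Re w)).
rewrite Clog_pos by (simpl; nra).
apply C_ext; simpl.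
- rewrite Cmod_Cexp; apply ln_exp.
- replace (exp (Re w) * sin (Im w) / (exp (Re w) * cos (Im w)))%R with (tan (Im w))
    by (unfold tan; field; lra).
  apply atan_tan; lra.
Qed.

Lemma Re_Cexp_pos (w : C) : (Rabs (Im w) < PI / 2)%R -> (0 < Re (Cexp w))%R.
Proof.
intro H; apply Rabs_def2 in H; simpl; apply Rmult_lt_0_compat; [apply exp_pos|apply cos_gt_0; lra].
Qed.

Lemma Re_pos_near (z w : C) : (Cmod (w - z) < Re z)%R -> (0 < Re w)%R.
Proof.
intro H; pose proof (Re_le_Cmod (z - w)) as H1; rewrite Cmod_sub_sym in H1.
replace (Re (z - w)) with (Re z - Re w)%R in H1 by reflexivity; lra.
Qed.

Lemma tends_Clog {T} (d : T -> R) (f : T -> C) (l : C) : (0 < Re l)%R ->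
  tends d f l -> tends d (fun q => Clog (f q)) (Clog l).
Proof.
intros Hl Hf; apply tends_comp with (g := Clog) (l := l); auto; clear f Hf.
apply tends_ext_loc with (r := Re l)
  (f := fun w => RtoC (ln (Cmod w)) + Ci * RtoC (atan (Re (RtoC (Im w) * / RtoC (Re w))))).
- auto.
- unfold at_pt; intros w Hw.
  assert (0 < Re w)%R by (apply Re_pos_near with l; exact Hw).
  rewrite Clog_pos by auto.
  assert (E : Re (RtoC (Im w) * / RtoC (Re w)) = (Im w / Re w)%R).
  { rewrite <- RtoC_inv, <- RtoC_mult by lra; reflexivity. }
  rewrite E; apply C_ext; simpl; ring.
- rewrite Clog_pos by auto.
  assert (E : Re (RtoC (Im l) * / RtoC (Re l)) = (Im l / Re l)%R).
  { rewrite <- RtoC_inv, <- RtoC_mult by lra; reflexivity. }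
  apply tends_eq with (RtoC (ln (Cmod l)) + Ci * RtoC (atan (Re (RtoC (Im l) * / RtoC (Re l)))));
    [|rewrite E; apply C_ext; simpl; ring].
  assert (0 < Cmod l)%R by (apply Cmod_gt_0, Re_pos_neq_0; auto).
  apply tends_plus; [|apply tends_mult; [apply tends_const|]].
  + apply tends_compR with (f := Cmod); [|apply tends_Cmod, tends_id].
    apply derivable_continuous_pt; eexists; apply derivable_pt_lim_ln; auto.
  + apply tends_compR.
    * apply derivable_continuous_pt, derivable_pt_atan.
    * apply tends_Re, tends_mult; [apply tends_Im, tends_id|].
      apply tends_inv; [|apply tends_Re, tends_id].
      intro E1; apply RtoC_inj in E1; lra.
Qed.

(** Inverting Caratheodory's slope function of [Cexp]. *)
Lemma cder_Clog (z : C) : (0 < Re z)%R -> cder Clog z (/ z).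
Proof.
intro Hz; destruct (cder_Cexp (Clog z)) as [phi [H1 H2]].
rewrite (Cexp_Clog z Hz) in H2.
assert (H3 : tends (at_pt z) (fun w => phi (Clog w)) z).
{ apply tends_comp with (g := phi) (l := Clog z); auto; apply tends_Clog; auto using tends_id. }
pose proof (Re_pos_neq_0 _ Hz) as Hz0.
destruct (tends_neq _ _ _ 0 H3 Hz0) as [r [Hr H4]].
apply der_ext_loc with (r := Rmin r (Re z)) (f := fun w => Clog z + (w - z) * / phi (Clog w)).
- apply Rmin_pos; auto.
- auto.
- intros w Hw.
  assert (Hw1 : (0 < Re w)%R)
    by (apply Re_pos_near with z; eapply Rlt_le_trans; [apply Hw|apply Rmin_r]).
  assert (Hw2 : phi (Clog w) <> 0) by (apply H4; eapply Rlt_le_trans; [apply Hw|apply Rmin_l]).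
  pose proof (H1 (Clog w)) as E; rewrite !Cexp_Clog in E by auto.
  replace (w - z) with ((Clog w - Clog z) * phi (Clog w)); [field; auto|].
  rewrite E at 3; ring.
- exists (fun w => / phi (Clog w)); split; [intro; ring|].
  apply tends_inv; auto.
Qed.

Lemma der_Clog {T} (i : T -> C) (f : T -> C) p l : (0 < Re (f p))%R -> der i f p l ->
  der i (fun q => Clog (f q)) p (/ f p * l).
Proof. intros; apply der_comp with (g := Clog); auto using cder_Clog. Qed.

Lemma Clog_1 : Clog 1 = 0.
Proof. rewrite <- Cexp_0, Clog_Cexp; [reflexivity|]. simpl; rewrite Rabs_R0; pose proof PI_RGT_0; lra. Qed.

(** * Integrals of complex valued functions *)

Definition at_R (t : R) : R -> R := fun x => Cmod (RtoC x - RtoC t).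

Definition conR (F : R -> C) (t : R) : Prop := tends (at_R t) F (F t).

Definition CInt (F : R -> C) (a b : R) : C :=
  (RInt (fun t => Re (F t)) a b, RInt (fun t => Im (F t)) a b).

Lemma at_RE t x : at_R t x = Rabs (x - t).
Proof. unfold at_R; rewrite <- RtoC_minus, Cmod_R; reflexivity. Qed.

Lemma rder_conR F t l : rder F t l -> conR F t.
Proof. apply der_tends. Qed.

Lemma conR_continuous F t : conR F t ->
  continuous (fun x => Re (F x)) t /\ continuous (fun x => Im (F x)) t.
Proof.
intro H; split; apply (proj2 (filterlim_locally _ _)); intro eps;
destruct (H eps (cond_pos eps)) as [r [Hr H1]]; exists (mkposreal r Hr);
intros y Hy; (assert (Hy' : (at_R t y < r)%R) by (rewrite at_RE; exact Hy));
(eapply Rle_lt_trans; [|apply (H1 y Hy')]).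
- change (Rabs (Re (F y - F t)) <= Cmod (F y - F t))%R; apply re_le_Cmod.
- change (Rabs (Im (F y - F t)) <= Cmod (F y - F t))%R; apply im_le_Cmod.
Qed.

Section OnInterval.
Variables (a b : R).
Hypothesis (Hab : (a <= b)%R).

Definition con_on (F : R -> C) := forall t, (a <= t <= b)%R -> conR F t.

Lemma con_on_ex F : con_on F ->
  ex_RInt (fun t => Re (F t)) a b /\ ex_RInt (fun t => Im (F t)) a b.
Proof.
intro H; split; apply (ex_RInt_continuous (V := R_CompleteNormedModule));
rewrite Rmin_left, Rmax_right by auto; intros; apply conR_continuous; auto.
Qed.

(** Pairing the integral [w] with itself turns [|w|^2] into the integral of the real function
    [Re (conj w * F)], to which monotonicity of the real integral applies. *)
Lemma CInt_le F (g : R -> R) : con_on F -> ex_RInt g a b ->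
  (forall t, a <= t <= b -> Cmod (F t) <= g t)%R -> (Cmod (CInt F a b) <= RInt g a b)%R.
Proof.
intros HF Hg H; destruct (con_on_ex F HF) as [H1 H2].
set (w := CInt F a b).
assert (E : (Cmod w * Cmod w = RInt (fun t => Re w * Re (F t) + Im w * Im (F t)) a b)%R).
{ rewrite Cmod_sqr; symmetry; apply is_RInt_unique.
  apply @is_RInt_plus; apply @is_RInt_scal; apply @RInt_correct; auto. }
assert (E1 : (RInt (fun t => Re w * Re (F t) + Im w * Im (F t)) a b
   <= RInt (fun t => Cmod w * g t) a b)%R).
{ apply RInt_le; auto.
  - apply @ex_RInt_plus; apply @ex_RInt_scal; auto.
  - apply @ex_RInt_scal; auto.
  - intros t Ht; eapply Rle_trans; [apply Re_Im_Cauchy|].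
    apply Rmult_le_compat_l; [apply Cmod_ge_0 | apply H; lra]. }
assert (E2 : (RInt (fun t => Cmod w * g t) a b = Cmod w * RInt g a b)%R).
{ apply is_RInt_unique, @is_RInt_scal, @RInt_correct; auto. }
rewrite E2 in E1; rewrite <- E in E1.
pose proof (Cmod_ge_0 w) as H0; destruct H0 as [H0|H0].
- apply Rmult_le_reg_l with (Cmod w); auto.
- rewrite <- H0; apply RInt_ge_0; auto.
  intros t Ht; eapply Rle_trans; [apply Cmod_ge_0|apply H; lra].
Qed.

Lemma CInt_le_const F D : con_on F ->
  (forall t, a <= t <= b -> Cmod (F t) <= D)%R -> (Cmod (CInt F a b) <= D * (b - a))%R.
Proof.
intros HF H; eapply Rle_trans; [apply CInt_le with (g := fun _ => D); auto; apply ex_RInt_const|].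
rewrite RInt_const; right; unfold scal; simpl; unfold mult; simpl; ring.
Qed.

Lemma CInt_derive F dF : (forall t, a <= t <= b -> rder F t (dF t))%R -> con_on dF ->
  CInt dF a b = F b - F a.
Proof.
intros H Hc; unfold CInt; apply C_ext; simpl; apply is_RInt_unique.
- apply (is_RInt_derive (V := R_CompleteNormedModule) (fun t => Re (F t)) (fun t => Re (dF t)));
  rewrite Rmin_left, Rmax_right by auto; intros t Ht.
  + apply (rder_is_derive _ _ _ (H t Ht)).
  + apply conR_continuous; auto.
- apply (is_RInt_derive (V := R_CompleteNormedModule) (fun t => Im (F t)) (fun t => Im (dF t)));
  rewrite Rmin_left, Rmax_right by auto; intros t Ht.
  + apply (rder_is_derive _ _ _ (H t Ht)).
  + apply conR_continuous; auto.
Qed.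

Lemma CInt_ext F G : (forall t, a <= t <= b -> F t = G t)%R -> CInt F a b = CInt G a b.
Proof.
intro H; unfold CInt; f_equal; apply RInt_ext; rewrite Rmin_left, Rmax_right by auto;
intros t Ht; rewrite H; auto; lra.
Qed.

Lemma CInt_plus F G : con_on F -> con_on G ->
  CInt (fun t => F t + G t) a b = CInt F a b + CInt G a b.
Proof.
intros HF HG; destruct (con_on_ex F HF), (con_on_ex G HG).
unfold CInt; apply C_ext; simpl; apply is_RInt_unique, @is_RInt_plus; apply @RInt_correct; auto.
Qed.

Lemma CInt_scal F c : con_on F -> CInt (fun t => c * F t) a b = c * CInt F a b.
Proof.
intros HF; destruct (con_on_ex F HF).
unfold CInt; apply C_ext; simpl; apply is_RInt_unique.
- apply @is_RInt_minus; apply @is_RInt_scal; apply @RInt_correct; auto.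
- apply @is_RInt_plus; apply @is_RInt_scal; apply @RInt_correct; auto.
Qed.

End OnInterval.

Lemma CInt_Chasles F a b c : (a <= b <= c)%R -> con_on a c F ->
  CInt F a b + CInt F b c = CInt F a c.
Proof.
intros H HF.
assert (H1 : con_on a b F) by (intros t Ht; apply HF; lra).
assert (H2 : con_on b c F) by (intros t Ht; apply HF; lra).
destruct (con_on_ex a b (proj1 H) F H1), (con_on_ex b c (proj2 H) F H2).
unfold CInt; apply C_ext; simpl; apply (RInt_Chasles (V := R_CompleteNormedModule)); auto.
Qed.

(** * Integrals of exponentially decaying functions over the half-line *)

Definition expdec (F : R -> C) (K k : R) : Prop :=
  (0 < k)%R /\ (forall t, (0 <= t)%R -> conR F t) /\
  (forall t, (0 <= t)%R -> (Cmod (F t) <= K * exp (- k * t))%R).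

(** A total function: the limit is taken along the integers and extracted by [Lim_seq]. Under
    [expdec] its value is characterised by [int_half_line_correct]. *)
Definition int_half_line (F : R -> C) : C :=
  (real (Lim_seq (fun n => Re (CInt F 0 (INR n)))), real (Lim_seq (fun n => Im (CInt F 0 (INR n))))).

Lemma exp_small (K k eps : R) : (0 < k)%R -> (0 < eps)%R ->
  exists T, (0 <= T)%R /\ forall t, (T <= t)%R -> (K * exp (- k * t) < eps)%R.
Proof.
intros Hk He; pose proof (Rabs_pos K).
exists (Rabs K / (eps * k))%R; split; [apply Rdiv_le_0_compat; nra|].
intros t Ht.
assert (H1 : (1 + k * t <= exp (k * t))%R) by apply exp_ineq1_le.
assert (H2 : (Rabs K <= eps * k * t)%R).
{ replace (Rabs K) with (eps * k * (Rabs K / (eps * k)))%R by (field; lra).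
  apply Rmult_le_compat_l; nra. }
replace (- k * t)%R with (- (k * t))%R by ring; rewrite exp_Ropp.
apply Rmult_lt_reg_r with (exp (k * t)); [apply exp_pos|].
pose proof (exp_pos (k * t)); rewrite Rmult_assoc, Rinv_l by lra.
pose proof (Rle_abs K); nra.
Qed.

Lemma RInt_exp (K k a b : R) : (0 < k)%R ->
  is_RInt (fun t => K * exp (- k * t))%R a b (K / k * exp (- k * a) - K / k * exp (- k * b))%R.
Proof.
intro Hk.
replace (K / k * exp (- k * a) - K / k * exp (- k * b))%R
  with (minus (- (K / k) * exp (- k * b))%R (- (K / k) * exp (- k * a))%R)
  by (unfold minus, plus, opp; simpl; ring).
apply (is_RInt_derive (V := R_CompleteNormedModule) (fun t => - (K / k) * exp (- k * t))%R).
- intros t _; auto_derive; auto; field; lra.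
- intros t _; apply (ex_derive_continuous (V := R_NormedModule)); auto_derive; auto.
Qed.

Lemma expdec_CInt F K k a b : expdec F K k -> (0 <= a <= b)%R ->
  (Cmod (CInt F a b) <= K / k * exp (- k * a))%R.
Proof.
intros [Hk [Hc Hb]] Hab.
pose proof (RInt_exp K k a b Hk) as HI.
eapply Rle_trans; [apply CInt_le with (g := fun t => (K * exp (- k * t))%R)|].
- lra.
- intros t Ht; apply Hc; lra.
- eexists; apply HI.
- intros t Ht; apply Hb; lra.
- rewrite (is_RInt_unique _ _ _ _ HI).
  assert (0 <= K)%R.
  { specialize (Hb 0%R (Rle_refl 0)); rewrite Rmult_0_r, exp_0 in Hb.
    pose proof (Cmod_ge_0 (F 0%R)); lra. }
  assert (0 <= K / k)%R by (apply Rdiv_le_0_compat; lra).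
  assert (0 <= K / k * exp (- k * b))%R by (apply Rmult_le_pos; [auto|left; apply exp_pos]); lra.
Qed.

(** The partial integrals form a Cauchy sequence because the part beyond [T] is at most
    [K / k * exp (- k * T)], and this tail bound passes to the limit. Later exchanges of limit and
    integral rest on it. *)
Lemma int_half_line_correct F K k T : expdec F K k -> (0 <= T)%R ->
  (Cmod (int_half_line F - CInt F 0 T) <= K / k * exp (- k * T))%R.
Proof.
intros HF HT; pose proof HF as [Hk [Hc Hb]].
set (u := fun n => CInt F 0 (INR n)).
assert (Hu : forall T1 T2, (0 <= T1 <= T2)%R -> CInt F 0 T2 - CInt F 0 T1 = CInt F T1 T2).
{ intros T1 T2 H12; rewrite <- (CInt_Chasles F 0 T1 T2); [ring|lra|].
  intros t Ht; apply Hc; lra. }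
assert (HC : forall eps, (0 < eps)%R -> exists N, forall n m, (N <= n)%nat -> (N <= m)%nat ->
  (Cmod (u n - u m) < eps)%R).
{ intros eps He; destruct (exp_small (K / k) k eps Hk He) as [T0 [HT0 H0]].
  destruct (nfloor_ex T0 HT0) as [N HN]; exists (S N).
  assert (W : forall n m, (S N <= n)%nat -> (n <= m)%nat -> (Cmod (u m - u n) < eps)%R).
  { intros n m Hn Hm; unfold u; apply le_INR in Hn; apply le_INR in Hm; rewrite S_INR in Hn.
    pose proof (pos_INR N).
    rewrite Hu by lra; eapply Rle_lt_trans; [apply (expdec_CInt F K k); auto; lra|].
    apply H0; lra. }
  intros n m Hn Hm; destruct (Nat.le_ge_cases n m).
  - rewrite Cmod_sub_sym; auto.
  - auto. }
assert (L1 : is_lim_seq (fun n => Re (u n)) (Re (int_half_line F))).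
{ apply Lim_seq_correct', ex_lim_seq_cauchy_corr; intro eps.
  destruct (HC eps (cond_pos eps)) as [N HN]; exists N; intros n m Hn Hm.
  eapply Rle_lt_trans; [|apply (HN n m Hn Hm)].
  change (Rabs (Re (u n - u m)) <= Cmod (u n - u m))%R; apply re_le_Cmod. }
assert (L2 : is_lim_seq (fun n => Im (u n)) (Im (int_half_line F))).
{ apply Lim_seq_correct', ex_lim_seq_cauchy_corr; intro eps.
  destruct (HC eps (cond_pos eps)) as [N HN]; exists N; intros n m Hn Hm.
  eapply Rle_lt_trans; [|apply (HN n m Hn Hm)].
  change (Rabs (Im (u n - u m)) <= Cmod (u n - u m))%R; apply im_le_Cmod. }
apply le_epsilon; intros eps He.
apply is_lim_seq_spec in L1; apply is_lim_seq_spec in L2.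
assert (He2 : (0 < eps / 2)%R) by lra.
destruct (L1 (mkposreal _ He2)) as [N1 HN1]; destruct (L2 (mkposreal _ He2)) as [N2 HN2].
destruct (nfloor_ex T HT) as [N3 HN3].
set (n := (S N3 + N1 + N2)%nat).
assert (Hn : (T <= INR n)%R).
{ unfold n; rewrite !plus_INR, S_INR; pose proof (pos_INR N1); pose proof (pos_INR N2); lra. }
specialize (HN1 n ltac:(unfold n; lia)); specialize (HN2 n ltac:(unfold n; lia)); cbn [pos] in HN1, HN2.
eapply Rle_trans; [apply Cmod_sub_triangle with (y := u n)|].
assert (Cmod (u n - CInt F 0 T) <= K / k * exp (- k * T))%R.
{ unfold u; rewrite Hu by lra; apply expdec_CInt; auto. }
assert (Cmod (int_half_line F - u n) <= eps)%R; [|lra].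
rewrite Cmod_sub_sym.
eapply Rle_trans; [apply Cmod_le_Re_Im|].
change (Re (u n - int_half_line F)) with (Re (u n) - Re (int_half_line F))%R.
change (Im (u n - int_half_line F)) with (Im (u n) - Im (int_half_line F))%R; lra.
Qed.

Lemma int_half_line_unique F K k l : expdec F K k ->
  (forall eps, (0 < eps)%R -> exists T0, forall T, (T0 <= T)%R -> (0 <= T)%R ->
    (Cmod (l - CInt F 0 T) < eps)%R) -> int_half_line F = l.
Proof.
intros HF H; apply NNPP; intro Hn; apply Cmod_pos_sub in Hn; set (e := Cmod (int_half_line F - l)) in *.
destruct (H (e / 2)%R) as [T1 H1]; [lra|].
destruct (exp_small (K / k) k (e / 2)%R) as [T2 [HT2 H2]]; [apply HF|lra|].
set (T := Rmax T1 T2).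
assert (T1 <= T)%R by apply Rmax_l; assert (T2 <= T)%R by apply Rmax_r.
specialize (H1 T ltac:(auto) ltac:(lra)); specialize (H2 T ltac:(auto)).
pose proof (int_half_line_correct F K k T HF ltac:(lra)).
pose proof (Cmod_sub_triangle (int_half_line F) (CInt F 0 T) l) as H6.
rewrite (Cmod_sub_sym (CInt F 0 T)) in H6; fold e in H6; lra.
Qed.

Lemma expdec_plus F G K L k : expdec F K k -> expdec G L k ->
  expdec (fun t => F t + G t) (K + L) k.
Proof.
intros [Hk [Hc Hb]] [_ [Hc' Hb']]; repeat split; auto.
- intros t Ht; apply tends_plus; [apply Hc | apply Hc']; auto.
- intros t Ht; eapply Rle_trans; [apply Cmod_triangle|].
  rewrite Rmult_plus_distr_r; apply Rplus_le_compat; auto.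
Qed.

Lemma expdec_scal F c K k : expdec F K k -> expdec (fun t => c * F t) (Cmod c * K) k.
Proof.
intros [Hk [Hc Hb]]; repeat split; auto.
- intros t Ht; apply tends_mult; [apply tends_const | apply Hc; auto].
- intros t Ht; rewrite Cmod_mult, Rmult_assoc; apply Rmult_le_compat_l; auto; apply Cmod_ge_0.
Qed.

Lemma expdec_le F K L k : (K <= L)%R -> expdec F K k -> expdec F L k.
Proof.
intros HKL [Hk [Hc Hb]]; repeat split; auto.
intros t Ht; eapply Rle_trans; [apply Hb; auto|]; apply Rmult_le_compat_r; auto; left; apply exp_pos.
Qed.

Lemma int_half_line_ext F G : (forall t, (0 <= t)%R -> F t = G t) -> int_half_line F = int_half_line G.
Proof.
intro H; unfold int_half_line; f_equal; f_equal; apply Lim_seq_ext; intro n;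
rewrite (CInt_ext 0 (INR n) (pos_INR n) F G); auto; intros; apply H; lra.
Qed.

Lemma int_half_line_plus F G K L k : expdec F K k -> expdec G L k ->
  int_half_line (fun t => F t + G t) = int_half_line F + int_half_line G.
Proof.
intros HF HG; pose proof (expdec_plus _ _ _ _ _ HF HG) as HS.
apply (int_half_line_unique _ _ _ _ HS); intros eps He.
destruct (exp_small ((K + L) / k) k eps) as [T0 [HT0 H0]]; [apply HF|auto|].
exists T0; intros T HT HT1.
rewrite CInt_plus; try (intros t Ht; apply HF || apply HG; lra); try lra.
replace (int_half_line F + int_half_line G - (CInt F 0 T + CInt G 0 T))
  with ((int_half_line F - CInt F 0 T) + (int_half_line G - CInt G 0 T)) by ring.
eapply Rle_lt_trans; [apply Cmod_triangle|].
pose proof (int_half_line_correct _ _ _ T HF HT1); pose proof (int_half_line_correct _ _ _ T HG HT1).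
specialize (H0 T HT); unfold Rdiv in *; lra.
Qed.

Lemma int_half_line_scal F c K k : expdec F K k -> int_half_line (fun t => c * F t) = c * int_half_line F.
Proof.
intros HF; pose proof (expdec_scal _ c _ _ HF) as HS.
apply (int_half_line_unique _ _ _ _ HS); intros eps He.
destruct (exp_small (Cmod c * K / k) k eps) as [T0 [HT0 H0]]; [apply HF|auto|].
exists T0; intros T HT HT1.
rewrite CInt_scal; try (intros t Ht; apply HF; lra); try lra.
replace (c * int_half_line F - c * CInt F 0 T) with (c * (int_half_line F - CInt F 0 T)) by ring.
rewrite Cmod_mult.
pose proof (int_half_line_correct _ _ _ T HF HT1); specialize (H0 T HT); unfold Rdiv in *.
eapply Rle_lt_trans; [apply Rmult_le_compat_l; [apply Cmod_ge_0|eauto]|lra].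
Qed.

Lemma int_half_line_minus F G K L k : expdec F K k -> expdec G L k ->
  int_half_line (fun t => F t - G t) = int_half_line F - int_half_line G.
Proof.
intros HF HG; rewrite (int_half_line_ext _ (fun t => F t + (- (1)) * G t)) by (intros; ring).
rewrite (int_half_line_plus _ _ _ _ _ HF (expdec_scal _ _ _ _ HG)), (int_half_line_scal _ _ _ _ HG); ring.
Qed.

Lemma int_half_line_bound F K k : expdec F K k -> (Cmod (int_half_line F) <= K / k)%R.
Proof.
intro HF; pose proof (int_half_line_correct _ _ _ 0 HF (Rle_refl 0)) as H.
rewrite Rmult_0_r, exp_0, Rmult_1_r in H.
assert (E : CInt F 0 0 = 0).
{ unfold CInt; rewrite !RInt_point; reflexivity. }
rewrite E in H; replace (int_half_line F - 0) with (int_half_line F) in H by ring; auto.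
Qed.

(** Integrations by parts go through this lemma: the integrand is recognised as a total derivative
    whose primitive decays, and only the boundary value at [0] survives. *)
Lemma int_half_line_derive F dF K L k : expdec dF K k ->
  (forall t, (0 <= t)%R -> rder F t (dF t)) ->
  (forall t, (0 <= t)%R -> (Cmod (F t) <= L * exp (- k * t))%R) -> int_half_line dF = - F 0%R.
Proof.
intros HF HD HL; apply (int_half_line_unique _ _ _ _ HF); intros eps He.
destruct (exp_small L k eps) as [T0 [HT0 H0]]; [apply HF|auto|].
exists T0; intros T HT HT1.
rewrite CInt_derive with (F := F); [|lra|intros; apply HD; lra|intros t Ht; apply HF; lra].
replace (- F 0%R - (F T - F 0%R)) with (- F T) by ring; rewrite Cmod_opp.
eapply Rle_lt_trans; [apply HL; auto|apply H0; auto].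
Qed.

(** * Integrals depending on a parameter *)

(** Mean value inequality along the segment for the map [u -> f u - u * l]. It bounds the remainder
    of the first order expansion by the oscillation of the derivative, as differentiation under the
    integral sign requires. *)
Lemma cder_segment_bound (f df : C -> C) (z w l : C) (r D : R) :
  (forall u, (Cmod (u - z) < r)%R -> cder f u (df u) /\ (Cmod (df u - l) <= D)%R) ->
  (Cmod (w - z) < r)%R ->
  (Cmod (f w - f z - (w - z) * l) <= D * Cmod (w - z))%R.
Proof.
intros H Hw; set (h := w - z).
replace (f w - f z - h * l) with ((f (z + 1%R * h) - 1%R * h * l) - (f (z + 0%R * h) - 0%R * h * l)).
- replace (D * Cmod h)%R with (D * Cmod h * (1 - 0))%R by ring.
  apply Cbounded_variation with (f := fun t : R => f (z + t * h) - t * h * l)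
    (df := fun t : R => (df (z + t * h) - l) * h); [lra|].
  intros t Ht.
  assert (Ht' : (Cmod (z + t * h - z) < r)%R).
  { replace (z + t * h - z) with (t * h) by ring.
    rewrite Cmod_mult, Cmod_R, Rabs_pos_eq by lra; pose proof (Cmod_ge_0 h); unfold h in *; nra. }
  destruct (H _ Ht') as [H1 H2]; split.
  + apply der_eq with (df (z + t * h) * (0 + (1 * h + t * 0)) - ((1 * h + t * 0) * l + t * h * 0));
      [|ring].
    apply der_minus.
    * apply der_comp; auto.
      apply der_plus; [apply der_const|]. apply der_mult; [apply der_id|apply der_const].
    * apply (der_mult _ (fun t : R => t * h) (fun _ => l)); [|apply der_const].
      apply der_mult; [apply der_id|apply der_const].
  + rewrite Cmod_mult; apply Rmult_le_compat_r; [apply Cmod_ge_0|auto].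
- replace (z + 1%R * h) with w by (unfold h; ring); replace (z + 0%R * h) with z by ring; ring.
Qed.

Definition joint {T : Type} (d : T -> R) (F : T -> R -> C) (p : T) (y : R) : Prop :=
  tends (fun q : T * R => Rmax (d (fst q)) (at_R y (snd q))) (fun q => F (fst q) (snd q)) (F p y).

Section Joint.
Context {T : Type} (d : T -> R) (p0 : T).

Lemma joint_slice (f : T -> C) l y : tends d f l ->
  tends (fun q : T * R => Rmax (d (fst q)) (at_R y (snd q))) (fun q => f (fst q)) l.
Proof.
intros H eps He; destruct (H eps He) as [r [Hr H1]]; exists r; split; auto.
intros q Hq; apply H1; eapply Rle_lt_trans; [apply Rmax_l|apply Hq].
Qed.

Lemma joint_sliceR (f : R -> C) y : conR f y ->
  tends (fun q : T * R => Rmax (d (fst q)) (at_R y (snd q))) (fun q => f (snd q)) (f y).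
Proof.
intros H eps He; destruct (H eps He) as [r [Hr H1]]; exists r; split; auto.
intros q Hq; apply H1; eapply Rle_lt_trans; [apply Rmax_r|apply Hq].
Qed.

Lemma joint_RtoC y :
  tends (fun q : T * R => Rmax (d (fst q)) (at_R y (snd q))) (fun q => RtoC (snd q)) y.
Proof.
apply (joint_sliceR RtoC); apply tends_le with 1%R; unfold at_R; intros; [lra|apply Cmod_ge_0].
Qed.

Hypothesis Hd : d p0 = 0%R.

(** This is the tube lemma. Joint continuity furnishes a radius around each [y], and
    [compactness_value_1d] a common lower bound for the radii in use. That result is doubly negated,
    whence the appeal to [NNPP]. *)
Lemma joint_uniform (F : T -> R -> C) a b :
  (forall y, (a <= y <= b)%R -> joint d F p0 y) ->
  forall eps, (0 < eps)%R -> exists delta, (0 < delta)%R /\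
    forall p y, (d p < delta)%R -> (a <= y <= b)%R -> (Cmod (F p y - F p0 y) < eps)%R.
Proof.
intros H eps He.
assert (H1 : forall y, exists r : posreal, (a <= y <= b)%R -> forall p y',
  (d p < r)%R -> (Rabs (y' - y) < r)%R -> (Cmod (F p y' - F p0 y) < eps / 2)%R).
{ intro y; destruct (classic (a <= y <= b)%R) as [Hy|Hy].
  - destruct (H y Hy (eps / 2)%R) as [r [Hr Hr1]]; [lra|].
    exists (mkposreal r Hr); intros _ p y' Hp Hy'; apply (Hr1 (p, y')); simpl.
    rewrite at_RE; apply Rmax_lub_lt; auto.
  (* The compactness lemma takes a gauge on the whole real line; outside [[a, b]] the radius is an
     arbitrary default. *)
  - exists (mkposreal 1 Rlt_0_1); intro; contradiction. }
destruct (choice _ H1) as [dl Hdl].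
destruct (compactness_value_1d a b dl) as [delta Hdelta].
exists delta; split; [apply cond_pos|].
intros p y Hp Hy; apply NNPP; intro Hn; apply (Hdelta y Hy); intros [t [Ht [H2 H3]]]; apply Hn.
eapply Rle_lt_trans; [apply Cmod_sub_triangle with (y := F p0 t)|].
assert (H4 : (Cmod (F p y - F p0 t) < eps / 2)%R) by (apply Hdl; auto; lra).
assert (H5 : (Cmod (F p0 y - F p0 t) < eps / 2)%R).
{ apply Hdl; auto; rewrite Hd; apply cond_pos. }
rewrite (Cmod_sub_sym (F p0 t)); lra.
Qed.

Lemma CInt_tends (F : T -> R -> C) a b r : (a <= b)%R -> (0 < r)%R ->
  (forall y, (a <= y <= b)%R -> joint d F p0 y) ->
  (forall p, (d p < r)%R -> con_on a b (F p)) ->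
  tends d (fun p => CInt (F p) a b) (CInt (F p0) a b).
Proof.
intros Hab Hr HJ Hc eps He.
destruct (joint_uniform F a b HJ (eps / (b - a + 1))%R) as [r' [Hr' H]];
  [apply Rdiv_lt_0_compat; lra|].
exists (Rmin r r'); split; [apply Rmin_pos; auto|]; intros p Hp.
assert (Hp1 : (d p < r)%R) by (eapply Rlt_le_trans; [apply Hp|apply Rmin_l]).
assert (Hp2 : (d p < r')%R) by (eapply Rlt_le_trans; [apply Hp|apply Rmin_r]).
assert (Hc0 : con_on a b (F p0)) by (apply Hc; rewrite Hd; auto).
replace (CInt (F p) a b - CInt (F p0) a b) with (CInt (fun y => F p y + (- (1)) * F p0 y) a b).
- eapply Rle_lt_trans; [apply CInt_le_const with (D := (eps / (b - a + 1))%R); auto|].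
  + intros t Ht; apply tends_plus; [apply Hc; auto|].
    apply tends_mult; [apply tends_const|apply Hc0; auto].
  + intros t Ht; replace (F p t + - (1) * F p0 t) with (F p t - F p0 t) by ring; left; auto.
  + replace eps with (eps / (b - a + 1) * (b - a + 1))%R at 2 by (field; lra).
    apply Rmult_lt_compat_l; [apply Rdiv_lt_0_compat|]; lra.
- rewrite CInt_plus, CInt_scal; auto; [ring|].
  intros t Ht; apply tends_mult; [apply tends_const|apply Hc0; auto].
Qed.

Lemma int_half_line_tends (F : T -> R -> C) K k r : (0 < r)%R ->
  (forall y, (0 <= y)%R -> joint d F p0 y) ->
  (forall p, (d p < r)%R -> expdec (F p) K k) ->
  tends d (fun p => int_half_line (F p)) (int_half_line (F p0)).
Proof.
intros Hr HJ HE eps He.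
assert (H0 : expdec (F p0) K k) by (apply HE; rewrite Hd; auto).
destruct (exp_small (K / k) k (eps / 4)%R) as [X [HX HX1]]; [apply H0|lra|].
specialize (HX1 X (Rle_refl X)).
destruct (CInt_tends F 0 X r HX Hr) with (eps := (eps / 4)%R) as [r' [Hr' H]].
- intros y Hy; apply HJ; lra.
- intros p Hp t Ht; apply (HE p Hp); lra.
- lra.
- exists (Rmin r r'); split; [apply Rmin_pos; auto|]; intros p Hp.
  assert (Hp1 : (d p < r)%R) by (eapply Rlt_le_trans; [apply Hp|apply Rmin_l]).
  assert (Hp2 : (d p < r')%R) by (eapply Rlt_le_trans; [apply Hp|apply Rmin_r]).
  pose proof (int_half_line_correct _ _ _ X (HE p Hp1) HX); pose proof (int_half_line_correct _ _ _ X H0 HX) as H3.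
  specialize (H p Hp2); rewrite Cmod_sub_sym in H3.
  replace (int_half_line (F p) - int_half_line (F p0)) with ((int_half_line (F p) - CInt (F p) 0 X) +
    ((CInt (F p) 0 X - CInt (F p0) 0 X) + (CInt (F p0) 0 X - int_half_line (F p0)))) by ring.
  eapply Rle_lt_trans; [apply Cmod_triangle|].
  eapply Rle_lt_trans; [apply Rplus_le_compat_l, Cmod_triangle|]; lra.
Qed.

End Joint.

Lemma at_pt_refl z : at_pt z z = 0%R.
Proof. apply Cmod_zero_sub. Qed.

Lemma CInt_cder (F dF : C -> R -> C) (z : C) a b r : (a <= b)%R -> (0 < r)%R ->
  (forall w y, (Cmod (w - z) < r)%R -> (a <= y <= b)%R -> cder (fun u => F u y) w (dF w y)) ->
  (forall w, (Cmod (w - z) < r)%R -> con_on a b (F w)) -> con_on a b (dF z) ->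
  (forall y, (a <= y <= b)%R -> joint (at_pt z) dF z y) ->
  cder (fun w => CInt (F w) a b) z (CInt (dF z) a b).
Proof.
intros Hab Hr HD Hc Hc' HJ; apply der_of_eps; [intros; subst; auto|].
intros eps He.
destruct (joint_uniform (at_pt z) z (at_pt_refl z) dF a b HJ (eps / (b - a + 1))%R) as [r' [Hr' H]];
  [apply Rdiv_lt_0_compat; lra|].
exists (Rmin r r'); split; [apply Rmin_pos; auto|]; intros w Hw.
assert (Hw1 : (Cmod (w - z) < r)%R) by (eapply Rlt_le_trans; [apply Hw|apply Rmin_l]).
assert (Hz : con_on a b (F z)) by (apply Hc; rewrite Cmod_zero_sub; auto).
assert (E : CInt (fun y => F w y + (- (1) * F z y + - (w - z) * dF z y)) a b
  = CInt (F w) a b - CInt (F z) a b - (w - z) * CInt (dF z) a b).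
{ rewrite !CInt_plus, !CInt_scal; auto; try ring;
  intros t Ht; repeat apply tends_plus; try apply tends_mult; try apply tends_const;
  try apply Hz; try apply Hc'; auto. }
rewrite <- E.
eapply Rle_trans; [apply CInt_le_const with (D := (eps / (b - a + 1) * Cmod (w - z))%R); auto|].
- intros t Ht; repeat apply tends_plus; try apply tends_mult; try apply tends_const;
  try apply Hz; try apply Hc'; try apply Hc; auto.
- intros t Ht.
  replace (F w t + (- (1) * F z t + - (w - z) * dF z t)) with (F w t - F z t - (w - z) * dF z t)
    by ring.
  apply cder_segment_bound with (f := fun u => F u t) (df := fun u => dF u t) (r := Rmin r r'); auto.
  intros u Hu; split.
  + apply HD; auto; eapply Rlt_le_trans; [apply Hu|apply Rmin_l].
  + left; apply H; auto; eapply Rlt_le_trans; [apply Hu|apply Rmin_r].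
- pose proof (Cmod_ge_0 (w - z)).
  replace (eps / (b - a + 1) * Cmod (w - z) * (b - a))%R
    with (eps * Cmod (w - z) * ((b - a) / (b - a + 1)))%R by (field; lra).
  rewrite <- (Rmult_1_r (eps * Cmod (w - z))) at 2; apply Rmult_le_compat_l; [nra|].
  apply Rmult_le_reg_r with (b - a + 1)%R; [lra|]; unfold Rdiv; rewrite Rmult_assoc, Rinv_l; lra.
Qed.

(** The remainder is the integral of [G = F w - F z - (w - z) dF z]. On [[0, X]] it is small by
    uniform continuity of [dF] in the parameter; beyond [X] the decay of [dF] is enough. Both bounds
    carry the factor [|w - z|], so [X] can be fixed before [w]. *)
Lemma int_half_line_cder (F dF : C -> R -> C) (z : C) K k r : (0 < r)%R ->
  (forall w y, (Cmod (w - z) < r)%R -> (0 <= y)%R -> cder (fun u => F u y) w (dF w y)) ->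
  (forall w, (Cmod (w - z) < r)%R -> expdec (F w) K k) ->
  (forall w, (Cmod (w - z) < r)%R -> expdec (dF w) K k) ->
  (forall y, (0 <= y)%R -> joint (at_pt z) dF z y) ->
  cder (fun w => int_half_line (F w)) z (int_half_line (dF z)).
Proof.
intros Hr HD HE HE' HJ; apply der_of_eps; [intros; subst; auto|].
intros eps He.
assert (Hz : expdec (F z) K k) by (apply HE; rewrite Cmod_zero_sub; auto).
assert (Hz' : expdec (dF z) K k) by (apply HE'; rewrite Cmod_zero_sub; auto).
(* The factor 2 comes from bounding [dF u - dF z] by the sum of the two moduli in the tail. *)
destruct (exp_small (2 * K / k) k (eps / 2)%R) as [X [HX HX1]]; [apply Hz|lra|].
specialize (HX1 X (Rle_refl X)).
destruct (joint_uniform (at_pt z) z (at_pt_refl z) dF 0 X) with (eps := (eps / 2 / (X + 1))%R)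
  as [r' [Hr' H]]; [intros; apply HJ; lra | apply Rdiv_lt_0_compat; lra|].
exists (Rmin r r'); split; [apply Rmin_pos; auto|]; intros w Hw.
assert (Hw1 : (Cmod (w - z) < r)%R) by (eapply Rlt_le_trans; [apply Hw|apply Rmin_l]).
set (G := fun y => F w y + (- (1) * F z y + - (w - z) * dF z y)).
assert (E : int_half_line G = int_half_line (F w) - int_half_line (F z) - (w - z) * int_half_line (dF z)).
{ unfold G; erewrite int_half_line_plus; [|apply HE; auto|apply expdec_plus; apply expdec_scal; eauto].
  erewrite int_half_line_plus; [|apply expdec_scal; eauto|apply expdec_scal; eauto].
  erewrite !int_half_line_scal by eauto; ring. }
pose proof (Cmod_ge_0 (w - z)) as Hm.
assert (GE : forall t, G t = F w t - F z t - (w - z) * dF z t) by (intro; unfold G; ring).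
assert (HGc : forall t, (0 <= t)%R -> conR G t).
{ intros t Ht; unfold G; repeat apply tends_plus; try apply tends_mult; try apply tends_const;
  try apply (HE w Hw1); try apply Hz; try apply Hz'; auto. }
assert (HG : expdec G (2 * K * Cmod (w - z)) k).
{ repeat split; [apply Hz|auto|].
  intros t Ht; rewrite GE.
  replace (2 * K * Cmod (w - z) * exp (- k * t))%R with (2 * (K * exp (- k * t)) * Cmod (w - z))%R
    by ring.
  apply cder_segment_bound with (f := fun u => F u t) (df := fun u => dF u t) (r := r); auto.
  intros u Hu; split; [apply HD; auto|].
  eapply Rle_trans; [apply Cmod_triangle|]; rewrite Cmod_opp.
  pose proof (proj2 (proj2 (HE' u Hu)) t Ht); pose proof (proj2 (proj2 Hz') t Ht); lra. }
rewrite <- E.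
pose proof (int_half_line_correct _ _ _ X HG HX) as H1.
assert (H2 : (Cmod (CInt G 0 X) <= eps / 2 * Cmod (w - z))%R).
{ eapply Rle_trans.
  - apply CInt_le_const with (D := (eps / 2 / (X + 1) * Cmod (w - z))%R); [lra|intros t Ht; apply HGc; lra|].
    intros t Ht; rewrite GE.
    apply cder_segment_bound with (f := fun u => F u t) (df := fun u => dF u t) (r := Rmin r r'); auto.
    intros u Hu; split.
    + apply HD; [eapply Rlt_le_trans; [apply Hu|apply Rmin_l]|lra].
    + left; apply H; auto; eapply Rlt_le_trans; [apply Hu|apply Rmin_r].
  - replace (eps / 2 / (X + 1) * Cmod (w - z) * (X - 0))%R
      with (eps / 2 * Cmod (w - z) * (X / (X + 1)))%R by (field; lra).
    rewrite <- (Rmult_1_r (eps / 2 * Cmod (w - z))) at 2; apply Rmult_le_compat_l; [nra|].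
    apply Rmult_le_reg_r with (X + 1)%R; [lra|]; unfold Rdiv; rewrite Rmult_assoc, Rinv_l; lra. }
pose proof (Cmod_triangle_rev (int_half_line G) (CInt G 0 X)).
assert (2 * K * Cmod (w - z) / k * exp (- k * X) <= eps / 2 * Cmod (w - z))%R; [|lra].
replace (2 * K * Cmod (w - z) / k * exp (- k * X))%R
  with (2 * K / k * exp (- k * X) * Cmod (w - z))%R by (unfold Rdiv; ring).
apply Rmult_le_compat_r; lra.
Qed.

(** * Holomorphic functions of three variables *)

(** Pointwise and curried form of [holo3]. It is preserved by sums, products and compositions one
    factor at a time, which keeps the large expressions below manageable. *)
Definition holo_at (G : C -> C -> C -> C) (s z c : C) : Prop :=
  tends (dist3 (s, z, c)) (fun q => G (fst (fst q)) (snd (fst q)) (snd q)) (G s z c) /\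
  (exists l, cder (fun w => G w z c) s l) /\
  (exists l, cder (fun w => G s w c) z l) /\
  (exists l, cder (fun w => G s z w) c l).

Lemma dist3_lt s z c s' z' c' r : (dist3 (s, z, c) (s', z', c') < r)%R <->
  (Cmod (s' - s) < r /\ Cmod (z' - z) < r /\ Cmod (c' - c) < r)%R.
Proof.
unfold dist3; rewrite (Cmod_sub_sym s'), (Cmod_sub_sym z'), (Cmod_sub_sym c'); split.
- intro H; split; [|split]; (eapply Rle_lt_trans; [|apply H]).
  + apply Rmax_l.
  + eapply Rle_trans; [|apply Rmax_r]; apply Rmax_l.
  + eapply Rle_trans; [|apply Rmax_r]; apply Rmax_r.
- intros [H1 [H2 H3]]; repeat apply Rmax_lub_lt; auto.
Qed.

Lemma dist3_refl p : dist3 p p = 0%R.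
Proof.
destruct p as [[s z] c]; unfold dist3; rewrite !Cmod_zero_sub.
rewrite (Rmax_left 0 0) by lra; apply Rmax_left; lra.
Qed.

Section Coordinates.
Variables (s z c : C).

Lemma tends_coord1 : tends (dist3 (s, z, c)) (fun q => fst (fst q)) s.
Proof.
intros eps He; exists eps; split; auto; intros [[s' z'] c'] H; apply dist3_lt in H; apply H.
Qed.

Lemma tends_coord2 : tends (dist3 (s, z, c)) (fun q => snd (fst q)) z.
Proof.
intros eps He; exists eps; split; auto; intros [[s' z'] c'] H; apply dist3_lt in H; apply H.
Qed.

Lemma tends_coord3 : tends (dist3 (s, z, c)) (fun q => snd q) c.
Proof.
intros eps He; exists eps; split; auto; intros [[s' z'] c'] H; apply dist3_lt in H; apply H.
Qed.

Lemma holo_at_const k : holo_at (fun _ _ _ => k) s z c.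
Proof. split; [apply tends_const|]; repeat split; exists 0; apply der_const. Qed.

Lemma holo_at_coord1 : holo_at (fun s _ _ => s) s z c.
Proof.
split; [apply tends_coord1|]; repeat split; eexists; first [apply der_id | apply der_const].
Qed.

Lemma holo_at_coord2 : holo_at (fun _ z _ => z) s z c.
Proof.
split; [apply tends_coord2|]; repeat split; eexists; first [apply der_id | apply der_const].
Qed.

Lemma holo_at_coord3 : holo_at (fun _ _ c => c) s z c.
Proof.
split; [apply tends_coord3|]; repeat split; eexists; first [apply der_id | apply der_const].
Qed.

Lemma holo_at_plus F G : holo_at F s z c -> holo_at G s z c -> holo_at (fun s z c => F s z c + G s z c) s z c.
Proof.
intros [F0 [[a F1] [[b F2] [e F3]]]] [G0 [[a' G1] [[b' G2] [e' G3]]]]; split; [apply tends_plus; auto|].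
repeat split; eexists; apply der_plus; eauto.
Qed.

Lemma holo_at_mult F G : holo_at F s z c -> holo_at G s z c -> holo_at (fun s z c => F s z c * G s z c) s z c.
Proof.
intros [F0 [[a F1] [[b F2] [e F3]]]] [G0 [[a' G1] [[b' G2] [e' G3]]]]; split; [apply tends_mult; auto|].
split; [|split]; eexists.
- apply (der_mult _ (fun w => F w z c) (fun w => G w z c)); eauto.
- apply (der_mult _ (fun w => F s w c) (fun w => G s w c)); eauto.
- apply (der_mult _ (fun w => F s z w) (fun w => G s z w)); eauto.
Qed.

Lemma holo_at_opp F : holo_at F s z c -> holo_at (fun s z c => - F s z c) s z c.
Proof.
intros [F0 [[a F1] [[b F2] [e F3]]]]; split; [apply tends_opp; auto|].
repeat split; eexists; apply der_opp; eauto.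
Qed.

Lemma holo_at_minus F G : holo_at F s z c -> holo_at G s z c -> holo_at (fun s z c => F s z c - G s z c) s z c.
Proof. intros; apply holo_at_plus; auto using holo_at_opp. Qed.

Lemma holo_at_Cexp F : holo_at F s z c -> holo_at (fun s z c => Cexp (F s z c)) s z c.
Proof.
intros [F0 [[a F1] [[b F2] [e F3]]]]; split; [apply tends_Cexp; auto|].
split; [|split]; eexists.
- apply (der_Cexp _ (fun w => F w z c)); eauto.
- apply (der_Cexp _ (fun w => F s w c)); eauto.
- apply (der_Cexp _ (fun w => F s z w)); eauto.
Qed.

Lemma holo_at_comp G f g l m : cder f z l -> cder g c m -> holo_at G s (f z) (g c) ->
  holo_at (fun s z c => G s (f z) (g c)) s z c.
Proof.
intros Hf Hg [G0 [[a G1] [[b G2] [e G3]]]]; split; [|split; [|split]].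
- intros eps He; destruct (G0 eps He) as [r [Hr H]].
  destruct (der_tends _ _ _ _ Hf r Hr) as [r1 [Hr1 H1]].
  destruct (der_tends _ _ _ _ Hg r Hr) as [r2 [Hr2 H2]].
  exists (Rmin r (Rmin r1 r2)); split; [repeat apply Rmin_pos; auto|].
  intros [[s' z'] c'] Hq; apply dist3_lt in Hq; destruct Hq as [Q1 [Q2 Q3]]; simpl.
  apply (H (s', f z', g c')), dist3_lt; split; [|split].
  + eapply Rlt_le_trans; [apply Q1|apply Rmin_l].
  + apply H1; eapply Rlt_le_trans; [apply Q2|].
    eapply Rle_trans; [apply Rmin_r|apply Rmin_l].
  + apply H2; eapply Rlt_le_trans; [apply Q3|].
    eapply Rle_trans; [apply Rmin_r|apply Rmin_r].
- eauto.
- eexists; apply (der_comp _ (fun w => G s w (g c))); eauto.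
- eexists; apply (der_comp _ (fun w => G s (f z) w)); eauto.
Qed.

Lemma holo_at_ext F G r : (0 < r)%R ->
  (forall s' z' c', (dist3 (s, z, c) (s', z', c') < r)%R -> F s' z' c' = G s' z' c') ->
  holo_at F s z c -> holo_at G s z c.
Proof.
intros Hr E [F0 [[a F1] [[b F2] [e F3]]]].
assert (E0 : F s z c = G s z c) by (apply E; rewrite dist3_refl; auto).
assert (Z : forall x, (Cmod (x - x) < r)%R) by (intro; rewrite Cmod_zero_sub; auto).
split; [|split; [|split; eexists]].
- apply tends_eq with (F s z c); auto.
  apply tends_ext_loc with (r := r) (f := fun q => F (fst (fst q)) (snd (fst q)) (snd q)); auto.
  intros [[s' z'] c'] H; simpl; auto.
- exists a; apply der_ext_loc with (f := fun w => F w z c) (r := r); auto.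
  intros w Hw; apply E, dist3_lt; auto.
- apply der_ext_loc with (f := fun w => F s w c) (r := r); eauto.
  intros w Hw; apply E, dist3_lt; auto.
- apply der_ext_loc with (f := fun w => F s z w) (r := r); eauto.
  intros w Hw; apply E, dist3_lt; auto.
Qed.

End Coordinates.

Lemma holo_at_holo3 (U : C3 -> Prop) (G : C -> C -> C -> C) :
  (forall s z c, U (s, z, c) -> holo_at G s z c) ->
  holo3 U (fun q => G (fst (fst q)) (snd (fst q)) (snd q)).
Proof.
intros H [[s z] c] Hp; destruct (H _ _ _ Hp) as [F0 [[a F1] [[b F2] [e F3]]]].
split; [|split; [|split]].
- intros eps He; apply (F0 eps He).
- apply (cder_ex_derive _ _ _ F1).
- apply (cder_ex_derive _ _ _ F2).
- apply (cder_ex_derive _ _ _ F3).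
Qed.

Definition joint3 (F : C -> C -> C -> R -> C) (s z c : C) (y : R) : Prop :=
  joint (dist3 (s, z, c)) (fun q => F (fst (fst q)) (snd (fst q)) (snd q)) (s, z, c) y.

Lemma joint3_slice (F : C -> C -> C -> R -> C) (s z c : C) y : joint3 F s z c y ->
  joint (at_pt s) (fun w => F w z c) s y /\ joint (at_pt z) (fun w => F s w c) z y /\
  joint (at_pt c) (fun w => F s z w) c y /\ conR (F s z c) y.
Proof.
assert (Z : forall x r, (0 < r)%R -> (Cmod (x - x) < r)%R) by (intros; rewrite Cmod_zero_sub; auto).
intro H; split; [|split; [|split]]; intros eps He; destruct (H eps He) as [r [Hr H1]];
exists r; split; auto.
- intros [w t] Hq; apply (H1 ((w, z, c), t)); simpl in *.
  apply Rmax_lub_lt; [apply dist3_lt; split; auto|];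
  (eapply Rle_lt_trans; [|apply Hq]); [apply Rmax_l|apply Rmax_r].
- intros [w t] Hq; apply (H1 ((s, w, c), t)); simpl in *.
  apply Rmax_lub_lt; [apply dist3_lt; split; auto; split; auto|];
  (eapply Rle_lt_trans; [|apply Hq]); [apply Rmax_l|apply Rmax_r].
- intros [w t] Hq; apply (H1 ((s, z, w), t)); simpl in *.
  apply Rmax_lub_lt; [apply dist3_lt; split; auto; split; auto|];
  (eapply Rle_lt_trans; [|apply Hq]); [apply Rmax_l|apply Rmax_r].
- intros t Ht; apply (H1 ((s, z, c), t)); simpl.
  apply Rmax_lub_lt; auto; rewrite Rmax_left, !Cmod_zero_sub; auto;
  rewrite Rmax_left; rewrite !Cmod_zero_sub; lra.
Qed.


Section Family.
Variables (F F1 F2 F3 : C -> C -> C -> R -> C) (s z c : C) (r a b : R).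
Hypothesis (Hr : (0 < r)%R).

Definition partials_on (I : R -> Prop) : Prop :=
  forall s' z' c' y, (dist3 (s, z, c) (s', z', c') < r)%R -> I y ->
    cder (fun w => F w z' c' y) s' (F1 s' z' c' y) /\
    cder (fun w => F s' w c' y) z' (F2 s' z' c' y) /\
    cder (fun w => F s' z' w y) c' (F3 s' z' c' y).

Let near1 w : (Cmod (w - s) < r)%R -> (dist3 (s, z, c) (w, z, c) < r)%R.
Proof. intro H; apply dist3_lt; rewrite !Cmod_zero_sub; auto. Qed.
Let near2 w : (Cmod (w - z) < r)%R -> (dist3 (s, z, c) (s, w, c) < r)%R.
Proof. intro H; apply dist3_lt; rewrite !Cmod_zero_sub; auto. Qed.
Let near3 w : (Cmod (w - c) < r)%R -> (dist3 (s, z, c) (s, z, w) < r)%R.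
Proof. intro H; apply dist3_lt; rewrite !Cmod_zero_sub; auto. Qed.
Let near0 : (dist3 (s, z, c) (s, z, c) < r)%R.
Proof. rewrite dist3_refl; auto. Qed.

(** A common constant and rate for the integrand and its three partial derivatives allow the
    one-variable theorem to be applied in each direction. *)
Lemma int_half_line_partials K k : partials_on (fun y => 0 <= y)%R ->
  (forall G, G = F \/ G = F1 \/ G = F2 \/ G = F3 ->
     (forall y, (0 <= y)%R -> joint3 G s z c y) /\
     forall s' z' c', (dist3 (s, z, c) (s', z', c') < r)%R -> expdec (G s' z' c') K k) ->
  tends (dist3 (s, z, c)) (fun q => int_half_line (F (fst (fst q)) (snd (fst q)) (snd q))) (int_half_line (F s z c)) /\
  cder (fun w => int_half_line (F w z c)) s (int_half_line (F1 s z c)) /\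
  cder (fun w => int_half_line (F s w c)) z (int_half_line (F2 s z c)) /\
  cder (fun w => int_half_line (F s z w)) c (int_half_line (F3 s z c)).
Proof.
intros HP HG.
destruct (HG F) as [J0 E0]; [auto|]; destruct (HG F1) as [J1 E1]; [auto|].
destruct (HG F2) as [J2 E2]; [auto|]; destruct (HG F3) as [J3 E3]; [auto|].
split; [|split; [|split]].
- apply (int_half_line_tends (dist3 (s, z, c)) (s, z, c) (dist3_refl _)
    (fun q => F (fst (fst q)) (snd (fst q)) (snd q)) K k r); auto.
  intros [[s' z'] c'] H; apply E0; auto.
- apply (int_half_line_cder (fun w => F w z c) (fun w => F1 w z c) s K k r); auto.
  + intros w y Hw Hy; apply (HP w z c y); auto.
  + intros y Hy; apply (joint3_slice F1); auto.
- apply (int_half_line_cder (fun w => F s w c) (fun w => F2 s w c) z K k r); auto.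
  + intros w y Hw Hy; apply (HP s w c y); auto.
  + intros y Hy; apply (joint3_slice F2); auto.
- apply (int_half_line_cder (fun w => F s z w) (fun w => F3 s z w) c K k r); auto.
  + intros w y Hw Hy; apply (HP s z w y); auto.
  + intros y Hy; apply (joint3_slice F3); auto.
Qed.

Lemma CInt_partials : (a <= b)%R -> partials_on (fun y => a <= y <= b)%R ->
  (forall G, G = F \/ G = F1 \/ G = F2 \/ G = F3 ->
     forall s' z' c' y, (dist3 (s, z, c) (s', z', c') < r)%R -> (a <= y <= b)%R -> joint3 G s' z' c' y) ->
  tends (dist3 (s, z, c)) (fun q => CInt (F (fst (fst q)) (snd (fst q)) (snd q)) a b)
    (CInt (F s z c) a b) /\
  cder (fun w => CInt (F w z c) a b) s (CInt (F1 s z c) a b) /\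
  cder (fun w => CInt (F s w c) a b) z (CInt (F2 s z c) a b) /\
  cder (fun w => CInt (F s z w) a b) c (CInt (F3 s z c) a b).
Proof.
intros Hab HP HG.
assert (J0 := HG F (or_introl eq_refl)).
assert (J1 := HG F1 (or_intror (or_introl eq_refl))).
assert (J2 := HG F2 (or_intror (or_intror (or_introl eq_refl)))).
assert (J3 := HG F3 (or_intror (or_intror (or_intror eq_refl)))).
assert (C0 : forall s' z' c', (dist3 (s, z, c) (s', z', c') < r)%R -> con_on a b (F s' z' c')).
{ intros s' z' c' H y Hy; apply (joint3_slice F); auto. }
split; [|split; [|split]].
- apply (CInt_tends (dist3 (s, z, c)) (s, z, c) (dist3_refl _)
    (fun q => F (fst (fst q)) (snd (fst q)) (snd q)) a b r); auto.
  + intros y Hy; apply J0; auto.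
  + intros [[s' z'] c'] H; apply C0; auto.
- apply (CInt_cder (fun w => F w z c) (fun w => F1 w z c) s a b r); auto.
  + intros w y Hw Hy; apply (HP w z c y); auto.
  + intros y Hy; apply (joint3_slice F1); auto.
  + intros y Hy; apply (joint3_slice F1); auto.
- apply (CInt_cder (fun w => F s w c) (fun w => F2 s w c) z a b r); auto.
  + intros w y Hw Hy; apply (HP s w c y); auto.
  + intros y Hy; apply (joint3_slice F2); auto.
  + intros y Hy; apply (joint3_slice F2); auto.
- apply (CInt_cder (fun w => F s z w) (fun w => F3 s z w) c a b r); auto.
  + intros w y Hw Hy; apply (HP s z w y); auto.
  + intros y Hy; apply (joint3_slice F3); auto.
  + intros y Hy; apply (joint3_slice F3); auto.
Qed.

End Family.

Lemma joint3_coord1 s z c y : joint3 (fun s _ _ _ => s) s z c y.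
Proof. apply (joint_slice _ (fun q : C3 => fst (fst q))), tends_coord1. Qed.
Lemma joint3_coord2 s z c y : joint3 (fun _ z _ _ => z) s z c y.
Proof. apply (joint_slice _ (fun q : C3 => snd (fst q))), tends_coord2. Qed.
Lemma joint3_coord3 s z c y : joint3 (fun _ _ c _ => c) s z c y.
Proof. apply (joint_slice _ (fun q : C3 => snd q)), tends_coord3. Qed.
Lemma joint3_y s z c y : joint3 (fun _ _ _ y => RtoC y) s z c y.
Proof. apply joint_RtoC. Qed.
Lemma joint3_sliceR f s z c y : conR f y -> joint3 (fun _ _ _ y => f y) s z c y.
Proof. apply joint_sliceR. Qed.

(** Directed by the syntax of the integrand; the goals left over are the side conditions, namely
    nonzero denominators and arguments of [Clog] in the right half-plane. *)
Ltac joint_tac :=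
  match goal with
  | |- joint3 _ _ _ _ _ => unfold joint3, joint; joint_tac
  | |- tends _ (fun q => fst (fst (fst q))) _ => apply joint3_coord1
  | |- tends _ (fun q => snd (fst (fst q))) _ => apply joint3_coord2
  | |- tends _ (fun q => snd (fst q)) _ => apply joint3_coord3
  | |- tends _ (fun q => RtoC (snd q)) _ => apply joint3_y
  | |- tends _ (fun _ => ?a) _ => apply tends_const
  | |- tends _ (fun q => _ + _) _ => apply tends_plus; joint_tac
  | |- tends _ (fun q => _ - _) _ => apply tends_minus; joint_tac
  | |- tends _ (fun q => _ * _) _ => apply tends_mult; joint_tac
  | |- tends _ (fun q => _ / _) _ => apply tends_mult; joint_tac
  | |- tends _ (fun q => - _) _ => apply tends_opp; joint_tac
  | |- tends _ (fun q => / _) _ => apply tends_inv; [|joint_tac]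
  | |- tends _ (fun q => Cexp _) _ => apply tends_Cexp; joint_tac
  | |- tends _ (fun q => Clog _) _ => apply tends_Clog; [|joint_tac]
  | |- _ => idtac
  end.

(** * Integrals along vertical half-lines *)

(** The directions of the upper and the lower vertical half-line. Both are treated at once, through
    [j * j = -1] and [|j| = 1]. *)
Definition vert (j : C) : Prop := j = Ci \/ j = - Ci.

(** This is [exp(j v y) (a + j y)^(-s)], which decays exponentially in [y] as soon as
    [Re (j v) < 0]. *)
Definition kexp (j s v a : C) (y : R) : C := Cexp (j * v * y - s * Clog (a + j * y)).

Definition KI (k : R -> C) (j s v a : C) : C := int_half_line (fun y => kexp j s v a y * k y).

Lemma vert_sqr j : vert j -> j * j = - (1).
Proof. intros [->| ->]; apply C_ext; simpl; ring. Qed.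

Lemma vert_mod j : vert j -> Cmod j = 1%R.
Proof. intros [->| ->]; rewrite ?Cmod_opp; apply Cmod_Ci. Qed.

Lemma vert_Re j a (y : R) : vert j -> Re (a + j * y) = Re a.
Proof. intros [->| ->]; simpl; unfold Re; ring. Qed.

Lemma Re_lip (x y : C) : (Re x <= Re y + Cmod (x - y))%R.
Proof.
pose proof (Re_le_Cmod (x - y)) as H.
replace (Re (x - y)) with (Re x - Re y)%R in H by reflexivity; lra.
Qed.

(** The slope [eta] is free, so that the power [(a + j y)^(-s)] costs only a prescribed part of the
    decay of [exp(j v y)]. *)
Lemma Clog_growth (a eta : R) : (0 < a)%R -> (0 < eta)%R ->
  exists K, (0 <= K)%R /\ forall x, (a <= Re x)%R -> (Cmod (Clog x) <= K + eta * Cmod x)%R.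
Proof.
intros Ha He; exists (Rabs (ln eta) + Rabs (ln a) + PI / 2)%R.
pose proof (Rabs_pos (ln eta)); pose proof (Rabs_pos (ln a)); pose proof PI_RGT_0.
split; [lra|]; intros x Hx.
eapply Rle_trans; [apply Cmod_le_Re_Im|].
pose proof (Im_Clog_bound x ltac:(lra)); rewrite Re_Clog.
assert (Hm : (a <= Cmod x)%R) by (pose proof (Re_le_Cmod x); lra).
assert (Rabs (ln (Cmod x)) <= Rabs (ln eta) + Rabs (ln a) + eta * Cmod x)%R; [|lra].
assert (L1 : (ln a <= ln (Cmod x))%R).
{ destruct Hm as [Hm|Hm]; [left; apply ln_increasing; auto | rewrite <- Hm; lra]. }
assert (L2 : (ln (eta * Cmod x) <= eta * Cmod x)%R).
{ assert (0 < eta * Cmod x)%R by (apply Rmult_lt_0_compat; lra).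
  pose proof (exp_ineq1_le (ln (eta * Cmod x))) as H4; rewrite exp_ln in H4; lra. }
rewrite ln_mult in L2 by lra.
assert (0 <= eta * Cmod x)%R by (apply Rmult_le_pos; lra).
apply Rabs_le; split.
- pose proof (Rle_abs (- ln a)) as H5; rewrite Rabs_Ropp in H5; lra.
- pose proof (Rle_abs (- ln eta)) as H5; rewrite Rabs_Ropp in H5; lra.
Qed.

(** The factor [m] runs over [1] and the logarithmic derivatives of [kexp] in [s], [v] and [a]: a
    single estimate covers the integrand and its partial derivatives, locally uniformly. *)
Lemma kexp_bounds (j s0 v0 a0 : C) : vert j -> (Re (j * v0) < 0)%R -> (0 < Re a0)%R ->
  exists r K k, (0 < r)%R /\ (0 < k)%R /\
  forall s v a, (dist3 (s0, v0, a0) (s, v, a) < r)%R -> (0 < Re a)%R /\ (Re (j * v) < 0)%R /\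
    forall (y : R) (m : C), (0 <= y)%R ->
      (m = 1 \/ m = - Clog (a + j * y) \/ m = j * y \/ m = - (s / (a + j * y)))%C ->
      (Cmod (m * kexp j s v a y) <= K * exp (- k * y))%R.
Proof.
intros Hj Hv Ha.
(* Budget of the decay: [Re (j v0) = - 4 k], of which one [k] is lost to the variation of [v], one
   to the logarithm (hence the slope [k / S]) and one to the factor [m]. The rate [k] remains. *)
set (k := (- Re (j * v0) / 4)%R); set (b := (Re a0 / 2)%R); set (S := (Cmod s0 + 1)%R).
pose proof (Cmod_ge_0 s0).
assert (Hk : (0 < k)%R) by (unfold k; lra).
assert (Hb : (0 < b)%R) by (unfold b; lra).
assert (HS : (0 < S)%R) by (unfold S; lra).
assert (He : (0 < k / S)%R) by (apply Rdiv_lt_0_compat; auto).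
destruct (Clog_growth b (k / S) Hb He) as [K0 [HK0 HC]].
set (B := (Cmod a0 + b)%R).
assert (HB : (0 <= B)%R) by (unfold B; pose proof (Cmod_ge_0 a0); lra).
set (M := (S * K0 + k * B)%R).
set (K1 := (1 + / k + (K0 + k / S * B + / S) + S / b)%R).
assert (P1 : (0 < / k)%R) by (apply Rinv_0_lt_compat; auto).
assert (P2 : (0 < / S)%R) by (apply Rinv_0_lt_compat; auto).
assert (P3 : (0 < S / b)%R) by (apply Rdiv_lt_0_compat; auto).
assert (P4 : (0 <= k / S * B)%R) by (apply Rmult_le_pos; lra).
exists (Rmin 1 (Rmin k b)), (exp M * K1)%R, k.
split; [repeat apply Rmin_pos; auto; lra|]; split; auto.
intros s v a Hd; apply dist3_lt in Hd; destruct Hd as [D1 [D2 D3]].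
assert (D1' : (Cmod (s - s0) < 1)%R) by (eapply Rlt_le_trans; [apply D1|apply Rmin_l]).
assert (D2' : (Cmod (v - v0) < k)%R)
  by (eapply Rlt_le_trans; [apply D2|eapply Rle_trans; [apply Rmin_r|apply Rmin_l]]).
assert (D3' : (Cmod (a - a0) < b)%R)
  by (eapply Rlt_le_trans; [apply D3|eapply Rle_trans; [apply Rmin_r|apply Rmin_r]]).
assert (Ra : (b < Re a)%R).
{ pose proof (Re_lip a0 a) as H1; rewrite Cmod_sub_sym in H1; unfold b in *; lra. }
assert (Rv : (Re (j * v) <= - 3 * k)%R).
{ pose proof (Re_lip (j * v) (j * v0)) as H1.
  replace (j * v - j * v0) with (j * (v - v0)) in H1 by ring.
  rewrite Cmod_mult, (vert_mod j Hj) in H1; unfold k in *; lra. }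
assert (Ms : (Cmod s <= S)%R).
{ pose proof (Cmod_triangle_rev s s0); unfold S; lra. }
split; [lra|]; split; [lra|].
intros y m Hy Hm.
set (x := a + j * y) in *.
assert (Rx : (b < Re x)%R) by (unfold x; rewrite vert_Re; auto).
assert (Mx : (Cmod x <= B + y)%R).
{ unfold x; eapply Rle_trans; [apply Cmod_triangle|].
  rewrite Cmod_mult, (vert_mod j Hj), Cmod_R, Rabs_pos_eq by auto.
  pose proof (Cmod_triangle_rev a a0); unfold B; lra. }
assert (Lx : (Cmod (Clog x) <= K0 + k / S * B + k / S * y)%R).
{ eapply Rle_trans; [apply HC; lra|].
  assert (k / S * Cmod x <= k / S * (B + y))%R by (apply Rmult_le_compat_l; lra); lra. }
assert (Ex : (Cmod (kexp j s v a y) <= exp M * exp (- (2 * k) * y))%R).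
{ unfold kexp; rewrite Cmod_Cexp, <- exp_plus; apply exp_mono; fold x.
  replace (Re (j * v * y - s * Clog x)) with (Re (j * v) * y + Re (- (s * Clog x)))%R
    by (simpl; unfold Re; ring).
  pose proof (Re_le_Cmod (- (s * Clog x))) as H1; rewrite Cmod_opp, Cmod_mult in H1.
  assert (H2 : (Cmod s * Cmod (Clog x) <= S * (K0 + k / S * B + k / S * y))%R).
  { apply Rmult_le_compat; auto using Cmod_ge_0. }
  assert (H3 : (S * (K0 + k / S * B + k / S * y) = M + k * y)%R) by (unfold M; field; lra).
  assert (Re (j * v) * y <= - 3 * k * y)%R by (apply Rmult_le_compat_r; auto); lra. }
assert (E1 : (1 <= exp (k * y))%R).
{ pose proof (exp_ineq1_le (k * y)); assert (0 <= k * y)%R by (apply Rmult_le_pos; lra); lra. }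
assert (E2 : (y <= / k * exp (k * y))%R).
{ pose proof (exp_ineq1_le (k * y)).
  apply Rle_trans with (/ k * (k * y))%R; [right; field; lra|].
  apply Rmult_le_compat_l; lra. }
assert (Bm : (Cmod m <= K1 * exp (k * y))%R).
{ assert (G : forall X Y Z : R, (0 <= Y -> Z <= X * exp (k * y) -> X + Y = K1 -> Z <= K1 * exp (k * y))%R).
  { intros X Y Z HY HZ HE; rewrite <- HE, Rmult_plus_distr_r.
    assert (0 <= Y * exp (k * y))%R by (apply Rmult_le_pos; lra); lra. }
  destruct Hm as [->|[->|[->| ->]]].
  - rewrite Cmod_1; apply (G 1 (K1 - 1))%R; unfold K1; lra.
  - rewrite Cmod_opp; apply (G (K0 + k / S * B + / S) (1 + / k + S / b))%R; unfold K1; try lra.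
    eapply Rle_trans; [apply Lx|]; rewrite Rmult_plus_distr_r.
    assert (k / S * y <= / S * exp (k * y))%R.
    { replace (k / S * y)%R with (/ S * (k * y))%R by (field; lra).
      apply Rmult_le_compat_l; [lra|]; pose proof (exp_ineq1_le (k * y)); lra. }
    assert (K0 + k / S * B <= (K0 + k / S * B) * exp (k * y))%R.
    { rewrite <- (Rmult_1_r (K0 + k / S * B)) at 1; apply Rmult_le_compat_l; lra. }
    lra.
  - rewrite Cmod_mult, (vert_mod j Hj), Cmod_R, Rabs_pos_eq by auto.
    apply (G (/ k) (1 + (K0 + k / S * B + / S) + S / b))%R; unfold K1; lra.
  - rewrite Cmod_opp, Cmod_div by (apply Re_pos_neq_0; lra).
    apply (G (S / b) (1 + / k + (K0 + k / S * B + / S)))%R; unfold K1; try lra.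
    apply Rle_trans with (S / b)%R; [|rewrite <- (Rmult_1_r (S / b)) at 1; apply Rmult_le_compat_l; lra].
    unfold Rdiv; apply Rmult_le_compat; auto using Cmod_ge_0.
    + left; apply Rinv_0_lt_compat; pose proof (Re_le_Cmod x); lra.
    + apply Rinv_le_contravar; auto; pose proof (Re_le_Cmod x); lra. }
rewrite Cmod_mult.
apply Rle_trans with (K1 * exp (k * y) * (exp M * exp (- (2 * k) * y)))%R.
- apply Rmult_le_compat; auto using Cmod_ge_0.
- right; replace (- k * y)%R with (k * y + - (2 * k) * y)%R by ring; rewrite exp_plus; ring.
Qed.

Definition bounded1 (k : R -> C) : Prop :=
  (forall y, (0 <= y)%R -> conR k y) /\ (forall y, (0 <= y)%R -> (Cmod (k y) <= 1)%R).

Lemma KI_partials (k : R -> C) (j s v a : C) : vert j -> (Re (j * v) < 0)%R -> (0 < Re a)%R ->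
  bounded1 k ->
  (exists K e, expdec (fun y => kexp j s v a y * k y) K e /\
     expdec (fun y => - Clog (a + j * y) * (kexp j s v a y * k y)) K e /\
     expdec (fun y => j * y * (kexp j s v a y * k y)) K e /\
     expdec (fun y => - (s / (a + j * y)) * (kexp j s v a y * k y)) K e) /\
  tends (dist3 (s, v, a)) (fun q => KI k j (fst (fst q)) (snd (fst q)) (snd q)) (KI k j s v a) /\
  cder (fun w => KI k j w v a) s (int_half_line (fun y => - Clog (a + j * y) * (kexp j s v a y * k y))) /\
  cder (fun w => KI k j s w a) v (int_half_line (fun y => j * y * (kexp j s v a y * k y))) /\
  cder (fun w => KI k j s v w) a (int_half_line (fun y => - (s / (a + j * y)) * (kexp j s v a y * k y))).
Proof.
intros Hj Hv Ha [Hk1 Hk2].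
destruct (kexp_bounds j s v a Hj Hv Ha) as [r [K [e [Hr [He H]]]]].
assert (J : forall G, G = (fun s v a y => kexp j s v a y * k y) \/
   G = (fun s v a y => - Clog (a + j * y) * (kexp j s v a y * k y)) \/
   G = (fun (s v a : C) (y : R) => j * y * (kexp j s v a y * k y)) \/
   G = (fun s v a y => - (s / (a + j * y)) * (kexp j s v a y * k y)) ->
   forall s' v' a' y, (0 < Re a')%R -> (0 <= y)%R -> joint3 G s' v' a' y).
{ intros G HG s' v' a' y Ha' Hy.
  assert (Hx : (0 < Re (a' + j * y))%R) by (rewrite vert_Re; auto).
  pose proof (joint3_sliceR k s' v' a' y (Hk1 y Hy)) as HK; unfold joint3, joint in HK.
  destruct HG as [->|[->|[->| ->]]]; unfold kexp; joint_tac; auto; apply Re_pos_neq_0; auto. }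
assert (HE : forall G, G = (fun s v a y => kexp j s v a y * k y) \/
   G = (fun s v a y => - Clog (a + j * y) * (kexp j s v a y * k y)) \/
   G = (fun (s v a : C) (y : R) => j * y * (kexp j s v a y * k y)) \/
   G = (fun s v a y => - (s / (a + j * y)) * (kexp j s v a y * k y)) ->
   (forall y, (0 <= y)%R -> joint3 G s v a y) /\
   forall s' v' a', (dist3 (s, v, a) (s', v', a') < r)%R -> expdec (G s' v' a') K e).
{ intros G HG; split; [intros y Hy; apply J; auto|].
  intros s' v' a' Hd; destruct (H s' v' a' Hd) as [Ha' [_ Hb]]; split; [auto|split].
  - intros t Ht; apply (joint3_slice G s' v' a' t), J; auto.
  - intros t Ht.
    assert (W : forall m : C, (m = 1 \/ m = - Clog (a' + j * t) \/ m = j * t \/ m = - (s' / (a' + j * t)))%C ->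
      (Cmod (m * (kexp j s' v' a' t * k t)) <= K * exp (- e * t))%R).
    { intros m Hm; rewrite Cmult_assoc, Cmod_mult.
      eapply Rle_trans; [|apply (Hb t m Ht Hm)].
      rewrite <- (Rmult_1_r (Cmod (m * kexp j s' v' a' t))) at 2.
      apply Rmult_le_compat_l; auto using Cmod_ge_0. }
    destruct HG as [->|[->|[->| ->]]]; try (apply W; auto).
    specialize (W 1 (or_introl eq_refl)); rewrite Cmult_1_l in W; auto. }
split.
- assert (Hd : (dist3 (s, v, a) (s, v, a) < r)%R) by (rewrite dist3_refl; auto).
  exists K, e; split; [|split; [|split]].
  + apply (HE (fun s v a y => kexp j s v a y * k y)); auto.
  + apply (HE (fun s v a y => - Clog (a + j * y) * (kexp j s v a y * k y))); auto.
  + apply (HE (fun (s v a : C) (y : R) => j * y * (kexp j s v a y * k y))); auto.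
  + apply (HE (fun s v a y => - (s / (a + j * y)) * (kexp j s v a y * k y))); auto.
- apply (int_half_line_partials (fun s v a y => kexp j s v a y * k y)
    (fun s v a y => - Clog (a + j * y) * (kexp j s v a y * k y))
    (fun (s v a : C) (y : R) => j * y * (kexp j s v a y * k y))
    (fun s v a y => - (s / (a + j * y)) * (kexp j s v a y * k y)) s v a r Hr K e); auto.
  intros s' v' a' y Hd Hy; destruct (H s' v' a' Hd) as [Ha' [_ _]].
  assert (Hx : (0 < Re (a' + j * y))%R) by (rewrite vert_Re; auto).
  assert (Hx0 := Re_pos_neq_0 _ Hx).
  unfold kexp; split; [|split].
  + eapply der_eq; [apply der_mult; [|apply der_const]; apply der_Cexp, der_minus;
      [apply der_const|]; apply der_mult; [apply der_id|apply der_const]|].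
    cbv beta; ring.
  + eapply der_eq; [apply der_mult; [|apply der_const]; apply der_Cexp, der_minus;
      [|apply der_const]; apply der_mult; [|apply der_const]; apply der_mult;
      [apply der_const|apply der_id]|].
    cbv beta; ring.
  + eapply der_eq; [apply der_mult; [|apply der_const]; apply der_Cexp, der_minus;
      [apply der_const|]; apply der_mult; [apply der_const|]; apply der_Clog; [exact Hx|];
      apply der_plus; [apply der_id|apply der_const]|].
    cbv beta; field; auto.
Qed.

Lemma rder_line (a h : C) (t : R) : rder (fun t : R => a + t * h) t h.
Proof.
apply der_eq with (0 + (1 * h + t * 0)); [|ring].
apply der_plus; [apply der_const|].
apply (der_mult _ RtoC (fun _ => h)); [apply der_id|apply der_const].
Qed.

(** Uniqueness for the differential equations below and the independence of a line integral from its
    abscissa both reduce to a derivative that vanishes along one segment. *)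
Lemma cder_zero_segment (f : C -> C) (x y : C) :
  (forall t : R, (0 <= t <= 1)%R -> cder f (x + t * (y - x)) 0) -> f y = f x.
Proof.
intro H; apply NNPP; intro Hn; apply Cmod_pos_sub in Hn.
assert (B : (Cmod (f (x + 1%R * (y - x))%C - f (x + 0%R * (y - x))%C) <= 0 * (1 - 0))%R).
{ apply Cbounded_variation with (f := fun t : R => f (x + t * (y - x))) (df := fun _ => 0); [lra|].
  intros t Ht; split; [|rewrite Cmod_0; lra].
  apply der_eq with (0 * (y - x)); [|ring].
  apply (der_comp _ f (fun t : R => x + t * (y - x))); auto using rder_line. }
replace (x + 1%R * (y - x)) with y in B by ring; replace (x + 0%R * (y - x)) with x in B by ring; lra.
Qed.

(** The radial primitive of [phi] is [h * CInt (fun t => phi (a + t * h)) 0 1];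
    this is the identity behind its differentiability. *)
Lemma CInt_radial (phi dphi : C -> C) (a h : C) :
  (forall t : R, (0 <= t <= 1)%R -> cder phi (a + t * h) (dphi (a + t * h))) ->
  con_on 0 1 (fun t => dphi (a + t * h)) ->
  CInt (fun t => phi (a + t * h)) 0 1 + h * CInt (fun t => t * dphi (a + t * h)) 0 1 = phi (a + h).
Proof.
intros H Hc.
assert (Hl := rder_line a h).
assert (Hp : con_on 0 1 (fun t => phi (a + t * h))).
{ intros t Ht; eapply rder_conR, (der_comp _ phi (fun t : R => a + t * h)); eauto. }
assert (Ht' : forall t, conR RtoC t) by (intro; eapply rder_conR, der_id).
rewrite <- CInt_scal, <- CInt_plus; try lra; auto.
- rewrite (CInt_derive 0 1 ltac:(lra) (fun t : R => t * phi (a + t * h))).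
  + replace (a + 1%R * h) with (a + h) by ring; ring.
  + intros t Ht; apply der_eq with (1 * phi (a + t * h) + t * (dphi (a + t * h) * h)); [|ring].
    apply (der_mult _ RtoC (fun t : R => phi (a + t * h))); [apply der_id|].
    apply (der_comp _ phi (fun t : R => a + t * h)); auto.
  + intros t Ht; apply tends_plus; [apply Hp; auto|].
    apply tends_mult; [apply tends_const|apply tends_mult; [apply Ht'|apply Hc; auto]].
- intros t Ht; apply tends_mult; [apply tends_const|apply tends_mult; [apply Ht'|apply Hc; auto]].
- intros t Ht; apply tends_mult; [apply Ht'|apply Hc; auto].
Qed.

(** ** The integral of [exp (v y) y^(-s)] along a vertical half-line *)

Definition Tj (j s v a : C) : C := KI (fun _ => j) j s v a.

Lemma bounded1_const j : vert j -> bounded1 (fun _ => j).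
Proof. intro H; split; intros; [apply tends_const|rewrite vert_mod by auto; lra]. Qed.

Lemma kexp_rder j s v a y : vert j -> (0 < Re a)%R ->
  rder (kexp j s v a) y ((j * v - s * j / (a + j * y)) * kexp j s v a y).
Proof.
intros Hj Ha.
assert (Hx : (0 < Re (a + j * y))%R) by (rewrite vert_Re; auto).
assert (Hx0 := Re_pos_neq_0 _ Hx).
unfold kexp; eapply der_eq.
- apply der_Cexp, der_minus.
  + apply der_mult; [apply der_const|apply der_id].
  + apply der_mult; [apply der_const|]; apply der_Clog; [exact Hx|].
    apply der_plus; [apply der_const|]; apply der_mult; [apply der_const|apply der_id].
- cbv beta; field; auto.
Qed.

Lemma kexp_0 j s v a : kexp j s v a 0 = Cexp (- s * Clog a).
Proof. unfold kexp; f_equal; rewrite !Cmult_0_r, Cplus_0_r; ring. Qed.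

Section Vertical.
Variables (j s v a : C).
Hypotheses (Hj : vert j) (Hv : (Re (j * v) < 0)%R) (Ha : (0 < Re a)%R).

(** Both relations are integrals of total derivatives in [y]: that of [(a + j y) E] gives the
    differential equation in [v], that of [E] the one in [a], where [E] is [kexp j s v a]. *)
Lemma Tj_derivatives : exists Tv Ta,
  cder (fun w => Tj j s w a) v Tv /\ cder (fun w => Tj j s v w) a Ta /\
  v * Tv + a * v * Tj j s v a = (s - 1) * Tj j s v a - a * Cexp (- s * Clog a) /\
  Ta + v * Tj j s v a = - Cexp (- s * Clog a).
Proof.
destruct (KI_partials (fun _ => j) j s v a Hj Hv Ha (bounded1_const j Hj))
  as [[K [k [E0 [E1 [E2 E3]]]]] [_ [_ [D2 D3]]]].
set (E := kexp j s v a) in *.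
assert (j0 : j <> 0) by (apply Cmod_gt_0; rewrite vert_mod; auto; lra).
assert (Hx0 : forall y : R, a + j * y <> 0) by (intro; apply Re_pos_neq_0; rewrite vert_Re; auto).
exists (int_half_line (fun y : R => j * y * (E y * j))), (int_half_line (fun y => - (s / (a + j * y)) * (E y * j))).
split; [exact D2|]; split; [exact D3|].
(* The bounds are available for [E * j]; since [- (j * j) = 1], they carry over to [E] itself. *)
assert (EE : forall y : R, E y = (- j) * (E y * j)).
{ intro y; replace (- j * (E y * j)) with (- (j * j) * E y) by ring; rewrite (vert_sqr j Hj); ring. }
assert (B0 : expdec E (Cmod (- j) * K) k).
{ destruct (expdec_scal _ (- j) _ _ E0) as [G1 [G2 G3]]; split; [auto|split].
  - intros t Ht; apply tends_ext with (fun y => - j * (E y * j)); [intro; symmetry; apply EE|].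
    rewrite (EE t); apply G2; auto.
  - intros t Ht; rewrite (EE t); apply G3; auto. }
split.
- assert (H : (1 - s) * Tj j s v a + (v * a * Tj j s v a + v * int_half_line (fun y : R => j * y * (E y * j)))
    = - (a * Cexp (- s * Clog a))).
  { unfold Tj, KI; fold E.
    rewrite <- (int_half_line_scal _ (1 - s) _ _ E0), <- (int_half_line_scal _ (v * a) _ _ E0), <- (int_half_line_scal _ v _ _ E2).
    pose proof (expdec_scal _ (1 - s) _ _ E0) as X1.
    pose proof (expdec_scal _ (v * a) _ _ E0) as X2.
    pose proof (expdec_scal _ v _ _ E2) as X3.
    pose proof (expdec_plus _ _ _ _ _ X2 X3) as X4.
    pose proof (expdec_plus _ _ _ _ _ X1 X4) as X5.
    rewrite <- (int_half_line_plus _ _ _ _ _ X2 X3), <- (int_half_line_plus _ _ _ _ _ X1 X4).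
    pose proof (expdec_plus _ _ _ _ _ (expdec_scal _ a _ _ B0) (expdec_scal _ (- j) _ _ E2)) as B1.
    rewrite (int_half_line_derive (fun y : R => (a + j * y) * E y) _ _
      (Cmod a * (Cmod (- j) * K) + Cmod (- j) * K)%R _ X5).
    - unfold E; rewrite kexp_0; ring.
    - intros t Ht; eapply der_eq.
      + apply der_mult; [apply der_plus; [apply der_const|];
          apply der_mult; [apply der_const|apply der_id]|apply kexp_rder; auto].
      + cbv beta; fold E; field; auto.
    - intros t Ht; destruct B1 as [_ [_ B1]]; specialize (B1 t Ht).
      replace ((a + j * t) * E t) with (a * E t + - j * (j * t * (E t * j))); [exact B1|].
      replace (a * E t + - j * (j * t * (E t * j))) with (a * E t - (j * j) * (j * t * E t)) by ring.
      rewrite (vert_sqr j Hj); ring. }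
  replace (- (a * Cexp (- s * Clog a))) with (0 - a * Cexp (- s * Clog a)) in H by ring.
  set (A := a * Cexp (- s * Clog a)) in *; set (X := int_half_line _) in *; set (Y := Tj j s v a) in *.
  replace (v * X + a * v * Y) with ((1 - s) * Y + (v * a * Y + v * X) + (s - 1) * Y) by ring.
  rewrite H; ring.
- unfold Tj, KI; fold E; rewrite <- (int_half_line_scal _ v _ _ E0).
  pose proof (expdec_plus _ _ _ _ _ E3 (expdec_scal _ v _ _ E0)) as X1.
  rewrite <- (int_half_line_plus _ _ _ _ _ E3 (expdec_scal _ v _ _ E0)).
  rewrite (int_half_line_derive E _ _ (Cmod (- j) * K)%R _ X1).
  + unfold E; rewrite kexp_0; ring.
  + intros t Ht; eapply der_eq; [apply kexp_rder; auto|]; fold E; field; auto.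
  + apply B0.
Qed.

End Vertical.

(** ** The integral of [exp (v y) y^(-s)] from [a] to [1] *)

Definition ypow (s v y : C) : C := Cexp (v * y - s * Clog y).

Definition Pint (s v a : C) : C := - (a - 1) * CInt (fun t => ypow s v (1 + t * (a - 1))) 0 1.

Lemma cder_ypow s v y : (0 < Re y)%R -> cder (ypow s v) y ((v - s / y) * ypow s v y).
Proof.
intro Hy; pose proof (Re_pos_neq_0 _ Hy); unfold ypow; eapply der_eq.
- apply der_Cexp, der_minus.
  + apply der_mult; [apply der_const|apply der_id].
  + apply der_mult; [apply der_const|]; apply der_Clog; [exact Hy|apply der_id].
- cbv beta; field; auto.
Qed.

Lemma Re_segment (a : C) (t : R) : (0 < Re a)%R -> (0 <= t <= 1)%R -> (0 < Re (1 + t * (a - 1)))%R.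
Proof.
intros Ha Ht; replace (Re (1 + t * (a - 1))) with ((1 - t) + t * Re a)%R
  by (simpl; unfold Re; ring).
destruct (Req_dec t 1); [subst; lra|]; assert (0 <= t * Re a)%R by (apply Rmult_le_pos; lra); lra.
Qed.

(** The derivative in [a] is the fundamental theorem of calculus, by way of [CInt_radial]. The
    relation in [v] follows by integrating the derivative of [y * ypow s v y]; its term [Cexp v] is
    the one that cancels against the inhomogeneity in [cder_hj]. *)
Lemma Pint_partials (s v a : C) : (0 < Re a)%R ->
  holo_at Pint s v a /\ cder (fun w => Pint s v w) a (- ypow s v a) /\
  exists Pv, cder (fun w => Pint s w a) v Pv /\
    v * Pv = (s - 1) * Pint s v a - a * ypow s v a + Cexp v.
Proof.
intro Ha.
set (y := fun (a : C) (t : R) => 1 + t * (a - 1)).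
set (F := fun s v a t => ypow s v (y a t)).
set (F1 := fun s v a t => - Clog (y a t) * ypow s v (y a t)).
set (F2 := fun s v a t => y a t * ypow s v (y a t)).
set (F3 := fun s v a (t : R) => t * ((v - s / y a t) * ypow s v (y a t))).
assert (Rn : forall s' v' a', (dist3 (s, v, a) (s', v', a') < Re a)%R -> (0 < Re a')%R).
{ intros s' v' a' H; apply dist3_lt in H; apply Re_pos_near with a; apply H. }
assert (J : forall G, G = F \/ G = F1 \/ G = F2 \/ G = F3 ->
  forall s' v' a' t, (dist3 (s, v, a) (s', v', a') < Re a)%R -> (0 <= t <= 1)%R ->
  joint3 G s' v' a' t).
{ intros G HG s' v' a' t Hd Ht.
  pose proof (Re_segment a' t (Rn _ _ _ Hd) Ht) as Hx.
  destruct HG as [->|[->|[->| ->]]]; unfold F, F1, F2, F3, y, ypow; joint_tac; auto;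
    apply Re_pos_neq_0; auto. }
assert (Hl : forall t : R, rder (y a) t (a - 1)) by (intro; apply rder_line).
destruct (CInt_partials F F1 F2 F3 s v a (Re a) 0 1 Ha ltac:(lra)) as [T0 [D1 [D2 D3]]]; auto.
{ intros s' v' a' t Hd Ht.
  pose proof (Re_segment a' t (Rn _ _ _ Hd) Ht) as Hx; fold (y a' t) in Hx.
  pose proof (Re_pos_neq_0 _ Hx); unfold F, F1, F2, F3; split; [|split].
  - unfold ypow; eapply der_eq; [apply der_Cexp, der_minus; [apply der_const|];
      apply der_mult; [apply der_id|apply der_const]|]; cbv beta; ring.
  - unfold ypow; eapply der_eq; [apply der_Cexp, der_minus; [|apply der_const];
      apply der_mult; [apply der_id|apply der_const]|]; cbv beta; ring.
  - eapply der_eq; [apply (der_comp _ (ypow s' v') (fun w => y w t)); [apply cder_ypow; exact Hx|];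
      unfold y; apply der_plus; [apply der_const|]; apply der_mult; [apply der_const|];
      apply der_minus; [apply der_id|apply der_const]|]; cbv beta; ring. }
assert (Da : cder (fun w => Pint s v w) a (- ypow s v a)).
{ pose proof (CInt_radial (ypow s v) (fun y => (v - s / y) * ypow s v y) 1 (a - 1)) as HR.
  unfold Pint; eapply der_eq.
  - apply der_mult; [|exact D3].
    apply der_opp, der_minus; [apply der_id|apply der_const].
  - cbv beta; unfold F3, y in *.
    replace (1 + (a - 1)) with a in HR by ring.
    rewrite <- HR.
    + ring.
    + intros t Ht; apply cder_ypow, Re_segment; auto.
    + intros t Ht; apply (joint3_slice (fun s v a t => (v - s / y a t) * ypow s v (y a t)) s v a t).
      pose proof (Re_segment a t Ha Ht); unfold y, ypow; joint_tac; auto; apply Re_pos_neq_0; auto. }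
assert (Dv : cder (fun w => Pint s w a) v (- (a - 1) * CInt (F2 s v a) 0 1)).
{ unfold Pint; eapply der_eq; [apply der_mult; [apply der_const|exact D2]|]; cbv beta; ring. }
split; [|split; [auto|]].
- split; [|split; [|split; eauto]].
  + unfold Pint; apply tends_mult; [|exact T0].
    apply tends_opp, tends_minus; [apply tends_coord3|apply tends_const].
  + eexists; unfold Pint; apply der_mult; [apply der_const|exact D1].
- eexists; split; [exact Dv|].
  assert (H0 : (dist3 (s, v, a) (s, v, a) < Re a)%R) by (rewrite dist3_refl; auto).
  assert (C0 : con_on 0 1 (F s v a)) by (intros t Ht; apply (joint3_slice F), J; auto).
  assert (C2 : con_on 0 1 (F2 s v a)) by (intros t Ht; apply (joint3_slice F2), J; auto).
  assert (HI : (a - 1) * (1 - s) * CInt (F s v a) 0 1 + (a - 1) * v * CInt (F2 s v a) 0 1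
    = a * ypow s v a - Cexp v).
  { assert (C0' : con_on 0 1 (fun t => (a - 1) * (1 - s) * F s v a t))
      by (intros t Ht; apply tends_mult; [apply tends_const|apply C0; auto]).
    assert (C2' : con_on 0 1 (fun t => (a - 1) * v * F2 s v a t))
      by (intros t Ht; apply tends_mult; [apply tends_const|apply C2; auto]).
    rewrite <- !CInt_scal, <- CInt_plus; auto; try lra.
    rewrite (CInt_derive 0 1 ltac:(lra) (F2 s v a)).
    - unfold F2, y; replace (1 + 1%R * (a - 1)) with a by ring.
      replace (1 + 0%R * (a - 1)) with (RtoC 1) by ring.
      unfold ypow at 2; rewrite Clog_1; replace (v * 1 - s * 0) with v by ring; ring.
    - intros t Ht; pose proof (Re_segment a t Ha Ht) as Hx; fold (y a t) in Hx.
      pose proof (Re_pos_neq_0 _ Hx).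
      unfold F2, F; eapply der_eq.
      + apply (der_mult _ (y a) (fun t => ypow s v (y a t))); [apply Hl|].
        apply (der_comp _ (ypow s v) (y a)); [apply cder_ypow; exact Hx|apply Hl].
      + field; auto.
    - intros t Ht; apply tends_plus; [apply C0'|apply C2']; auto. }
  assert (EP : Pint s v a = - (a - 1) * CInt (F s v a) 0 1) by reflexivity.
  rewrite EP; set (X := CInt (F s v a) 0 1) in *; set (Y := CInt (F2 s v a) 0 1) in *.
  replace (v * (- (a - 1) * Y)) with
    ((a - 1) * (1 - s) * X - ((a - 1) * (1 - s) * X + (a - 1) * v * Y)) by ring.
  rewrite HI; ring.
Qed.

Lemma Pint_1 s v : Pint s v 1 = 0.
Proof. unfold Pint; ring. Qed.

(** ** Continuation of [Tj] to the universal covering of the punctured plane *)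

(** The principal logarithm of [j], common starting point of the segments in the [L]-plane. *)
Definition Lj (j : C) : C := j * (PI / 2)%R.

(** Integrating factor times inhomogeneity, up to sign, for the equation
    [h' = (s - 1) h - exp(exp u)]. Its primitive [hint] along the segment from [Lj j] enters [hj] by
    variation of constants. *)
Definition hphi (j s u : C) : C := Cexp (- (s - 1) * (u - Lj j) + Cexp u).

Definition hint (j s L : C) : C := (L - Lj j) * CInt (fun t => hphi j s (Lj j + t * (L - Lj j))) 0 1.

(** Up to elementary factors the incomplete Gamma function with parameters [1 - s] and [- Cexp L]. *)
Definition hj (j s L : C) : C :=
  Cexp ((s - 1) * (L - Lj j)) * (Cexp j * Tj j s j 1 - hint j s L).

Lemma Cexp_Lj j : vert j -> Cexp (Lj j) = j.
Proof.
intros [->| ->]; unfold Lj, Cexp; simpl;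
[replace (0 * (PI / 2) - 1 * 0)%R with 0%R by ring;
 replace (0 * 0 + 1 * (PI / 2))%R with (PI / 2)%R by ring
|replace (-0 * (PI / 2) - - (1) * 0)%R with 0%R by ring;
 replace (-0 * 0 + - (1) * (PI / 2))%R with (- (PI / 2))%R by ring; rewrite sin_neg, cos_neg];
rewrite exp_0, cos_PI2, sin_PI2; apply C_ext; simpl; ring.
Qed.

Lemma hint_partials (j s L c : C) :
  holo_at (fun s L _ => hint j s L) s L c /\ cder (fun w => hint j s w) L (hphi j s L).
Proof.
set (u := fun (L : C) (t : R) => Lj j + t * (L - Lj j)).
set (F := fun s L (_ : C) t => hphi j s (u L t)).
set (F1 := fun s L (_ : C) t => - (u L t - Lj j) * hphi j s (u L t)).
set (F2 := fun s L (_ : C) (t : R) => t * ((- (s - 1) + Cexp (u L t)) * hphi j s (u L t))).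
set (F3 := fun (_ _ _ : C) (_ : R) => RtoC 0).
assert (J : forall G, G = F \/ G = F1 \/ G = F2 \/ G = F3 ->
  forall s' v' a' t, joint3 G s' v' a' t).
{ intros G HG s' v' a' t.
  destruct HG as [->|[->|[->| ->]]]; unfold F, F1, F2, F3, hphi, u; joint_tac. }
assert (Dphi : forall s w, cder (hphi j s) w ((- (s - 1) + Cexp w) * hphi j s w)).
{ intros s' w; unfold hphi; eapply der_eq.
  - apply der_Cexp, der_plus; [|apply cder_Cexp].
    apply der_mult; [apply der_const|]; apply der_minus; [apply der_id|apply der_const].
  - cbv beta; ring. }
destruct (CInt_partials F F1 F2 F3 s L c 1 0 1 ltac:(lra) ltac:(lra)) as [T0 [D1 [D2 D3]]]; auto.
{ intros s' v' a' t Hd Ht; unfold F, F1, F2, F3; split; [|split].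
  - unfold hphi; eapply der_eq; [apply der_Cexp, der_plus; [|apply der_const];
      apply der_mult; [|apply der_const]; apply der_opp, der_minus; [apply der_id|apply der_const]|];
      cbv beta; ring.
  - eapply der_eq; [apply (der_comp _ (hphi j s') (fun w => u w t)); [apply Dphi|];
      unfold u; apply der_plus; [apply der_const|]; apply der_mult; [apply der_const|];
      apply der_minus; [apply der_id|apply der_const]|]; cbv beta; ring.
  - apply der_const. }
assert (Da : cder (fun w => hint j s w) L (hphi j s L)).
{ pose proof (CInt_radial (hphi j s) (fun u => (- (s - 1) + Cexp u) * hphi j s u) (Lj j) (L - Lj j)) as HR.
  unfold hint; eapply der_eq.
  - apply der_mult; [|exact D2].
    apply der_minus; [apply der_id|apply der_const].
  - cbv beta; unfold F2, u in *.
    replace (Lj j + (L - Lj j)) with L in HR by ring.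
    rewrite <- HR.
    + ring.
    + intros t Ht; apply Dphi.
    + intros t Ht; apply (joint3_slice (fun s L (_ : C) t => (- (s - 1) + Cexp (u L t)) * hphi j s (u L t)) s L c t).
      unfold u, hphi; joint_tac. }
split; auto; split; [|split; [|split; eauto]].
- unfold hint; apply tends_mult; [|exact T0].
  apply tends_minus; [apply tends_coord2|apply tends_const].
- eexists; unfold hint; apply der_mult; [apply der_const|exact D1].
- eexists; apply der_const.
Qed.

Lemma KI_holo_at (k : R -> C) (j s v a : C) : vert j -> (Re (j * v) < 0)%R -> (0 < Re a)%R ->
  bounded1 k -> holo_at (KI k j) s v a.
Proof.
intros H1 H2 H3 H4; destruct (KI_partials k j s v a H1 H2 H3 H4) as [_ [T0 [D1 [D2 D3]]]].
split; [exact T0|split; [|split]]; eexists; [exact D1|exact D2|exact D3].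
Qed.

Lemma vert_neg j : vert j -> (Re (j * j) < 0)%R.
Proof. intro H; rewrite vert_sqr by auto; simpl; lra. Qed.

Lemma hj_holo_at (j s L c : C) : vert j -> holo_at (fun s L _ => hj j s L) s L c.
Proof.
intro Hj; unfold hj; apply holo_at_mult.
- apply holo_at_Cexp, holo_at_mult; apply holo_at_minus; try apply holo_at_const; [apply holo_at_coord1|apply holo_at_coord2].
- apply holo_at_minus; [|apply hint_partials].
  apply holo_at_mult; [apply holo_at_const|].
  apply (holo_at_comp _ _ _ (Tj j) (fun _ => j) (fun _ => RtoC 1) 0 0); try apply der_const.
  apply (KI_holo_at (fun _ => j)); [auto|apply vert_neg; auto|simpl; lra|apply bounded1_const; auto].
Qed.

(** This is the equation of [exp(v) * Tj j s v 1] in the variable [L = log v], as read off from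
    [Tj_derivatives] at [a = 1]. *)
Lemma cder_hj (j s L : C) : cder (fun w => hj j s w) L ((s - 1) * hj j s L - Cexp (Cexp L)).
Proof.
destruct (hint_partials j s L 0) as [_ D].
unfold hj; eapply der_eq.
- apply der_mult.
  + apply der_Cexp, der_mult; [apply der_const|]; apply der_minus; [apply der_id|apply der_const].
  + apply der_minus; [apply der_const|exact D].
- cbv beta.
  assert (E : Cexp (Cexp L) = Cexp ((s - 1) * (L - Lj j)) * hphi j s L).
  { unfold hphi; rewrite <- Cexp_plus; f_equal; ring. }
  rewrite E; ring.
Qed.

(** Multiplied by [exp(v a)], [Tj] is the integral of [ypow s v] from [a] to infinity in direction
    [j], so changing [a] to [1] only adds the integral between these two points. *)
Lemma Tj_shift (j s v a : C) : vert j -> (Re (j * v) < 0)%R -> (0 < Re a)%R ->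
  Cexp (v * a) * Tj j s v a = Cexp v * Tj j s v 1 + Pint s v a.
Proof.
intros Hj Hv Ha.
assert (E : Cexp (v * a) * Tj j s v a - Pint s v a = Cexp (v * 1) * Tj j s v 1 - Pint s v 1).
{ apply (cder_zero_segment (fun a => Cexp (v * a) * Tj j s v a - Pint s v a) 1 a).
  intros t Ht; pose proof (Re_segment a t Ha Ht) as Hx; set (b := 1 + t * (a - 1)) in *.
  destruct (Tj_derivatives j s v b Hj Hv Hx) as [_ [Ta [_ [D [_ E]]]]].
  destruct (Pint_partials s v b Hx) as [_ [DP _]].
  eapply der_eq.
  - apply der_minus; [|exact DP].
    apply der_mult; [|exact D]; apply der_Cexp, der_mult; [apply der_const|apply der_id].
  - cbv beta; unfold ypow; unfold Cminus at 2; rewrite Cexp_plus.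
    replace (Cexp (- (s * Clog b))) with (- (Ta + v * Tj j s v b)); [ring|].
    rewrite E; replace (- (s * Clog b)) with (- s * Clog b) by ring; ring. }
rewrite Pint_1 in E; replace (v * 1) with v in E by ring.
replace (Cexp v * Tj j s v 1) with (Cexp v * Tj j s v 1 - 0) by ring; rewrite <- E; ring.
Qed.

Lemma Re_vert_Cexp (j L : C) : vert j -> (Rabs (Im (L - Lj j)) < PI / 2)%R ->
  (Re (j * Cexp L) < 0)%R.
Proof.
intros Hj HL; apply Re_Cexp_pos in HL.
replace (j * Cexp L) with (- Cexp (L - Lj j)); [simpl in *; unfold Re, Im in *; simpl in *; lra|].
replace (Cexp L) with (Cexp (L - Lj j) * Cexp (Lj j)) by (rewrite <- Cexp_plus; f_equal; ring).
rewrite Cexp_Lj by auto.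
replace (j * (Cexp (L - Lj j) * j)) with (j * j * Cexp (L - Lj j)) by ring.
rewrite vert_sqr by auto; ring.
Qed.

(** Both sides solve the same first order linear differential equation in [L]
    and agree at [Lj j]. *)
Lemma Tj_hj (j s L : C) : vert j -> (Rabs (Im (L - Lj j)) < PI / 2)%R ->
  Cexp (Cexp L) * Tj j s (Cexp L) 1 = hj j s L.
Proof.
intros Hj HL.
set (X := fun L => Cexp (- (s - 1) * (L - Lj j)) * (Cexp (Cexp L) * Tj j s (Cexp L) 1 - hj j s L)).
assert (E : X L = X (Lj j)).
{ apply cder_zero_segment; intros t Ht; set (u := Lj j + t * (L - Lj j)).
  assert (Hu : (Re (j * Cexp u) < 0)%R).
  { apply Re_vert_Cexp; auto; unfold u.
    replace (Lj j + t * (L - Lj j) - Lj j) with (t * (L - Lj j)) by ring.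
    replace (Im (t * (L - Lj j))) with (t * Im (L - Lj j))%R by (simpl; unfold Im; ring).
    rewrite Rabs_mult, (Rabs_pos_eq t) by lra; pose proof (Rabs_pos (Im (L - Lj j))); nra. }
  destruct (Tj_derivatives j s (Cexp u) 1 Hj Hu ltac:(simpl; lra)) as [Tv [_ [D [_ [E _]]]]].
  unfold X; eapply der_eq.
  - apply der_mult.
    + apply der_Cexp, der_mult; [apply der_const|]; apply der_minus; [apply der_id|apply der_const].
    + apply der_minus; [|apply cder_hj].
      apply der_mult; [apply der_Cexp, cder_Cexp|].
      apply (der_comp _ (fun w => Tj j s w 1) Cexp); [exact D|apply cder_Cexp].
  - cbv beta; rewrite Clog_1 in E; replace (- s * 0) with (RtoC 0) in E by ring.
    rewrite Cexp_0 in E.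
    set (A := Cexp u) in *; set (B := Tj j s A 1) in *; set (H := hj j s u).
    set (G := Cexp (- (s - 1) * (u - Lj j))).
    replace (_ + _) with (G * (Cexp A * ((A * Tv + 1 * A * B) - (s - 1) * B + 1))) by ring.
    rewrite E; ring. }
assert (E0 : X (Lj j) = 0).
{ unfold X, hj, hint; replace (Lj j - Lj j) with (RtoC 0) by ring.
  replace ((s - 1) * 0) with (RtoC 0) by ring; rewrite Cexp_0, Cexp_Lj by auto; ring. }
rewrite E0 in E; unfold X in E.
assert (E1 : Cexp (Cexp L) * Tj j s (Cexp L) 1 - hj j s L = 0).
{ apply NNPP; intro Hn; apply (Cmult_neq_0 _ _ (Cexp_neq_0 (- (s - 1) * (L - Lj j))) Hn E). }
replace (hj j s L) with (hj j s L + 0) by ring; rewrite <- E1; ring.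
Qed.

(** The integral splits into a part entire in the logarithm of [v] and a part [Pint] entire in [v];
    only the first has monodromy around [v = 0]. *)
Lemma Tj_continuation (j s v a : C) : vert j -> (Re (j * v) < 0)%R -> (0 < Re a)%R ->
  Cexp (v * a) * Tj j s v a = hj j s (Lj j + Clog (- (j * v))) + Pint s v a.
Proof.
intros Hj Hv Ha; rewrite Tj_shift by auto; f_equal.
assert (H : (0 < Re (- (j * v)))%R) by (simpl in *; unfold Re in *; simpl in *; lra).
rewrite <- Tj_hj; auto.
- rewrite Cexp_plus, Cexp_Lj, Cexp_Clog by auto.
  replace (j * - (j * v)) with (- (j * j) * v) by ring; rewrite vert_sqr by auto.
  replace (- - (1) * v) with v by ring; reflexivity.
- replace (Lj j + Clog (- (j * v)) - Lj j) with (Clog (- (j * v))) by ring.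
  apply Im_Clog_bound; auto.
Qed.

Lemma con_on_bounded (a b : R) (F : R -> C) : (a <= b)%R -> con_on a b F ->
  exists K, forall t, (a <= t <= b)%R -> (Cmod (F t) <= K)%R.
Proof.
intros Hab HF.
destruct (continuity_ab_maj (fun t => Cmod (F t)) a b Hab) as [m [Hm _]].
- intros t Ht eps He.
  destruct (tends_Cmod _ _ _ (HF t Ht) eps He) as [r [Hr H]].
  exists r; split; auto; intros x [_ Hx].
  specialize (H x); rewrite at_RE, <- RtoC_minus, Cmod_R in H; apply H; exact Hx.
- eexists; apply Hm.
Qed.

(** The kernel used below has poles on the real axis, so that explicit estimates exist for [y >= 1]
    only. On [[0, 1]] compactness gives a bound, converted into exponential form at the price of a
    factor [exp k]. *)
Lemma expdec_near {T : Type} (d : T -> R) (p0 : T) (F : T -> R -> C) (K k r : R) :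
  d p0 = 0%R -> (0 < r)%R -> (0 < k)%R ->
  (forall y, (0 <= y)%R -> joint d F p0 y) ->
  (forall p y, (d p < r)%R -> (0 <= y)%R -> conR (F p) y) ->
  (forall p y, (d p < r)%R -> (1 <= y)%R -> (Cmod (F p y) <= K * exp (- k * y))%R) ->
  exists r' K', (0 < r')%R /\ forall p, (d p < r')%R -> expdec (F p) K' k.
Proof.
intros Hd Hr Hk HJ Hc HB.
destruct (joint_uniform d p0 Hd F 0 1) with (eps := 1%R) as [r1 [Hr1 H1]];
  [intros; apply HJ; lra|lra|].
destruct (con_on_bounded 0 1 (F p0)) as [B HB1]; [lra|intros t Ht; apply Hc; lra|].
assert (HB0 : (0 <= B)%R).
{ eapply Rle_trans; [apply Cmod_ge_0|apply (HB1 0%R); lra]. }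
exists (Rmin r r1), (Rmax K ((B + 1) * exp k)); split; [apply Rmin_pos; auto|].
intros p Hp.
assert (Hp1 : (d p < r)%R) by (eapply Rlt_le_trans; [apply Hp|apply Rmin_l]).
assert (Hp2 : (d p < r1)%R) by (eapply Rlt_le_trans; [apply Hp|apply Rmin_r]).
split; [auto|split; [auto|]]; intros y Hy.
pose proof (exp_pos (- k * y)).
destruct (Rle_dec 1 y) as [H3|H3].
- eapply Rle_trans; [apply HB; auto|]; apply Rmult_le_compat_r; [lra|apply Rmax_l].
- apply Rle_trans with ((B + 1) * exp k * exp (- k * y))%R.
  + rewrite Rmult_assoc, <- exp_plus.
    assert (1 <= exp (k + - k * y))%R.
    { pose proof (exp_ineq1_le (k + - k * y)); assert (0 <= k * (1 - y))%R by (apply Rmult_le_pos; lra); lra. }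
    specialize (H1 p y Hp2 ltac:(lra)); specialize (HB1 y ltac:(lra)).
    pose proof (Cmod_triangle_rev (F p y) (F p0 y)).
    apply Rle_trans with ((B + 1) * 1)%R; [lra|apply Rmult_le_compat_l; lra].
  + apply Rmult_le_compat_r; [lra|apply Rmax_r].
Qed.

(** * A contour shift across a simple pole *)

Definition I2pi : C := (2 * PI)%R * Ci.

Definition rker (x : C) : C := / (1 - Cexp (I2pi * x)).

(** [rker x] and [rker x - 1 = Cexp (I2pi * x) * rker x] for [j = Ci] and
    [j = - Ci] respectively. *)
Definition Rker (j x : C) : C := rker x - (1 + Ci * j) / 2.

(** With [line_j j v] in place of [v] this is [exp(v x) (x + c)^(-s) / (1 - exp(2 pi i x))] at
    [x = z + j y], see [Mker_Epow]. In the lower half-plane the decay of the kernel has been moved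
    into the exponential, which leaves the bounded factor [rker - 1]. *)
Definition Mker (j s v c z : C) (y : R) : C :=
  Cexp (v * z) * kexp j s v (z + c) y * Rker j (z + j * y).

Definition dMker (j s v c z : C) (y : R) : C :=
  Cexp (v * z) * kexp j s v (z + c) y *
  ((v - s / (z + c + j * y)) * Rker j (z + j * y) +
   I2pi * rker (z + j * y) * (rker (z + j * y) - 1)).

Lemma Re_I2pi (x : C) : Re (I2pi * x) = (- (2 * PI) * Im x)%R.
Proof. unfold I2pi; simpl; unfold Re, Im; ring. Qed.

Lemma Im_vert (j : C) (y : R) : vert j -> Im (j * y) = (y * Im j)%R.
Proof. intros [->| ->]; simpl; ring. Qed.

Lemma C2_neq_0 : RtoC 2 <> 0.
Proof. intro E; apply RtoC_inj in E; lra. Qed.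

Lemma Rker_vert j x : vert j -> (j = Ci /\ Rker j x = rker x) \/ (j = - Ci /\ Rker j x = rker x - 1).
Proof.
pose proof C2_neq_0.
assert (E : Ci * Ci = - (1)) by (apply C_ext; simpl; ring).
intros [->| ->]; [left|right]; split; auto; unfold Rker.
- rewrite E; field; auto.
- replace (Ci * - Ci) with (- (Ci * Ci)) by ring; rewrite E; field; auto.
Qed.

(** The point [z + j y] has height at least [1/2] in absolute value, so that [exp(2 pi i x)] has
    modulus at most [exp(-pi) <= 1/2] in the upper half-plane and at least [exp(pi) >= 2] in the
    lower one. *)
Lemma Rker_bound (j z : C) (y : R) : vert j -> (Rabs (Im z) < / 2)%R -> (1 <= y)%R ->
  (Cmod (Rker j (z + j * y)) <= 2 /\ Cmod (rker (z + j * y)) <= 2 /\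
   Cmod (rker (z + j * y) - 1) <= 2)%R.
Proof.
intros Hj Hz Hy; set (x := z + j * y); apply Rabs_def2 in Hz.
assert (He : (exp (- PI) <= / 2)%R).
{ rewrite exp_Ropp; apply Rinv_le_contravar; [lra|].
  pose proof (exp_ineq1_le PI); pose proof PI2_3_2; lra. }
assert (He' : (2 <= exp PI)%R) by (pose proof (exp_ineq1_le PI); pose proof PI2_3_2; lra).
pose proof PI_RGT_0.
set (q := Cexp (I2pi * x)).
assert (Hq : Cmod q = exp (- (2 * PI) * Im x)) by (unfold q; rewrite Cmod_Cexp, Re_I2pi; auto).
assert (Ix : Im x = (Im z + y * Im j)%R) by (unfold x; rewrite <- (Im_vert j y Hj); reflexivity).
assert (H1 : (q <> 1 /\ (Cmod (/ (1 - q)) <= 2 /\ Cmod (q / (1 - q)) <= 2))%R).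
{ assert (IC : Im Ci = 1%R) by reflexivity.
  assert (IC' : Im (- Ci) = (- (1))%R) by reflexivity.
  destruct Hj as [->| ->]; rewrite ?IC, ?IC' in Ix.
  - assert (Hq1 : (Cmod q <= / 2)%R).
    { rewrite Hq; eapply Rle_trans; [|apply He]; apply exp_mono.
      assert (/ 2 <= Im x)%R by lra; nra. }
    assert (Hd : (/ 2 <= Cmod (1 - q))%R).
    { pose proof (Cmod_triangle_rev 1 q); rewrite Cmod_1 in *; lra. }
    assert (1 - q <> 0) by (apply Cmod_gt_0; lra).
    assert (Hi : (/ Cmod (1 - q) <= 2)%R).
    { rewrite <- (Rinv_inv 2); apply Rinv_le_contravar; lra. }
    split; [|split].
    + intro E; rewrite E, Cmod_1 in Hq1; lra.
    + rewrite Cmod_inv; auto.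
    + rewrite Cmod_div by auto; unfold Rdiv.
      apply Rle_trans with (1 * 2)%R; [|lra].
      apply Rmult_le_compat; auto using Cmod_ge_0; [|lra].
      left; apply Rinv_0_lt_compat; lra.
  - assert (Hq1 : (2 <= Cmod q)%R).
    { rewrite Hq; eapply Rle_trans; [apply He'|]; apply exp_mono.
      assert (Im x <= - / 2)%R by lra; nra. }
    assert (Hd : (Cmod q / 2 <= Cmod (1 - q))%R).
    { pose proof (Cmod_triangle_rev q 1) as D; rewrite Cmod_1 in D; rewrite (Cmod_sub_sym 1 q); lra. }
    assert (1 - q <> 0) by (apply Cmod_gt_0; lra).
    split; [|split].
    + intro E; rewrite E, Cmod_1 in Hq1; lra.
    + rewrite Cmod_inv by auto; apply Rle_trans with (/ 1)%R; [apply Rinv_le_contravar; lra|lra].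
    + rewrite Cmod_div by auto; apply Rmult_le_reg_r with (Cmod (1 - q)); [lra|].
      unfold Rdiv; rewrite Rmult_assoc, Rinv_l; lra. }
destruct H1 as [H1 [H2 H3]].
assert (H0 : 1 - q <> 0).
{ intro E; apply H1; replace q with (1 - (1 - q)) by ring; rewrite E; ring. }
assert (E : rker x - 1 = q / (1 - q)) by (unfold rker; fold q; field; auto).
assert (E' : rker x = / (1 - q)) by reflexivity.
destruct (Rker_vert j x Hj) as [[_ ->]|[_ ->]]; rewrite E, E'; auto.
Qed.

Lemma rker_neq (x : C) : (0 < Rabs (Re x) < 1)%R -> 1 - Cexp (I2pi * x) <> 0.
Proof.
intros Hx E.
assert (E1 : Cexp (I2pi * x) = 1).
{ replace (Cexp (I2pi * x)) with (1 - (1 - Cexp (I2pi * x))) by ring; rewrite E; ring. }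
destruct (Cexp_eq_1 _ E1) as [k Hk].
assert (E2 : Re x = IZR k).
{ apply (f_equal Im) in Hk; unfold I2pi in Hk; simpl in Hk; unfold Re, Im in *.
  apply Rmult_eq_reg_l with (2 * PI)%R; [|pose proof PI_RGT_0; lra]; lra. }
rewrite E2, <- abs_IZR in Hx.
assert (0 < Z.abs k)%Z by (apply lt_IZR; lra); assert (Z.abs k < 1)%Z by (apply lt_IZR; lra); lia.
Qed.

Lemma cder_rker (x : C) : 1 - Cexp (I2pi * x) <> 0 ->
  cder rker x (I2pi * rker x * (rker x - 1)).
Proof.
intro Hx; unfold rker; eapply der_eq.
- apply der_inv; [exact Hx|].
  apply der_minus; [apply der_const|]; apply der_Cexp, der_mult; [apply der_const|apply der_id].
- cbv beta; field; auto.
Qed.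

Section Shift.
Variables (j s v c : C).
Hypotheses (Hj : vert j) (Hv : (Re (j * v) < 0)%R).

Lemma Mker_bounds (z0 : C) : Im z0 = 0%R -> (0 < Re (z0 + c))%R ->
  exists r K k, (0 < r)%R /\ (0 < k)%R /\ forall z, (at_pt z0 z < r)%R ->
    (0 < Re (z + c))%R /\ forall y, (1 <= y)%R ->
      (Cmod (Mker j s v c z y) <= K * exp (- k * y) /\
       Cmod (dMker j s v c z y) <= K * exp (- k * y))%R.
Proof.
intros Hz0 Hz.
destruct (kexp_bounds j s v (z0 + c) Hj Hv Hz) as [r [K [k [Hr [Hk H]]]]].
set (B := exp (Cmod v * (Cmod z0 + 1))).
assert (HB : (0 < B)%R) by apply exp_pos.
pose proof (Cmod_ge_0 v); pose proof PI_RGT_0.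
(* The kernels being bounded by 2, the three terms of [dMker] contribute [2 |v|], [2] and
   [2 pi * 2 * 2] to the constant. *)
exists (Rmin r (/ 2)), (B * (2 * (Cmod v + 1 + 4 * PI) * K))%R, k.
split; [apply Rmin_pos; lra|]; split; auto.
intros z Hd; unfold at_pt in Hd.
assert (Hd1 : (Cmod (z - z0) < r)%R) by (eapply Rlt_le_trans; [apply Hd|apply Rmin_l]).
assert (Hd2 : (Cmod (z - z0) < / 2)%R) by (eapply Rlt_le_trans; [apply Hd|apply Rmin_r]).
destruct (H s v (z + c)) as [Ha [_ HK]].
{ apply dist3_lt; rewrite !Cmod_zero_sub; replace (z + c - (z0 + c)) with (z - z0) by ring; auto. }
split; auto; intros y Hy.
assert (Iz : (Rabs (Im z) < / 2)%R).
{ eapply Rle_lt_trans; [|apply Hd2].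
  replace (Im z) with (Im (z - z0)); [apply im_le_Cmod|].
  change (Im (z - z0)) with (Im z - Im z0)%R; rewrite Hz0; ring. }
destruct (Rker_bound j z y Hj Iz Hy) as [R1 [R2 R3]].
assert (EB : (Cmod (Cexp (v * z)) <= B)%R).
{ rewrite Cmod_Cexp; apply exp_mono; eapply Rle_trans; [apply Re_le_Cmod|].
  rewrite Cmod_mult; apply Rmult_le_compat_l; auto.
  pose proof (Cmod_triangle_rev z z0); lra. }
assert (K1 := HK y 1 ltac:(lra) (or_introl eq_refl)).
assert (K2 := HK y _ ltac:(lra) (or_intror (or_intror (or_intror eq_refl)))).
rewrite Cmult_1_l in K1.
set (E := kexp j s v (z + c) y) in *; set (e := (K * exp (- k * y))%R) in *.
assert (He : (0 <= e)%R) by (eapply Rle_trans; [apply Cmod_ge_0|apply K1]).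
replace (B * (2 * (Cmod v + 1 + 4 * PI) * K) * exp (- k * y))%R
  with (B * (2 * (Cmod v + 1 + 4 * PI) * e))%R by (unfold e; ring).
unfold Mker, dMker; fold E.
set (X := Rker j (z + j * y)) in *; set (Y := rker (z + j * y)) in *.
split.
- rewrite <- Cmult_assoc, Cmod_mult; apply Rmult_le_compat; auto using Cmod_ge_0.
  rewrite Cmod_mult; apply Rle_trans with (e * 2)%R.
  + apply Rmult_le_compat; auto using Cmod_ge_0.
  + assert (0 <= (Cmod v + 4 * PI) * e)%R by (apply Rmult_le_pos; lra); lra.
- replace (Cexp (v * z) * E * ((v - s / (z + c + j * y)) * X + I2pi * Y * (Y - 1)))
    with (Cexp (v * z) * (v * E * X + (- (s / (z + c + j * y)) * E * X + I2pi * Y * (Y - 1) * E)))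
    by ring.
  rewrite Cmod_mult; apply Rmult_le_compat; auto using Cmod_ge_0.
  eapply Rle_trans; [apply Cmod_triangle|].
  eapply Rle_trans; [apply Rplus_le_compat_l, Cmod_triangle|].
  assert (A1 : (Cmod (v * E * X) <= Cmod v * e * 2)%R).
  { rewrite !Cmod_mult; apply Rmult_le_compat; auto using Cmod_ge_0.
    - apply Rmult_le_pos; auto using Cmod_ge_0.
    - apply Rmult_le_compat_l; auto. }
  assert (A2 : (Cmod (- (s / (z + c + j * y)) * E * X) <= e * 2)%R).
  { rewrite Cmod_mult; apply Rmult_le_compat; auto using Cmod_ge_0. }
  assert (A3 : (Cmod (I2pi * Y * (Y - 1) * E) <= 2 * PI * 2 * 2 * e)%R).
  { rewrite !Cmod_mult; apply Rmult_le_compat; auto using Cmod_ge_0.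
    - repeat apply Rmult_le_pos; auto using Cmod_ge_0.
    - apply Rmult_le_compat; auto using Cmod_ge_0.
      + apply Rmult_le_pos; auto using Cmod_ge_0.
      + apply Rmult_le_compat; auto using Cmod_ge_0.
        unfold I2pi; rewrite Cmod_mult, Cmod_R, Cmod_Ci, Rabs_pos_eq; lra. }
  lra.
Qed.

(** [Mker] is a function of [z + j y], so its derivative in [y] is [j] times the one in [z]. This
    plays the part of Cauchy's theorem. *)
Lemma Mker_cder (z : C) (y : R) : (0 < Re (z + c))%R -> (0 < Rabs (Re z) < 1)%R ->
  cder (fun w => Mker j s v c w y) z (dMker j s v c z y) /\
  rder (Mker j s v c z) y (j * dMker j s v c z y).
Proof.
intros Hz Hz1.
assert (Hx : (0 < Re (z + c + j * y))%R) by (rewrite vert_Re; auto).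
assert (Hx0 := Re_pos_neq_0 _ Hx).
assert (Hq : 1 - Cexp (I2pi * (z + j * y)) <> 0) by (apply rker_neq; rewrite vert_Re; auto).
assert (DR : cder (Rker j) (z + j * y) (I2pi * rker (z + j * y) * (rker (z + j * y) - 1))).
{ unfold Rker; eapply der_eq; [apply der_minus; [apply cder_rker; auto|apply der_const]|]; ring. }
unfold Mker, dMker; split; eapply der_eq.
- apply der_mult.
  + apply der_mult; [apply der_Cexp, der_mult; [apply der_const|apply der_id]|].
    unfold kexp; apply der_Cexp, der_minus; [apply der_const|].
    apply der_mult; [apply der_const|]; apply der_Clog; [exact Hx|].
    apply der_plus; [|apply der_const]; apply der_plus; [apply der_id|apply der_const].
  + apply (der_comp _ (Rker j) (fun w => w + j * y)); [exact DR|].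
    apply der_plus; [apply der_id|apply der_const].
- cbv beta; unfold kexp; field; auto.
- apply der_mult.
  + apply der_mult; [apply der_const|]; apply kexp_rder; auto.
  + apply (der_comp _ (Rker j) (fun y : R => z + j * y)); [exact DR|].
    apply der_plus; [apply der_const|]; apply der_mult; [apply der_const|apply der_id].
- cbv beta; field; auto.
Qed.

Lemma Mker_joint (z : C) (y : R) : (0 < Re (z + c))%R -> 1 - Cexp (I2pi * (z + j * y)) <> 0 ->
  joint (at_pt z) (Mker j s v c) z y /\ joint (at_pt z) (dMker j s v c) z y /\
  conR (Mker j s v c z) y /\ conR (dMker j s v c z) y.
Proof.
intros Hz Hq.
assert (Hx : (0 < Re (z + c + j * y))%R) by (rewrite vert_Re; auto).
assert (Hx0 := Re_pos_neq_0 _ Hx).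
assert (J1 : joint3 (fun (_ z _ : C) y => Mker j s v c z y) 0 z 0 y)
  by (unfold Mker, Rker, rker, kexp; joint_tac; auto).
assert (J2 : joint3 (fun (_ z _ : C) y => dMker j s v c z y) 0 z 0 y)
  by (unfold dMker, Rker, rker, kexp; joint_tac; auto).
apply joint3_slice in J1; apply joint3_slice in J2; tauto.
Qed.

Lemma Mker_expdec (z0 : C) : Im z0 = 0%R -> (0 < Re (z0 + c))%R -> (0 < Rabs (Re z0) < 1)%R ->
  exists r K k, (0 < r)%R /\ forall z, (at_pt z0 z < r)%R -> (0 < Rabs (Re z) < 1)%R /\
    (0 < Re (z + c))%R /\ expdec (Mker j s v c z) K k /\ expdec (dMker j s v c z) K k.
Proof.
intros Hz0 Hz Hz1.
destruct (Mker_bounds z0 Hz0 Hz) as [r [K [k [Hr [Hk H]]]]].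
set (r1 := Rmin r (Rmin (Rabs (Re z0)) (1 - Rabs (Re z0)))).
assert (Hr1 : (0 < r1)%R) by (repeat apply Rmin_pos; lra).
assert (HR : forall z, (at_pt z0 z < r1)%R -> (0 < Rabs (Re z) < 1)%R).
{ intros z Hd; unfold at_pt in Hd.
  assert (D1 : (Cmod (z - z0) < Rabs (Re z0))%R).
  { eapply Rlt_le_trans; [apply Hd|]; eapply Rle_trans; [apply Rmin_r|apply Rmin_l]. }
  assert (D2 : (Cmod (z - z0) < 1 - Rabs (Re z0))%R).
  { eapply Rlt_le_trans; [apply Hd|]; eapply Rle_trans; [apply Rmin_r|apply Rmin_r]. }
  pose proof (re_le_Cmod (z - z0)) as D3; change (Re (z - z0)) with (Re z - Re z0)%R in D3.
  pose proof (Rabs_triang_inv (Re z0) (Re z)) as D4; rewrite Rabs_minus_sym in D4.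
  pose proof (Rabs_triang_inv (Re z) (Re z0)); lra. }
assert (HL : forall z, (at_pt z0 z < r1)%R -> (at_pt z0 z < r)%R).
{ intros z Hd; eapply Rlt_le_trans; [apply Hd|apply Rmin_l]. }
assert (HJ : forall z y, (at_pt z0 z < r1)%R ->
  joint (at_pt z) (Mker j s v c) z y /\ joint (at_pt z) (dMker j s v c) z y /\
  conR (Mker j s v c z) y /\ conR (dMker j s v c z) y).
{ intros z y Hd; apply Mker_joint; [apply (H z); auto|].
  apply rker_neq; rewrite vert_Re; auto. }
assert (H0 : (at_pt z0 z0 < r1)%R) by (rewrite at_pt_refl; auto).
destruct (expdec_near (at_pt z0) z0 (Mker j s v c) K k r1) as [r2 [K2 [Hr2 H2]]];
  [apply at_pt_refl|auto|auto|intros; apply HJ; auto|intros; apply HJ; auto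
  |intros z y Hd Hy; apply (H z); auto|].
destruct (expdec_near (at_pt z0) z0 (dMker j s v c) K k r1) as [r3 [K3 [Hr3 H3]]];
  [apply at_pt_refl|auto|auto|intros; apply HJ; auto|intros; apply HJ; auto
  |intros z y Hd Hy; apply (H z); auto|].
exists (Rmin r1 (Rmin r2 r3)), (Rmax K2 K3), k.
split; [apply Rmin_pos; [auto|apply Rmin_pos; auto]|].
intros z Hd.
assert (D1 : (at_pt z0 z < r1)%R) by (eapply Rlt_le_trans; [apply Hd|apply Rmin_l]).
split; [auto|]; split; [apply (H z); auto|]; split.
- apply expdec_le with K2; [apply Rmax_l|]; apply H2.
  eapply Rlt_le_trans; [apply Hd|]; eapply Rle_trans; [apply Rmin_r|apply Rmin_l].
- apply expdec_le with K3; [apply Rmax_r|]; apply H3.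
  eapply Rlt_le_trans; [apply Hd|]; eapply Rle_trans; [apply Rmin_r|apply Rmin_r].
Qed.

(** The integral of [dMker] is [1/j] times that of a total derivative in [y], hence a boundary value
    at [y = 0]; the factor is [- 1/j = j]. *)
Lemma int_half_line_Mker_cder (z0 : C) : Im z0 = 0%R -> (0 < Re (z0 + c))%R -> (0 < Rabs (Re z0) < 1)%R ->
  cder (fun z => int_half_line (Mker j s v c z)) z0 (j * Mker j s v c z0 0).
Proof.
intros Hz0 Hz Hz1.
destruct (Mker_expdec z0 Hz0 Hz Hz1) as [r [K [k [Hr H]]]].
assert (H0 : (at_pt z0 z0 < r)%R) by (rewrite at_pt_refl; auto).
destruct (H z0 H0) as [_ [_ [E0 E1]]].
eapply der_eq.
- apply (int_half_line_cder (Mker j s v c) (dMker j s v c) z0 K k r); auto.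
  + intros w y Hw Hy; destruct (H w Hw) as [A1 [A2 _]]; apply Mker_cder; auto.
  + intros w Hw; apply (H w Hw).
  + intros w Hw; apply (H w Hw).
  + intros y Hy; apply Mker_joint; auto; apply rker_neq; rewrite vert_Re; auto.
- assert (E2 : j * int_half_line (dMker j s v c z0) = - Mker j s v c z0 0).
  { rewrite <- (int_half_line_scal _ j _ _ E1).
    apply (int_half_line_derive (Mker j s v c z0) _ _ K _ (expdec_scal _ j _ _ E1)).
    - intros t Ht; apply Mker_cder; auto.
    - apply E0. }
  replace (int_half_line (dMker j s v c z0)) with (- (j * j) * int_half_line (dMker j s v c z0))
    by (rewrite vert_sqr by auto; ring).
  replace (- (j * j) * int_half_line (dMker j s v c z0)) with (- j * (j * int_half_line (dMker j s v c z0))) by ring.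
  rewrite E2; ring.
Qed.

End Shift.

Definition kK (j : C) (y : R) : C := j * (/ (1 + exp (- (2 * PI) * y)))%R.

(** [kap Ci s v c] and, up to sign, [kap (- Ci) s (v - I2pi) c] are the integrals of
    [exp(v x) (x+c)^(-s) / (1 - exp(2 pi i x)) dx] along [-1/2 + j R_+]. *)
Definition kap (j s v c : C) : C := Cexp (- (v / 2)) * KI (kK j) j s v (c - / 2).

Lemma rder_RtoC (g : R -> R) (t l : R) : is_derive g t l -> rder (fun x => RtoC (g x)) t l.
Proof.
intro H; apply der_of_eps; [intros q Hq; apply RtoC_inj in Hq; subst; auto|].
intros eps He; apply is_derive_Reals in H; destruct (H eps He) as [r Hr].
exists r; split; [apply cond_pos|]; intros q Hq.
rewrite <- !RtoC_minus, <- RtoC_mult, <- RtoC_minus, !Cmod_R in *.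
destruct (Req_dec q t) as [->|Hn].
- replace (g t - g t - (t - t) * l)%R with 0%R by ring; rewrite Rabs_R0.
  apply Rmult_le_pos; [lra|apply Rabs_pos].
- specialize (Hr (q - t)%R ltac:(lra) Hq).
  replace (t + (q - t))%R with q in Hr by ring.
  replace (g q - g t - (q - t) * l)%R with (((g q - g t) / (q - t) - l) * (q - t))%R by (field; lra).
  rewrite Rabs_mult; apply Rmult_le_compat_r; [apply Rabs_pos|lra].
Qed.

Lemma atan_le_id (x : R) : (0 <= x)%R -> (0 <= atan x <= x)%R.
Proof.
intro Hx; destruct Hx as [Hx|<-]; [|rewrite atan_0; lra].
destruct (MVT_gen atan 0 x (fun t => / (1 + t ^ 2))%R) as [t [Ht E]].
- intros t Ht; apply is_derive_Reals.
  apply derivable_pt_lim_atan.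
- intros t Ht; apply derivable_continuous_pt, derivable_pt_atan.
- rewrite atan_0, !Rminus_0_r in E; rewrite E.
  pose proof (pow2_ge_0 t).
  assert (0 < / (1 + t ^ 2))%R by (apply Rinv_0_lt_compat; lra).
  assert (/ (1 + t ^ 2) <= / 1)%R by (apply Rinv_le_contravar; lra).
  rewrite Rinv_1 in *; split; nra.
Qed.

Lemma conR_RtoC (g : R -> R) t : ex_derive g t -> conR (fun x => RtoC (g x)) t.
Proof. intros [l H]; apply rder_conR with (RtoC l), rder_RtoC; auto. Qed.

Lemma bounded1_kK j : vert j -> bounded1 (kK j).
Proof.
intro Hj; split; intros y Hy; pose proof (exp_pos (- (2 * PI) * y)).
- unfold kK; apply tends_mult; [apply tends_const|].
  apply (conR_RtoC (fun y => / (1 + exp (- (2 * PI) * y)))%R); auto_derive; lra.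
- unfold kK; rewrite Cmod_mult, vert_mod, Cmod_R, Rabs_pos_eq by
    (auto; left; apply Rinv_0_lt_compat; lra).
  rewrite Rmult_1_l, <- Rinv_1; apply Rinv_le_contravar; lra.
Qed.

Lemma vert_Cexp_PI j (y : R) : vert j -> Cexp (I2pi * (j * y)) = RtoC (exp (- (2 * PI) * (y * Im j))).
Proof.
intro Hj.
assert (E : I2pi * (j * y) = RtoC (- (2 * PI) * (y * Im j))%R)
  by (destruct Hj as [->| ->]; unfold I2pi; apply C_ext; simpl; ring).
rewrite E; unfold Cexp; simpl; rewrite cos_0, sin_0; apply C_ext; simpl; ring.
Qed.

(** On the lines [Re x = 1/2] and [Re x = -1/2] the number [exp(2 pi i x)] is real and negative. The
    denominator cannot vanish there, and the kernel takes the same values on both lines. *)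
Lemma Rker_half j (e : R) (y : R) : vert j -> (e = / 2 \/ e = - / 2)%R ->
  Ci * Rker j (e + j * y) = kK j y.
Proof.
intros Hj He.
assert (EI : Cexp (I2pi * (e + j * y)) = - RtoC (exp (- (2 * PI) * (y * Im j)))).
{ rewrite Cmult_plus_distr_l, Cexp_plus, vert_Cexp_PI by auto.
  replace (Cexp (I2pi * e)) with (- RtoC 1); [ring|].
  assert (E : I2pi * e = (0, (e * (2 * PI))%R)) by (unfold I2pi; apply C_ext; simpl; ring).
  rewrite E; unfold Cexp; simpl; rewrite exp_0; destruct He as [->| ->].
  - replace (/ 2 * (2 * PI))%R with PI by field; rewrite cos_PI, sin_PI; apply C_ext; simpl; ring.
  - replace (- / 2 * (2 * PI))%R with (- PI)%R by field; rewrite cos_neg, sin_neg, cos_PI, sin_PI;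
      apply C_ext; simpl; ring. }
set (x := e + j * y) in *.
assert (P : forall u : R, (0 < u)%R -> RtoC 1 + RtoC u <> 0).
{ intros u Hu E; rewrite <- RtoC_plus in E; apply RtoC_inj in E; lra. }
pose proof (exp_pos (2 * PI * y)); pose proof (exp_pos (- (2 * PI) * y)).
unfold kK; rewrite RtoC_inv, RtoC_plus by lra.
assert (EE : rker x = / (1 + RtoC (exp (- (2 * PI) * (y * Im j))))).
{ unfold rker; rewrite EI; f_equal; ring. }
destruct (Rker_vert j x Hj) as [[-> ->]|[-> ->]]; rewrite EE.
- change (Im Ci) with 1%R; rewrite Rmult_1_r; ring.
- change (Im (- Ci)) with (- (1))%R.
  replace (- (2 * PI) * (y * - (1)))%R with (2 * PI * y)%R by ring.
  replace (- (2 * PI) * y)%R with (- (2 * PI * y))%R by ring.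
  rewrite exp_Ropp, RtoC_inv by lra.
  pose proof (P _ H); assert (RtoC (exp (2 * PI * y)) <> 0) by (intro E; apply RtoC_inj in E; lra).
  field; repeat split; auto; rewrite Cplus_comm; auto.
Qed.

Lemma Ci_sqr : Ci * Ci = - (1).
Proof. apply C_ext; simpl; ring. Qed.

Lemma Cexp_I2pi : Cexp I2pi = 1.
Proof.
rewrite <- (Cexp_2PI 1); f_equal; unfold I2pi; rewrite RtoC_mult; ring.
Qed.

Lemma Mker_expdec1 j s v c z : vert j -> (Re (j * v) < 0)%R -> Im z = 0%R ->
  (0 < Re (z + c))%R -> (0 < Rabs (Re z) < 1)%R -> exists K k, expdec (Mker j s v c z) K k.
Proof.
intros Hj Hv Hz0 Hz Hz1; destruct (Mker_expdec j s v c Hj Hv z Hz0 Hz Hz1) as [r [K [k [Hr H]]]].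
exists K, k; apply H; rewrite at_pt_refl; auto.
Qed.

Lemma KI_expdec k j s v a : vert j -> (Re (j * v) < 0)%R -> (0 < Re a)%R -> bounded1 k ->
  exists K e, expdec (fun y => kexp j s v a y * k y) K e.
Proof.
intros H1 H2 H3 H4; destruct (KI_partials k j s v a H1 H2 H3 H4) as [[K [e [E0 _]]] _]; eauto.
Qed.

Lemma int_half_line_Mker_half j s v c (e : R) : vert j -> (Re (j * v) < 0)%R -> (/ 2 < Re c)%R ->
  (e = / 2 \/ e = - / 2)%R ->
  Ci * int_half_line (Mker j s v c e) = Cexp (v * e) * KI (kK j) j s v (e + c).
Proof.
intros Hj Hv Hc He.
assert (He1 : (- / 2 <= e)%R) by (destruct He; lra).
assert (Ha : (0 < Re (e + c))%R) by (simpl; unfold Re in *; lra).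
assert (Hz1 : (0 < Rabs (Re e) < 1)%R).
{ simpl; destruct He as [->| ->]; rewrite ?Rabs_Ropp, Rabs_pos_eq; lra. }
destruct (Mker_expdec1 j s v c e Hj Hv eq_refl Ha Hz1) as [K [k HM]].
destruct (KI_expdec (kK j) j s v (e + c) Hj Hv Ha (bounded1_kK j Hj)) as [K' [k' HK]].
unfold KI; rewrite <- (int_half_line_scal _ Ci _ _ HM), <- (int_half_line_scal _ _ _ _ HK); apply int_half_line_ext; intros y Hy.
unfold Mker; rewrite <- (Rker_half j e y Hj He); ring.
Qed.

(** For [v] in the strip below, [Ci * Sline s v c z] is the integral over the full vertical line
    through [z], oriented upwards and cut at [z] into its two halves. *)
Definition Sline (s v c z : C) : C := int_half_line (Mker Ci s v c z) + int_half_line (Mker (- Ci) s (v - I2pi) c z).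

Lemma vert_Ci : vert Ci. Proof. left; auto. Qed.
Lemma vert_nCi : vert (- Ci). Proof. right; auto. Qed.

Lemma Re_Ci_mult (v : C) : Re (Ci * v) = (- Im v)%R.
Proof. simpl; unfold Re, Im; ring. Qed.

Lemma Re_nCi_mult (v : C) : Re (- Ci * v) = Im v.
Proof. simpl; unfold Re, Im; ring. Qed.

Lemma Im_minus_I2pi (v : C) : Im (v - I2pi) = (Im v - 2 * PI)%R.
Proof. unfold I2pi; simpl; unfold Im; ring. Qed.

Section Line.
Variables (s v c : C).
Hypotheses (Hv : (0 < Im v < 2 * PI)%R) (Hc : (/ 2 < Re c)%R).

Let HvC : (Re (Ci * v) < 0)%R.
Proof. rewrite Re_Ci_mult; lra. Qed.
Let HvC' : (Re (- Ci * (v - I2pi)) < 0)%R.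
Proof. rewrite Re_nCi_mult, Im_minus_I2pi; lra. Qed.

Lemma Sline_half (e : R) : (e = / 2 \/ e = - / 2)%R ->
  Ci * Sline s v c e = Cexp (v * (e + / 2)) * (kap Ci s v (e + c + / 2) + kap (- Ci) s (v - I2pi) (e + c + / 2)).
Proof.
intro He; unfold Sline, kap.
replace (e + c + / 2 - / 2) with (e + c) by ring.
rewrite Cmult_plus_distr_l, !int_half_line_Mker_half by (auto using vert_Ci, vert_nCi).
rewrite Cmult_plus_distr_l, !Cmult_assoc; f_equal; rewrite <- Cexp_plus.
- f_equal; f_equal; field; apply C2_neq_0.
- assert (E : Cexp (v * (e + / 2) + - ((v - I2pi) / 2)) = Cexp ((v - I2pi) * e)); [|rewrite E; auto].
  pose proof C2_neq_0.
  (* For [e = 1/2] the two exponents differ by [I2pi], which [Cexp] does not see; for [e = -1/2]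
     they agree. *)
  destruct He as [->| ->]; rewrite ?RtoC_opp, RtoC_inv by lra.
  + replace (v * (/ 2 + / 2) + - ((v - I2pi) / 2)) with ((v - I2pi) * / 2 + I2pi) by (field; auto).
    rewrite Cexp_plus, Cexp_I2pi; ring.
  + f_equal; field; auto.
Qed.

Lemma Mker_0_Ci z : (0 < Rabs (Re z) < 1)%R -> Mker Ci s v c z 0 = Mker (- Ci) s (v - I2pi) c z 0.
Proof.
intro Hz; pose proof (rker_neq z Hz) as Hq; pose proof C2_neq_0.
unfold Mker, Rker; rewrite !kexp_0, !Cmult_0_r, !Cplus_0_r.
replace (Ci * - Ci) with (- (Ci * Ci)) by ring; rewrite Ci_sqr.
replace ((v - I2pi) * z) with (v * z - I2pi * z) by ring.
rewrite Cexp_minus; unfold rker; field; repeat split; auto using Cexp_neq_0.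
Qed.

(** The derivatives of the two halves are [Ci] and [- Ci] times the common value at [y = 0], and
    cancel. The condition [0 < a * b] keeps the segment on one side of the pole at [0]. *)
Lemma Sline_const (a b : R) : (- / 2 <= a <= / 2)%R -> (- / 2 <= b <= / 2)%R -> (0 < a * b)%R ->
  Sline s v c b = Sline s v c a.
Proof.
intros Ha Hb Hab; apply cder_zero_segment; intros t Ht.
set (z := a + t * (b - a)).
assert (Ez : z = RtoC (a + t * (b - a))%R) by (unfold z; rewrite RtoC_plus, RtoC_mult, RtoC_minus; auto).
assert (Hz0 : Im z = 0%R) by (rewrite Ez; auto).
assert (Hr : ((0 < a <= / 2 /\ 0 < b <= / 2) \/ (- / 2 <= a < 0 /\ - / 2 <= b < 0))%R).
{ destruct (Rlt_or_le 0 a); [left|right]; nra. }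
assert (Hz1 : (- / 2 <= Re z <= / 2 /\ 0 < Rabs (Re z) < 1)%R).
{ rewrite Ez; simpl; set (m := (a + t * (b - a))%R).
  assert (B : (Rmin a b <= m <= Rmax a b)%R).
  { unfold m, Rmin, Rmax; destruct (Rle_dec a b); split; nra. }
  destruct Hr as [Hr|Hr]; revert B; unfold Rmin, Rmax; destruct (Rle_dec a b); intro B;
  (split; [lra|]); [rewrite Rabs_pos_eq|rewrite Rabs_pos_eq|rewrite Rabs_left|rewrite Rabs_left]; lra. }
assert (Hz : (0 < Re (z + c))%R).
{ change (Re (z + c)) with (Re z + Re c)%R; lra. }
unfold Sline; eapply der_eq.
- apply der_plus; apply int_half_line_Mker_cder; auto using vert_Ci, vert_nCi; apply Hz1.
- rewrite Mker_0_Ci by apply Hz1; ring.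
Qed.

End Line.

(** The case in closed form that replaces the computation of a residue: the integrand is
    [exp(-pi y) / (1 + exp(-2 pi y))] up to the factor [j], with primitive
    [- atan(exp(-pi y)) / pi]. *)
Lemma kap_PI j c : vert j -> (/ 2 < Re c)%R -> kap j 0 (PI * j) c = / 4.
Proof.
intros Hj Hc; pose proof PI_RGT_0.
assert (N4 : RtoC 4 <> 0) by (intro E; apply RtoC_inj in E; lra).
assert (Hv : (Re (j * (PI * j)) < 0)%R).
{ replace (j * (PI * j)) with (PI * (j * j)) by ring; rewrite vert_sqr by auto; simpl; lra. }
assert (Ha : (0 < Re (c - / 2))%R).
{ rewrite <- RtoC_inv by lra; simpl; unfold Re in *; lra. }
destruct (KI_expdec (kK j) j 0 (PI * j) (c - / 2) Hj Hv Ha (bounded1_kK j Hj)) as [K [k HK]].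
assert (Ek : forall y, kexp j 0 (PI * j) (c - / 2) y * kK j y
  = j * (exp (- PI * y) / (1 + exp (- (2 * PI) * y)))%R).
{ intro y; unfold kexp, kK.
  replace (j * (PI * j) * y - 0 * Clog (c - / 2 + j * y)) with (PI * (j * j) * y) by ring.
  rewrite vert_sqr by auto.
  assert (E : PI * - (1) * y = RtoC (- PI * y)%R) by (apply C_ext; simpl; ring).
  rewrite E; unfold Cexp; simpl; rewrite cos_0, sin_0.
  unfold Rdiv; rewrite RtoC_mult.
  replace ((exp (- PI * y) * 1)%R, (exp (- PI * y) * 0)%R) with (RtoC (exp (- PI * y)))
    by (apply C_ext; simpl; ring).
  ring. }
assert (B : forall y, (0 <= y)%R -> (0 <= exp (- PI * y) / (1 + exp (- (2 * PI) * y)) <= exp (- PI * y))%R).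
{ intros y Hy; pose proof (exp_pos (- PI * y)); pose proof (exp_pos (- (2 * PI) * y)); split.
  - apply Rdiv_le_0_compat; lra.
  - apply Rmult_le_reg_r with (1 + exp (- (2 * PI) * y))%R; [lra|].
    unfold Rdiv; rewrite Rmult_assoc, Rinv_l by lra; nra. }
assert (HE : expdec (fun y => j * (exp (- PI * y) / (1 + exp (- (2 * PI) * y)))%R) 1 PI).
{ split; [auto|split].
  - intros t Ht; apply tends_mult; [apply tends_const|].
    apply (conR_RtoC (fun y => exp (- PI * y) / (1 + exp (- (2 * PI) * y)))%R); auto_derive.
    pose proof (exp_pos (- (2 * PI) * t)); lra.
  - intros t Ht; rewrite Cmod_mult, vert_mod, Cmod_R, Rabs_pos_eq by (auto; apply B; auto).
    pose proof (B t Ht); lra. }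
unfold kap, KI.
rewrite (int_half_line_ext _ _ (fun y _ => Ek y)).
rewrite (int_half_line_derive (fun y => j * (- / PI * atan (exp (- PI * y)))%R) _ _ (/ PI) _ HE).
- rewrite Rmult_0_r, exp_0, atan_1.
  replace (- / PI * (PI / 4))%R with (- / 4)%R by (field; lra).
  replace (- (PI * j / 2)) with (- Lj j).
  + rewrite Cexp_opp, Cexp_Lj by auto.
    assert (j <> 0) by (apply Cmod_gt_0; rewrite vert_mod; auto; lra).
    rewrite RtoC_opp, RtoC_inv by lra; field; auto.
  + unfold Lj; unfold Rdiv; rewrite RtoC_mult, RtoC_inv by lra; field; apply C2_neq_0.
- intros t Ht; eapply der_eq.
  + apply der_mult; [apply der_const|].
    apply (rder_RtoC (fun y => - / PI * atan (exp (- PI * y)))%R); auto_derive; [auto|reflexivity].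
  + cbv beta.
    replace (- (2 * PI) * t)%R with (- PI * t + - PI * t)%R by ring; rewrite exp_plus.
    replace (0 * (- / PI * atan (exp (- PI * t)))%R) with (RtoC 0) by ring; rewrite Cplus_0_l.
    f_equal; f_equal; pose proof (exp_pos (- PI * t)); field; split; nra.
- intros t Ht; pose proof (exp_pos (- PI * t)).
  rewrite Cmod_mult, vert_mod, Cmod_R, Rmult_1_l, Rabs_mult, Rabs_Ropp by auto.
  destruct (atan_le_id (exp (- PI * t))) as [A1 A2]; [lra|].
  assert (0 < / PI)%R by (apply Rinv_0_lt_compat; auto).
  rewrite !Rabs_pos_eq by lra; apply Rmult_le_compat_l; lra.
Qed.

(** * The jump of the line integral across the pole at 0 *)

Lemma tends_at_value {T} (d : T -> R) (f : T -> C) (l : C) (p : T) :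
  d p = 0%R -> tends d f l -> f p = l.
Proof.
intros Hd H; apply NNPP; intro Hn; apply Cmod_pos_sub in Hn.
destruct (H _ Hn) as [r [Hr H1]]; specialize (H1 p ltac:(lra)); lra.
Qed.

Definition line_j (j v : C) : C := v - (1 + Ci * j) / 2 * I2pi.

Definition Epow (s v c x : C) : C := Cexp (v * x - s * Clog (x + c)).

Lemma line_Ci v : line_j Ci v = v.
Proof. unfold line_j; rewrite Ci_sqr; field; apply C2_neq_0. Qed.

Lemma line_nCi v : line_j (- Ci) v = v - I2pi.
Proof.
unfold line_j; replace (Ci * - Ci) with (- (Ci * Ci)) by ring; rewrite Ci_sqr; field; apply C2_neq_0.
Qed.

Lemma Mker_Epow (j s v c z : C) (y : R) : vert j -> 1 - Cexp (I2pi * (z + j * y)) <> 0 ->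
  Mker j s (line_j j v) c z y = Epow s v c (z + j * y) * rker (z + j * y).
Proof.
intros Hj Hq; set (x := z + j * y) in *.
unfold Mker; fold x.
assert (E : Cexp (line_j j v * z) * kexp j s (line_j j v) (z + c) y
  = Cexp (line_j j v * x - s * Clog (x + c))).
{ unfold kexp; rewrite <- Cexp_plus; unfold x; f_equal.
  replace (z + c + j * y) with (z + j * y + c) by ring; ring. }
rewrite E; unfold Epow.
destruct (Rker_vert j x Hj) as [[-> ->]|[-> ->]].
- rewrite line_Ci; auto.
- rewrite line_nCi.
  replace ((v - I2pi) * x - s * Clog (x + c)) with (v * x - s * Clog (x + c) - I2pi * x) by ring.
  rewrite Cexp_minus; unfold rker; field; split; auto using Cexp_neq_0.
Qed.

Lemma Re_line j v : vert j -> (0 < Im v < 2 * PI)%R -> (Re (j * line_j j v) < 0)%R.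
Proof.
intros [->| ->] Hv.
- rewrite line_Ci, Re_Ci_mult; lra.
- rewrite line_nCi, Re_nCi_mult, Im_minus_I2pi; lra.
Qed.

Lemma I2pi_neq_0 : I2pi <> 0.
Proof. intro E; apply (f_equal Im) in E; unfold I2pi in E; simpl in E; pose proof PI_RGT_0; lra. Qed.

Lemma Cexp_I2pi_neq (x : C) : x <> 0 -> (Rabs (Re x) < 1)%R -> 1 - Cexp (I2pi * x) <> 0.
Proof.
intros Hx Hx1 E.
assert (E1 : Cexp (I2pi * x) = 1).
{ replace (Cexp (I2pi * x)) with (1 - (1 - Cexp (I2pi * x))) by ring; rewrite E; ring. }
destruct (Cexp_eq_1 _ E1) as [k Hk].
assert (E2 : x = RtoC (IZR k)).
{ assert (I2pi * x = I2pi * IZR k) as Hk'.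
  { rewrite Hk; unfold I2pi; rewrite RtoC_mult; ring. }
  replace x with (/ I2pi * (I2pi * x)) by (field; apply I2pi_neq_0).
  rewrite Hk'; field; apply I2pi_neq_0. }
rewrite E2 in Hx1; simpl in Hx1; rewrite <- abs_IZR in Hx1.
assert (Z.abs k < 1)%Z by (apply lt_IZR; lra).
assert (k = 0)%Z by lia; subst k; apply Hx; rewrite E2; auto.
Qed.

Section Jump.
Variables (s v c : C).
Hypotheses (Hv : (0 < Im v < 2 * PI)%R) (Hc : (/ 2 < Re c)%R).

Let c0 : C := Cexp (- s * Clog c).
Let v1 : C := PI * Ci.
(** The comparison function [Epow 0 v1 c x = exp(pi i x)] equals 1 at [x = 0], so that [Fn] vanishes
    there and cancels the simple pole of [rker]. *)
Let Fn (x : C) : C := Epow s v c x - c0 * Epow 0 v1 c x.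

Let Hv1 : (0 < Im v1 < 2 * PI)%R.
Proof. unfold v1; simpl; pose proof PI_RGT_0; lra. Qed.

Lemma cder_Epow s' v' x : (0 < Re (x + c))%R ->
  cder (Epow s' v' c) x ((v' - s' / (x + c)) * Epow s' v' c x).
Proof.
intro Hx; pose proof (Re_pos_neq_0 _ Hx); unfold Epow; eapply der_eq.
- apply der_Cexp, der_minus; [apply der_mult; [apply der_const|apply der_id]|].
  apply der_mult; [apply der_const|]; apply der_Clog; [exact Hx|].
  apply der_plus; [apply der_id|apply der_const].
- cbv beta; field; auto.
Qed.

Lemma Fn_0 : Fn 0 = 0.
Proof.
unfold Fn, Epow, c0; rewrite !Cmult_0_r, !Cplus_0_l.
replace (0 - 0 * Clog c) with (RtoC 0) by ring; rewrite Cexp_0.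
replace (0 - s * Clog c) with (- s * Clog c) by ring; ring.
Qed.

(** [Fn * rker] extended by continuity at its removable singularity, as the
    quotient of the slope functions of [Fn] and of [1 - Cexp (I2pi * x)]. *)
Lemma removable : exists h : C -> C,
  (forall x : C, x <> 0 -> (Rabs (Re x) < 1)%R -> h x = Fn x * rker x) /\
  (forall x, (Rabs (Re x) < 1)%R -> (0 < Re (x + c))%R -> tends (at_pt x) h (h x)).
Proof.
assert (DF : forall x, (0 < Re (x + c))%R -> exists l, cder Fn x l).
{ intros x Hx; eexists; unfold Fn; apply der_minus; [apply cder_Epow; auto|].
  apply der_mult; [apply der_const|apply cder_Epow; auto]. }
assert (H0 : (0 < Re (0 + c))%R) by (simpl; unfold Re in *; lra).
destruct (DF 0 H0) as [l [phi [P1 P2]]].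
assert (DG : cder (fun x => 1 - Cexp (I2pi * x)) 0 (- I2pi)).
{ eapply der_eq; [apply der_minus; [apply der_const|];
    apply der_Cexp, der_mult; [apply der_const|apply der_id]|].
  cbv beta; rewrite Cmult_0_r, Cexp_0; ring. }
destruct DG as [psi [Q1 Q2]].
assert (Q3 : forall x, 1 - Cexp (I2pi * x) = x * psi x).
{ intro x; rewrite Q1, Cmult_0_r, Cexp_0; ring. }
assert (P3 : forall x, Fn x = x * phi x).
{ intro x; rewrite P1, Fn_0; ring. }
exists (fun x => phi x / psi x).
assert (E : forall x : C, x <> 0 -> (Rabs (Re x) < 1)%R -> phi x / psi x = Fn x * rker x).
{ intros x Hx Hx1; pose proof (Cexp_I2pi_neq x Hx Hx1) as Hq.
  unfold rker; rewrite Q3 in *; rewrite P3.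
  assert (psi x <> 0) by (intro E; rewrite E in Hq; apply Hq; ring).
  field; auto. }
split; [exact E|].
assert (N0 : - I2pi <> 0).
{ intro E0; apply I2pi_neq_0; replace I2pi with (- - I2pi) by ring; rewrite E0; ring. }
intros x Hx1 Hx2; destruct (classic (x = 0)) as [->|Hx].
- assert (T1 : tends (at_pt 0) phi l) by exact P2.
  assert (T2 : tends (at_pt 0) psi (- I2pi)) by exact Q2.
  rewrite (tends_at_value _ _ _ (RtoC 0) (at_pt_refl 0) T1), (tends_at_value _ _ _ (RtoC 0) (at_pt_refl 0) T2).
  apply tends_mult; auto; apply tends_inv; auto.
- assert (Hx' : (0 < Cmod x)%R) by (apply Cmod_gt_0; auto).
  assert (Hq := Cexp_I2pi_neq x Hx Hx1).
  apply tends_ext_loc with (f := fun x => Fn x * rker x) (r := Rmin (Cmod x) (1 - Rabs (Re x))).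
  + apply Rmin_pos; lra.
  + unfold at_pt; intros w Hw; symmetry; apply E.
    * eapply Cmod_sub_lt_neq; eapply Rlt_le_trans; [apply Hw|apply Rmin_l].
    * assert (Cmod (w - x) < 1 - Rabs (Re x))%R by (eapply Rlt_le_trans; [apply Hw|apply Rmin_r]).
      pose proof (re_le_Cmod (w - x)) as D3; change (Re (w - x)) with (Re w - Re x)%R in D3.
      pose proof (Rabs_triang_inv (Re w) (Re x)); lra.
  + rewrite E by auto; apply tends_mult.
    * destruct (DF x Hx2) as [l' D]; apply (der_tends _ _ _ _ D).
    * apply (der_tends _ _ _ _ (cder_rker x Hq)).
Qed.

(** The integrand [Fn * rker] has no pole at 0, so its line integral is continuous at abscissa 0. By
    [Sline_const] it is also constant on either side, hence takes equal values at [1/2] and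
    [-1/2]. *)
Lemma line_difference :
  Sline s v c (/ 2)%R - c0 * Sline 0 v1 c (/ 2)%R
  = Sline s v c (- / 2)%R - c0 * Sline 0 v1 c (- / 2)%R.
Proof.
destruct removable as [h [E HC]].
assert (Hc0 : (0 < Re (0 + c))%R) by (simpl; unfold Re in *; lra).
assert (EM : forall (j z : C) (y : R), vert j -> z + j * y <> 0 -> (Rabs (Re z) < 1)%R ->
  h (z + j * y) = Mker j s (line_j j v) c z y - c0 * Mker j 0 (line_j j v1) c z y).
{ intros j z y Hj Hx Hz.
  assert (Hz' : (Rabs (Re (z + j * y)) < 1)%R) by (rewrite vert_Re; auto).
  pose proof (Cexp_I2pi_neq _ Hx Hz').
  rewrite E, !Mker_Epow by auto; unfold Fn; ring. }
assert (EI : forall j (e : R), vert j -> (0 < Rabs e <= / 2)%R ->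
  int_half_line (fun y => h (e + j * y)) = int_half_line (Mker j s (line_j j v) c e) - c0 * int_half_line (Mker j 0 (line_j j v1) c e)).
{ intros j e Hj He.
  assert (He1 : (0 < Rabs (Re e) < 1)%R) by (simpl; lra).
  assert (He2 : (0 < Re (e + c))%R).
  { simpl; unfold Re in *; pose proof (Rle_abs (- e)) as A; rewrite Rabs_Ropp in A; lra. }
  destruct (Mker_expdec1 j s (line_j j v) c e Hj (Re_line j v Hj Hv) eq_refl He2 He1) as [K [k H1]].
  destruct (Mker_expdec1 j 0 (line_j j v1) c e Hj (Re_line j v1 Hj Hv1) eq_refl He2 He1) as [K' [k' H2]].
  (* The two integrands come with different rates of decay; the smaller one serves both. *)
  assert (Hmin : forall F A a b, (0 < b)%R -> expdec F A a -> expdec F A (Rmin a b)).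
  { intros F A a b Hb [G1 [G2 G3]]; split; [apply Rmin_pos; auto|split; auto].
    intros t Ht; eapply Rle_trans; [apply G3; auto|].
    assert (0 <= A)%R.
    { specialize (G3 0%R (Rle_refl 0)); rewrite Rmult_0_r, exp_0 in G3.
      pose proof (Cmod_ge_0 (F 0%R)); lra. }
    apply Rmult_le_compat_l; auto; apply exp_mono.
    assert (Rmin a b * t <= a * t)%R by (apply Rmult_le_compat_r; auto; apply Rmin_l); lra. }
  assert (H1' := Hmin _ _ _ k' (proj1 H2) H1).
  assert (H2' := Hmin _ _ _ k (proj1 H1) H2); rewrite Rmin_comm in H2'.
  rewrite <- (int_half_line_scal _ c0 _ _ H2'), <- (int_half_line_minus _ _ _ _ _ H1' (expdec_scal _ c0 _ _ H2')).
  apply int_half_line_ext; intros y Hy; apply EM; auto; [|apply He1].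
  intro A; apply (f_equal Re) in A; rewrite vert_Re in A by auto; simpl in A; subst e.
  rewrite Rabs_R0 in He; lra. }
(* As [z] tends to 0 each [Mker] is unbounded near [y = 0]. For small [y] the estimate is therefore
   made on the continuous function [h], and the bounds of [Mker] are used for [y >= 1] only. *)
assert (TI : forall j, vert j ->
  tends (at_pt 0) (fun z => int_half_line (fun y => h (z + j * y))) (int_half_line (fun y => h (0 + j * y)))).
{ intros j Hj.
  destruct (Mker_bounds j s (line_j j v) c Hj (Re_line j v Hj Hv) 0 eq_refl Hc0)
    as [r1 [K1 [k1 [Hr1 [Hk1 B1]]]]].
  destruct (Mker_bounds j 0 (line_j j v1) c Hj (Re_line j v1 Hj Hv1) 0 eq_refl Hc0)
    as [r2 [K2 [k2 [Hr2 [Hk2 B2]]]]].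
  set (r := Rmin 1 (Rmin r1 r2)).
  assert (Hr : (0 < r)%R) by (repeat apply Rmin_pos; auto; lra).
  assert (R1 : forall z, (at_pt 0 z < r)%R -> (Rabs (Re z) < 1)%R /\ (at_pt 0 z < r1)%R /\ (at_pt 0 z < r2)%R).
  { intros z Hz; split; [|split].
    - eapply Rle_lt_trans; [apply re_le_Cmod|].
      replace z with (z - 0) by ring; eapply Rlt_le_trans; [apply Hz|apply Rmin_l].
    - eapply Rlt_le_trans; [apply Hz|]; eapply Rle_trans; [apply Rmin_r|apply Rmin_l].
    - eapply Rlt_le_trans; [apply Hz|]; eapply Rle_trans; [apply Rmin_r|apply Rmin_r]. }
  assert (HJ : forall z (y : R), (at_pt 0 z < r)%R ->
    joint (at_pt z) (fun z y => h (z + j * y)) z y /\ conR (fun y => h (z + j * y)) y).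
  { intros z y Hz; destruct (R1 z Hz) as [A1 [A2 A3]]; destruct (B1 z A2) as [A4 _].
    assert (J : joint3 (fun (_ z _ : C) y => h (z + j * y)) 0 z 0 y).
    { unfold joint3, joint; apply (tends_comp _ h) with (l := z + j * y).
      - cbn [fst snd]; apply HC; [rewrite vert_Re; auto|].
        replace (z + j * y + c) with (z + c + j * y) by ring; rewrite vert_Re; auto.
      - joint_tac. }
    apply joint3_slice in J; tauto. }
  assert (H00 : (at_pt 0 0 < r)%R) by (rewrite at_pt_refl; auto).
  destruct (expdec_near (at_pt 0) (RtoC 0) (fun z y => h (z + j * y)) (Rabs K1 + Cmod c0 * Rabs K2)
    (Rmin k1 k2) r) as [r' [K' [Hr' H]]].
  - apply at_pt_refl.
  - auto.
  - apply Rmin_pos; auto.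
  - intros y Hy; apply HJ; auto.
  - intros z y Hz Hy; apply HJ; auto.
  - intros z y Hz Hy; destruct (R1 z Hz) as [A1 [A2 A3]].
    destruct (proj2 (B1 z A2) y Hy) as [C1 _]; destruct (proj2 (B2 z A3) y Hy) as [C2 _].
    assert (Hn : 1 - Cexp (I2pi * (z + j * y)) <> 0 \/ z + j * y = 0).
    { destruct (classic (z + j * y = 0)); auto; left; apply Cexp_I2pi_neq; auto.
      rewrite vert_Re; auto. }
    assert (X : forall K k, (Rmin k1 k2 <= k)%R ->
      (K * exp (- k * y) <= Rabs K * exp (- Rmin k1 k2 * y))%R).
    { intros K k Hk; apply Rle_trans with (Rabs K * exp (- k * y))%R.
      - apply Rmult_le_compat_r; [left; apply exp_pos|apply Rle_abs].
      - apply Rmult_le_compat_l; [apply Rabs_pos|]; apply exp_mono.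
        assert (Rmin k1 k2 * y <= k * y)%R by (apply Rmult_le_compat_r; lra); lra. }
    rewrite EM; auto.
    + eapply Rle_trans; [apply Cmod_triangle|]; rewrite Cmod_opp, Cmod_mult, Rmult_plus_distr_r.
      apply Rplus_le_compat.
      * eapply Rle_trans; [apply C1|apply X, Rmin_l].
      * rewrite Rmult_assoc; apply Rmult_le_compat_l; [apply Cmod_ge_0|].
        eapply Rle_trans; [apply C2|apply X, Rmin_r].
    + intro A.
      assert (Hzy : z = - (j * y)) by (replace z with (z + j * y - j * y) by ring; rewrite A; ring).
      assert (D : (at_pt 0 z < 1)%R) by (eapply Rlt_le_trans; [apply Hz|apply Rmin_l]).
      unfold at_pt in D; replace (z - 0) with z in D by ring.
      rewrite Hzy, Cmod_opp, Cmod_mult, vert_mod, Cmod_R, Rabs_pos_eq in D by (auto; lra); lra.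
  - apply (int_half_line_tends (at_pt 0) (RtoC 0) (at_pt_refl 0) (fun z y => h (z + j * y)) K' (Rmin k1 k2) r'); auto.
    intros y Hy; apply HJ; auto. }
set (Sh := fun z => int_half_line (fun y => h (z + Ci * y)) + int_half_line (fun y => h (z + - Ci * y))).
assert (TS : tends (at_pt 0) Sh (Sh 0)) by (apply tends_plus; apply TI; [apply vert_Ci|apply vert_nCi]).
assert (ES : forall e : R, (0 < Rabs e <= / 2)%R -> Sh e = Sline s v c e - c0 * Sline 0 v1 c e).
{ intros e He; unfold Sh; rewrite !EI by (auto using vert_Ci, vert_nCi).
  rewrite !line_Ci, !line_nCi; unfold Sline; ring. }
assert (EE : forall e e' : R, (e' = / 2 \/ e' = - / 2)%R -> (0 < Rabs e <= / 2)%R -> (0 < e * e')%R ->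
  Sh e = Sline s v c e' - c0 * Sline 0 v1 c e').
{ intros e e' He' He Hs; rewrite ES by auto.
  assert (- / 2 <= e <= / 2)%R.
  { pose proof (Rle_abs e); pose proof (Rle_abs (- e)) as A; rewrite Rabs_Ropp in A; lra. }
  assert (- / 2 <= e' <= / 2)%R by (destruct He'; lra).
  rewrite (Sline_const s v c Hv Hc e e'), (Sline_const 0 v1 c Hv1 Hc e e'); auto. }
assert (L : forall e', (e' = / 2 \/ e' = - / 2)%R -> Sh 0 = Sline s v c e' - c0 * Sline 0 v1 c e').
{ intros e' He'; apply NNPP; intro Hn; apply Cmod_pos_sub in Hn.
  destruct (TS _ Hn) as [r [Hr H1]].
  (* As [2 * e'] is the sign of [e'], this abscissa is close to 0 and on the same side as [e']. *)
  set (e := (2 * e' * Rmin (/ 2) (r / 2))%R).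
  assert (Hm : (0 < Rmin (/ 2) (r / 2))%R) by (apply Rmin_pos; lra).
  pose proof (Rmin_l (/ 2) (r / 2)); pose proof (Rmin_r (/ 2) (r / 2)).
  assert (He : (Rabs e = Rmin (/ 2) (r / 2))%R).
  { unfold e; destruct He' as [->| ->].
    - rewrite Rabs_pos_eq; lra.
    - rewrite Rabs_left; lra. }
  specialize (H1 e); rewrite Cmod_sub_sym in H1.
  assert (Hs : (0 < e * e')%R) by (unfold e; destruct He' as [->| ->]; nra).
  rewrite (EE e e' He' ltac:(lra) Hs) in H1.
  unfold at_pt in H1; replace (e - 0) with (RtoC e) in H1 by ring; rewrite Cmod_R in H1.
  specialize (H1 ltac:(lra)); lra. }
rewrite <- (L (/ 2)%R), <- (L (- / 2)%R); auto.
Qed.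

(** The jump is [c^(-s)] times that of the comparison integral. By [kap_PI] the latter is
    [1/4 + 1/4] at [-1/2] and its opposite at [1/2], because [exp(pi i) = -1]; the difference is
    1. *)
Lemma line_lemma :
  kap Ci s v c + kap (- Ci) s (v - I2pi) c
  - Cexp v * (kap Ci s v (c + 1) + kap (- Ci) s (v - I2pi) (c + 1)) = Cexp (- s * Clog c).
Proof.
pose proof line_difference as H.
assert (Hc1 : (/ 2 < Re (c + 1))%R) by (simpl; unfold Re in *; lra).
pose proof C2_neq_0 as N2.
assert (A : forall s' v', (0 < Im v' < 2 * PI)%R ->
  Ci * Sline s' v' c (- / 2)%R = kap Ci s' v' c + kap (- Ci) s' (v' - I2pi) c /\
  Ci * Sline s' v' c (/ 2)%R = Cexp v' * (kap Ci s' v' (c + 1) + kap (- Ci) s' (v' - I2pi) (c + 1))).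
{ intros s' v' Hv'; rewrite !Sline_half by auto; rewrite RtoC_opp, RtoC_inv by lra; split.
  - replace (v' * (- / 2 + / 2)) with (RtoC 0) by ring; rewrite Cexp_0, Cmult_1_l.
    replace (- / 2 + c + / 2) with c by ring; auto.
  - replace (v' * (/ 2 + / 2)) with v' by (field; auto).
    replace (/ 2 + c + / 2) with (c + 1) by (field; auto); auto. }
destruct (A s v Hv) as [A1 A2]; destruct (A 0 v1 Hv1) as [A3 A4].
rewrite <- A1, <- A2.
assert (V : v1 - I2pi = PI * - Ci) by (unfold v1, I2pi; rewrite RtoC_mult; ring).
rewrite V in A3, A4; unfold v1 in A3 at 2; unfold v1 in A4 at 3.
rewrite !kap_PI in A3, A4 by (auto using vert_Ci, vert_nCi).
assert (EV : Cexp v1 = - (1)).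
{ unfold v1, Cexp; simpl.
  replace (PI * 0 - 0 * 1)%R with 0%R by ring; replace (PI * 1 + 0 * 0)%R with PI by ring.
  rewrite exp_0, cos_PI, sin_PI; apply C_ext; simpl; ring. }
rewrite EV in A4.
assert (N4 : RtoC 4 <> 0) by (intro E; apply RtoC_inj in E; lra).
replace (Ci * Sline s v c (- / 2)%R - Ci * Sline s v c (/ 2)%R)
  with (Ci * (Sline s v c (- / 2)%R - Sline s v c (/ 2)%R)) by ring.
replace (Sline s v c (- / 2)%R - Sline s v c (/ 2)%R)
  with (c0 * (Sline 0 v1 c (- / 2)%R - Sline 0 v1 c (/ 2)%R)).
- replace (Ci * (c0 * (Sline 0 v1 c (- / 2)%R - Sline 0 v1 c (/ 2)%R)))
    with (c0 * (Ci * Sline 0 v1 c (- / 2)%R - Ci * Sline 0 v1 c (/ 2)%R)) by ring.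
  rewrite A3, A4; fold c0; field; auto.
- replace (Sline s v c (/ 2)%R) with
    (Sline s v c (/ 2)%R - c0 * Sline 0 v1 c (/ 2)%R + c0 * Sline 0 v1 c (/ 2)%R) by ring.
  rewrite H; ring.
Qed.

End Jump.

(** * Shedding incomplete Gamma functions to widen the strip *)

Lemma expdec_rate F K k l : (0 < l)%R -> expdec F K k -> expdec F K (Rmin k l).
Proof.
intros Hl [Hk [Hc Hb]]; split; [apply Rmin_pos; auto|split; auto].
intros t Ht; eapply Rle_trans; [apply Hb; auto|].
assert (0 <= K)%R.
{ specialize (Hb 0%R (Rle_refl 0)); rewrite Rmult_0_r, exp_0 in Hb.
  pose proof (Cmod_ge_0 (F 0%R)); lra. }
apply Rmult_le_compat_l; auto; apply exp_mono.
assert (Rmin k l * t <= k * t)%R by (apply Rmult_le_compat_r; auto; apply Rmin_l); lra.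
Qed.

Lemma int_half_line_plus_rates F G K k L l : expdec F K k -> expdec G L l ->
  int_half_line (fun t => F t + G t) = int_half_line F + int_half_line G.
Proof.
intros HF HG; apply int_half_line_plus with K L (Rmin k l).
- apply expdec_rate; auto; apply HG.
- rewrite Rmin_comm; apply expdec_rate; auto; apply HF.
Qed.

Fixpoint csum (f : nat -> C) (n : nat) : C :=
  match n with O => 0 | S n => csum f n + f n end.

Lemma csum_ext f g n : (forall k, (k < n)%nat -> f k = g k) -> csum f n = csum g n.
Proof. induction n; intro H; simpl; [auto|]; rewrite IHn, H; auto. Qed.

Lemma csum_S_left f n : csum f (S n) = f O + csum (fun k => f (S k)) n.
Proof.
induction n; [simpl; ring|].
change (csum f (S (S n))) with (csum f (S n) + f (S n)); rewrite IHn; simpl; ring.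
Qed.

Lemma csum_plus f g n : csum (fun k => f k + g k) n = csum f n + csum g n.
Proof. induction n; simpl; [ring|]; rewrite IHn; ring. Qed.

Lemma csum_scal a f n : csum (fun k => a * f k) n = a * csum f n.
Proof. induction n; simpl; [ring|]; rewrite IHn; ring. Qed.

Lemma csum_holo_at (G : nat -> C -> C -> C -> C) n s z c :
  (forall k, (k < n)%nat -> holo_at (G k) s z c) -> holo_at (fun s z c => csum (fun k => G k s z c) n) s z c.
Proof.
induction n; intro H; simpl; [apply holo_at_const|].
apply holo_at_plus; [apply IHn|apply (H n)]; auto.
Qed.

Lemma INR_C_S n : RtoC (INR (S n)) = RtoC (INR n) + 1.
Proof. rewrite S_INR, RtoC_plus; auto. Qed.

(** What remains of a shed integral once its [hj] term is removed. Being entire in [v], it can stay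
    inside [W] wherever [w] moves. *)
Definition pv (s v c : C) : C := Cexp (- (c * v)) * Pint s v (c - / 2).

Lemma Re_minus_half (c : C) : (/ 2 < Re c)%R -> (0 < Re (c - / 2))%R.
Proof. intro H; rewrite <- RtoC_inv by lra; simpl; unfold Re in *; lra. Qed.

Lemma Cexp_I2pi_Z (k : Z) : Cexp (I2pi * IZR k) = 1.
Proof. rewrite <- (Cexp_2PI k); f_equal; unfold I2pi; rewrite RtoC_mult; ring. Qed.

(** With [q = exp(-2 pi y)], the identity [1/(1+q) + q/(1+q) = 1] adds the integrals [KI] for [v]
    and [v + 2 pi j] up to [Tj], which [Tj_continuation] splits. The prefactor of [kap] changes sign
    between the two, since [exp(-pi j) = -1]. *)
Lemma kap_step j s v c : vert j -> (Re (j * v) < 0)%R -> (/ 2 < Re c)%R ->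
  kap j s v c = Cexp (- (c * v)) * hj j s (Lj j + Clog (- (j * v))) + pv s v c
    + kap j s (v + (2 * PI)%R * j) c.
Proof.
intros Hj Hv Hc; pose proof (Re_minus_half c Hc) as Ha; set (a := c - / 2) in *.
pose proof PI_RGT_0; pose proof C2_neq_0 as N2.
assert (Ej : forall x, j * (x * j) = - x).
{ intro x; replace (j * (x * j)) with (x * (j * j)) by ring; rewrite vert_sqr by auto; ring. }
assert (Hv' : (Re (j * (v + (2 * PI)%R * j)) < 0)%R).
{ rewrite Cmult_plus_distr_l, Ej; change (Re (j * v) + - (2 * PI) < 0)%R; lra. }
destruct (KI_expdec (kK j) j s v a Hj Hv Ha (bounded1_kK j Hj)) as [K [k H1]].
destruct (KI_expdec (kK j) j s (v + (2 * PI)%R * j) a Hj Hv' Ha (bounded1_kK j Hj)) as [K' [k' H2]].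
assert (E : Tj j s v a = KI (kK j) j s v a + KI (kK j) j s (v + (2 * PI)%R * j) a).
{ unfold Tj, KI; rewrite <- (int_half_line_plus_rates _ _ _ _ _ _ H1 H2); apply int_half_line_ext; intros y Hy.
  assert (E : kexp j s (v + (2 * PI)%R * j) a y = RtoC (exp (- (2 * PI) * y)) * kexp j s v a y).
  { unfold kexp.
    replace (j * (v + (2 * PI)%R * j) * y - s * Clog (a + j * y))
      with (RtoC (- (2 * PI) * y)%R + (j * v * y - s * Clog (a + j * y))).
    - rewrite Cexp_plus; f_equal; unfold Cexp; simpl; rewrite cos_0, sin_0; apply C_ext; simpl; ring.
    - rewrite Cmult_plus_distr_l, Ej, RtoC_mult, RtoC_opp; ring. }
  rewrite E; unfold kK; pose proof (exp_pos (- (2 * PI) * y)).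
  assert (N : RtoC (1 + exp (- (2 * PI) * y))%R <> 0) by (intro Z; apply RtoC_inj in Z; lra).
  rewrite RtoC_inv by lra; rewrite RtoC_plus in *; field; auto. }
assert (E1 : Cexp (- (v / 2)) = Cexp (- (c * v)) * Cexp (v * a)).
{ rewrite <- Cexp_plus; f_equal; unfold a; field; auto. }
assert (E2 : Cexp (- ((v + (2 * PI)%R * j) / 2)) = - Cexp (- (v / 2))).
{ replace (- ((v + (2 * PI)%R * j) / 2)) with (- (v / 2) - Lj j - Lj j).
  - rewrite !Cexp_minus, Cexp_Lj by auto.
    assert (j0 : j <> 0) by (apply Cmod_gt_0; rewrite vert_mod; auto; lra).
    replace (Cexp (- (v / 2)) / j / j) with (Cexp (- (v / 2)) / (j * j)) by (field; auto).
    rewrite vert_sqr by auto; field.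
  - unfold Lj; rewrite RtoC_mult; unfold Rdiv; rewrite RtoC_mult, RtoC_inv by lra; field; auto. }
unfold kap, pv; fold a; rewrite E2.
replace (KI (kK j) j s v a) with (Tj j s v a - KI (kK j) j s (v + (2 * PI)%R * j) a)
  by (rewrite E; ring).
rewrite <- Cmult_plus_distr_l, <- Tj_continuation, E1 by auto; ring.
Qed.

Lemma cder_minus_half c : cder (fun c => c - / 2) c 1.
Proof. eapply der_eq; [apply der_minus; [apply der_id|apply der_const]|]; ring. Qed.

Lemma kap_holo_at j s v c : vert j -> (Re (j * v) < 0)%R -> (/ 2 < Re c)%R -> holo_at (kap j) s v c.
Proof.
intros Hj Hv Hc; unfold kap; apply holo_at_mult.
- apply holo_at_Cexp, holo_at_opp; unfold Cdiv; apply holo_at_mult; [apply holo_at_coord2|apply holo_at_const].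
- apply (holo_at_comp _ _ _ (KI (kK j) j) (fun v => v) (fun c => c - / 2) 1 1).
  + apply der_id.
  + apply cder_minus_half.
  + apply KI_holo_at; auto using bounded1_kK, Re_minus_half.
Qed.

Lemma pv_holo_at s v c : (/ 2 < Re c)%R -> holo_at pv s v c.
Proof.
intro Hc; unfold pv; apply holo_at_mult.
- apply holo_at_Cexp, holo_at_opp, holo_at_mult; [apply holo_at_coord3|apply holo_at_coord2].
- apply (holo_at_comp _ _ _ Pint (fun v => v) (fun c => c - / 2) 1 1).
  + apply der_id.
  + apply cder_minus_half.
  + apply Pint_partials, Re_minus_half; auto.
Qed.

(** For [n = 0] and [w] in the initial strip this is the integral over [Re x = -1/2]. Each further
    step moves both [kap] terms one period away from the real axis and drops the [hj] terms met on
    the way, so that [W n] is defined on a strip wider by [n] periods on each side. *)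
Definition W (n : nat) (s w c : C) : C :=
  csum (fun k => pv s (w + I2pi * INR k) c) n + kap Ci s (w + I2pi * INR n) c +
  (csum (fun k => pv s (w - I2pi - I2pi * INR k) c) n + kap (- Ci) s (w - I2pi - I2pi * INR n) c).

Lemma Im_I2pi_mult (x : R) : Im (I2pi * x) = (2 * PI * x)%R.
Proof. unfold I2pi; simpl; ring. Qed.

Lemma Im_plus_I2pi (w : C) (x : R) : Im (w + I2pi * x) = (Im w + 2 * PI * x)%R.
Proof. rewrite <- Im_I2pi_mult; reflexivity. Qed.

Lemma Im_minus_I2pi_mult (w : C) (x : R) : Im (w - I2pi - I2pi * x) = (Im w - 2 * PI * (x + 1))%R.
Proof.
replace (w - I2pi - I2pi * x) with (w + I2pi * RtoC (- (x + 1))%R)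
  by (rewrite RtoC_opp, RtoC_plus; ring).
rewrite Im_plus_I2pi; ring.
Qed.

Definition strip (n : nat) (w : C) : Prop := (- (2 * PI * INR n) < Im w < 2 * PI * (INR n + 1))%R.

Lemma strip_Ci n w : strip n w -> (Re (Ci * (w + I2pi * INR n)) < 0)%R.
Proof. intros [H1 H2]; rewrite Re_Ci_mult, Im_plus_I2pi; lra. Qed.

Lemma strip_nCi n w : strip n w -> (Re (- Ci * (w - I2pi - I2pi * INR n)) < 0)%R.
Proof. intros [H1 H2]; rewrite Re_nCi_mult, Im_minus_I2pi_mult; lra. Qed.

Lemma strip_S n w : strip n w -> strip (S n) w.
Proof. unfold strip; rewrite S_INR; pose proof PI_RGT_0; lra. Qed.

Lemma cder_shift (a w : C) : cder (fun w => w + a) w 1.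
Proof. eapply der_eq; [apply der_plus; [apply der_id|apply der_const]|]; ring. Qed.

Lemma W_holo_at n s w c : strip n w -> (/ 2 < Re c)%R -> holo_at (W n) s w c.
Proof.
intros Hw Hc.
assert (A : forall G a, holo_at G s (w + a) c -> holo_at (fun s w c => G s (w + a) c) s w c).
{ intros G a HG; apply (holo_at_comp _ _ _ G (fun w => w + a) (fun c => c) 1 1); auto using cder_shift.
  apply der_id. }
unfold W; apply holo_at_plus; apply holo_at_plus.
- apply csum_holo_at; intros k Hk; apply A, pv_holo_at; auto.
- apply A, kap_holo_at; auto using vert_Ci, strip_Ci.
- apply csum_holo_at; intros k Hk.
  unfold Cminus.
  apply (holo_at_ext _ _ _ (fun s w c => pv s (w + (- I2pi - I2pi * INR k)) c) _ 1 Rlt_0_1).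
  + intros s' w' c' _; f_equal; ring.
  + apply A, pv_holo_at; auto.
- apply (holo_at_ext _ _ _ (fun s w c => kap (- Ci) s (w + (- I2pi - I2pi * INR n)) c) _ 1 Rlt_0_1).
  + intros s' w' c' _; f_equal; ring.
  + apply A, kap_holo_at; auto using vert_nCi.
    replace (w + (- I2pi - I2pi * INR n)) with (w - I2pi - I2pi * INR n) by ring.
    apply strip_nCi; auto.
Qed.

Lemma step_Ci v : v + (2 * PI)%R * Ci = v + I2pi.
Proof. reflexivity. Qed.

Lemma step_nCi v : v + (2 * PI)%R * - Ci = v - I2pi.
Proof. unfold I2pi; ring. Qed.

Lemma W_step n s w c : strip n w -> (/ 2 < Re c)%R ->
  W n s w c = W (S n) s w c
    + Cexp (- (c * (w + I2pi * INR n))) * hj Ci s (Lj Ci + Clog (- (Ci * (w + I2pi * INR n))))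
    + Cexp (- (c * (w - I2pi - I2pi * INR n)))
        * hj (- Ci) s (Lj (- Ci) + Clog (- (- Ci * (w - I2pi - I2pi * INR n)))).
Proof.
intros Hw Hc; unfold W.
rewrite (kap_step Ci), (kap_step (- Ci)) by (auto using vert_Ci, vert_nCi, strip_Ci, strip_nCi).
rewrite step_Ci, step_nCi, INR_C_S; simpl csum.
replace (w + I2pi * INR n + I2pi) with (w + I2pi * (INR n + 1)) by ring.
replace (w - I2pi - I2pi * INR n - I2pi) with (w - I2pi - I2pi * (INR n + 1)) by ring.
ring.
Qed.

(** * The functional equation of W on the wider strips *)

Section Difference.
Variables (s c : C).
Hypothesis (Hc : (/ 2 < Re c)%R).

Let Hc1 : (/ 2 < Re (c + 1))%R.
Proof. simpl; unfold Re in *; lra. Qed.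

(** The operator [f(c) - exp(v) f(c + 1)], applied to [pv] here and to [kap] in [dk]. It annihilates
    [exp(-c v)], hence the [hj] term of [kap_step], so that [dk_step] involves [dp] alone. *)
Let dp (v : C) : C := pv s v c - Cexp v * pv s v (c + 1).
Let dk (j v : C) : C := kap j s v c - Cexp v * kap j s v (c + 1).

Lemma dk_step j v : vert j -> (Re (j * v) < 0)%R -> dk j v = dp v + dk j (v + (2 * PI)%R * j).
Proof.
intros Hj Hv; unfold dk, dp.
rewrite (kap_step j s v c), (kap_step j s v (c + 1)) by auto.
assert (E : Cexp v * Cexp (- ((c + 1) * v)) = Cexp (- (c * v)))
  by (rewrite <- Cexp_plus; f_equal; ring).
assert (E2 : Cexp (v + (2 * PI)%R * j) = Cexp v).
{ rewrite Cexp_plus; destruct Hj as [->| ->].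
  - change ((2 * PI)%R * Ci) with I2pi; rewrite Cexp_I2pi; ring.
  - replace ((2 * PI)%R * - Ci) with (- I2pi) by (unfold I2pi; ring).
    rewrite Cexp_opp, Cexp_I2pi; field. }
rewrite E2, <- E; ring.
Qed.

Lemma dp_tends v : tends (at_pt v) dp (dp v).
Proof.
destruct (pv_holo_at s v c Hc) as [_ [_ [[l D] _]]]; destruct (pv_holo_at s v (c + 1) Hc1) as [_ [_ [[l' D'] _]]].
unfold dp; apply tends_minus; [apply (der_tends _ _ _ _ D)|].
apply tends_mult; [apply tends_Cexp, tends_id|apply (der_tends _ _ _ _ D')].
Qed.

Lemma dk_tends j v : vert j -> (Re (j * v) < 0)%R -> tends (at_pt v) (dk j) (dk j v).
Proof.
intros Hj Hv.
destruct (kap_holo_at j s v c Hj Hv Hc) as [_ [_ [[l D] _]]].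
destruct (kap_holo_at j s v (c + 1) Hj Hv Hc1) as [_ [_ [[l' D'] _]]].
unfold dk; apply tends_minus; [apply (der_tends _ _ _ _ D)|].
apply tends_mult; [apply tends_Cexp, tends_id|apply (der_tends _ _ _ _ D')].
Qed.

Lemma line_difference_base u : (- (2 * PI) < Im u < 0)%R ->
  dk Ci (u + I2pi) + dk (- Ci) u = Cexp (- s * Clog c).
Proof.
intro Hu; rewrite <- (line_lemma s (u + I2pi) c).
- replace (u + I2pi - I2pi) with u by ring; unfold dk.
  rewrite Cexp_plus, Cexp_I2pi; ring.
- replace (u + I2pi) with (u + I2pi * 1%R) by ring; rewrite Im_plus_I2pi; lra.
- auto.
Qed.

Lemma line_difference_real u : Im u = (- (2 * PI))%R ->
  dp (u + I2pi) + dk Ci (u + I2pi + I2pi) + dk (- Ci) u = Cexp (- s * Clog c).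
Proof.
intro Hu; pose proof PI_RGT_0.
set (G := fun u => dp (u + I2pi) + dk Ci (u + I2pi + I2pi) + dk (- Ci) u).
assert (TG : tends (at_pt u) G (G u)).
{ unfold G; apply tends_plus; [apply tends_plus|].
  - apply tends_comp with (g := dp) (l := u + I2pi); [apply dp_tends|].
    apply tends_plus; [apply tends_id|apply tends_const].
  - apply tends_comp with (g := dk Ci) (l := u + I2pi + I2pi).
    + apply dk_tends; [apply vert_Ci|]; rewrite Re_Ci_mult.
      replace (u + I2pi + I2pi) with (u + I2pi * 2%R) by ring.
      rewrite Im_plus_I2pi; lra.
    + apply tends_plus; [apply tends_plus; [apply tends_id|apply tends_const]|apply tends_const].
  - apply dk_tends; [apply vert_nCi|]; rewrite Re_nCi_mult; lra. }
apply NNPP; intro Hn; apply Cmod_pos_sub in Hn; destruct (TG _ Hn) as [r [Hr H1]].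
set (e := Rmin (r / 2) PI).
assert (He : (0 < e)%R) by (apply Rmin_pos; lra).
assert (He1 : (e <= r / 2)%R) by apply Rmin_l; assert (He2 : (e <= PI)%R) by apply Rmin_r.
specialize (H1 (u + Ci * e)); fold (G u) in H1.
assert (Iu : Im (u + Ci * e) = (- (2 * PI) + e)%R) by (rewrite <- Hu; simpl; unfold Im; ring).
assert (E : G (u + Ci * e) = Cexp (- s * Clog c)).
{ rewrite <- (line_difference_base (u + Ci * e)) by (rewrite Iu; lra).
  unfold G; f_equal; rewrite (dk_step Ci (u + Ci * e + I2pi)); [auto|apply vert_Ci|].
  rewrite Re_Ci_mult; replace (u + Ci * e + I2pi) with (u + Ci * e + I2pi * 1%R) by ring.
  rewrite Im_plus_I2pi, Iu; lra. }
rewrite E, Cmod_sub_sym in H1.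
unfold at_pt in H1; replace (u + Ci * e - u) with (Ci * e) in H1 by ring.
rewrite Cmod_mult, Cmod_Ci, Cmod_R, Rabs_pos_eq in H1 by lra.
specialize (H1 ltac:(lra)); unfold G in H1; lra.
Qed.

(** The end points [u] and [u + I2pi (n + 1)] lie on opposite sides of the real axis. As long as its
    next point is on the same side, one of them is moved inwards by [dk_step], which absorbs a term
    [dp]. *)
Lemma line_difference_sum n : forall u, (Im u < 0 < Im u + 2 * PI * (INR n + 1))%R ->
  csum (fun k => dp (u + I2pi * (INR k + 1))) n + dk Ci (u + I2pi * (INR n + 1)) + dk (- Ci) u
  = Cexp (- s * Clog c).
Proof.
pose proof PI_RGT_0.
induction n as [|n IH]; intros u Hu.
- simpl in Hu; simpl csum; simpl INR.
  replace (u + I2pi * (0%R + 1)) with (u + I2pi) by ring.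
  rewrite <- (line_difference_base u) by lra; ring.
- rewrite S_INR in Hu.
  destruct (Rlt_or_le (Im u + 2 * PI) 0) as [H1|H1]; [|destruct (Rlt_or_le 0 (Im u + 2 * PI * (INR n + 1))) as [H2|H2]].
  + assert (I1 : Im (u + I2pi) = (Im u + 2 * PI)%R).
    { replace (u + I2pi) with (u + I2pi * 1%R) by ring; rewrite Im_plus_I2pi; ring. }
    rewrite <- (IH (u + I2pi)) by (rewrite I1; lra).
    rewrite (dk_step (- Ci) (u + I2pi)) by (auto using vert_nCi; rewrite Re_nCi_mult; lra).
    rewrite step_nCi; replace (u + I2pi - I2pi) with u by ring.
    rewrite csum_S_left, INR_C_S; simpl INR.
    replace (u + I2pi * (0%R + 1)) with (u + I2pi) by ring.
    replace (u + I2pi + I2pi * (INR n + 1)) with (u + I2pi * (INR n + 1 + 1)) by ring.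
    rewrite (csum_ext (fun k => dp (u + I2pi * (INR (S k) + 1))) (fun k => dp (u + I2pi + I2pi * (INR k + 1)))).
    * ring.
    * intros k _; rewrite INR_C_S; f_equal; ring.
  + rewrite <- (IH u) by lra.
    rewrite (dk_step Ci (u + I2pi * (INR n + 1))).
    * rewrite step_Ci, INR_C_S; simpl csum.
      replace (u + I2pi * (INR n + 1) + I2pi) with (u + I2pi * (INR n + 1 + 1)) by ring; ring.
    * apply vert_Ci.
    * rewrite Re_Ci_mult; rewrite <- RtoC_plus, Im_plus_I2pi; lra.
  (* Neither end can move: [Im u + 2 pi >= 0 >= Im u + 2 pi (n + 1)] forces [n = 0] and
     [Im u = - 2 pi]. *)
  + pose proof (pos_INR n).
    assert (n = O).
    { destruct n; auto; rewrite S_INR in *; pose proof (pos_INR n); nra. }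
    subst n; simpl INR in *; simpl csum.
    rewrite <- (line_difference_real u) by lra.
    replace (u + I2pi * (0%R + 1)) with (u + I2pi) by ring.
    replace (u + I2pi * (1%R + 1)) with (u + I2pi + I2pi) by ring; ring.
Qed.

Lemma csum_two_sided (g : C -> C) (w : C) (n m : nat) :
  csum (fun k => g (w + I2pi * INR k)) n + csum (fun k => g (w - I2pi - I2pi * INR k)) m
  = csum (fun k => g (w - I2pi * (INR m + 1) + I2pi * (INR k + 1))) (m + n).
Proof.
induction m as [|m IH].
- simpl csum at 2; rewrite Cplus_0_r; apply csum_ext; intros k _; f_equal; simpl INR; ring.
- change (S m + n)%nat with (S (m + n)).
  rewrite (csum_S_left (fun k => g (w - I2pi * (INR (S m) + 1) + I2pi * (INR k + 1)))).
  change (csum (fun k => g (w - I2pi - I2pi * INR k)) (S m))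
    with (csum (fun k => g (w - I2pi - I2pi * INR k)) m + g (w - I2pi - I2pi * INR m)).
  rewrite (Cplus_assoc (csum _ n)), IH, (Cplus_comm (csum _ _) (g _)); f_equal.
  + f_equal; rewrite INR_C_S; simpl INR; ring.
  + apply csum_ext; intros k _; f_equal; rewrite !INR_C_S; ring.
Qed.

(** The [n] shed points above and the [n] below, listed from the bottom, form the sum of
    [line_difference_sum] with [n + n] terms. The factors [exp(v)] all equal [exp(w)], since the
    points differ by multiples of [I2pi]. *)
Lemma W_difference n w : strip n w ->
  W n s w c - Cexp w * W n s w (c + 1) = Cexp (- s * Clog c).
Proof.
intros [H1 H2]; pose proof PI_RGT_0; pose proof (pos_INR n).
set (u := w - I2pi * (INR n + 1)).
assert (Iu : Im u = (Im w - 2 * PI * (INR n + 1))%R).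
{ unfold u; replace (w - I2pi * (INR n + 1)) with (w - I2pi - I2pi * INR n) by ring.
  apply Im_minus_I2pi_mult. }
rewrite <- (line_difference_sum (n + n) u) by (rewrite Iu, plus_INR; lra).
unfold u; rewrite <- (csum_two_sided dp w n n).
replace (w - I2pi * (INR n + 1) + I2pi * (INR (n + n) + 1)) with (w + I2pi * INR n)
  by (rewrite plus_INR, RtoC_plus; ring).
replace (w - I2pi * (INR n + 1)) with (w - I2pi - I2pi * INR n) by ring.
assert (E1 : forall k : nat, Cexp (w + I2pi * INR k) = Cexp w).
{ intro k; rewrite Cexp_plus, INR_IZR_INZ, Cexp_I2pi_Z; ring. }
assert (E2 : forall k : nat, Cexp (w - I2pi - I2pi * INR k) = Cexp w).
{ intro k; rewrite !Cexp_minus, Cexp_I2pi, INR_IZR_INZ, Cexp_I2pi_Z; field. }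
assert (S1 : csum (fun k => dp (w + I2pi * INR k)) n
  = csum (fun k => pv s (w + I2pi * INR k) c) n - Cexp w * csum (fun k => pv s (w + I2pi * INR k) (c + 1)) n).
{ rewrite (csum_ext _ (fun k => pv s (w + I2pi * INR k) c + - Cexp w * pv s (w + I2pi * INR k) (c + 1))).
  - rewrite csum_plus, csum_scal; ring.
  - intros k _; unfold dp; rewrite E1; ring. }
assert (S2 : csum (fun k => dp (w - I2pi - I2pi * INR k)) n
  = csum (fun k => pv s (w - I2pi - I2pi * INR k) c) n
    - Cexp w * csum (fun k => pv s (w - I2pi - I2pi * INR k) (c + 1)) n).
{ rewrite (csum_ext _ (fun k => pv s (w - I2pi - I2pi * INR k) c
      + - Cexp w * pv s (w - I2pi - I2pi * INR k) (c + 1))).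
  - rewrite csum_plus, csum_scal; ring.
  - intros k _; unfold dp; rewrite E2; ring. }
rewrite S1, S2; unfold dk, W; rewrite E1, E2; ring.
Qed.

End Difference.

(** [w = log z], [Lp k] and [Lm k] are logarithms of [w + 2 pi i k] and of
    [w - 2 pi i (k+1)], and [M l] is a logarithm of [c + l]. *)
Definition form (N n : nat) (s w c : C) (Lp Lm M : nat -> C) : C :=
  csum (fun l => Cexp (w * INR l - s * M l)) N +
  csum (fun k => Cexp (- (c * (w + I2pi * INR k))) * hj Ci s (Lp k)) n +
  csum (fun k => Cexp (- (c * (w - I2pi - I2pi * INR k))) * hj (- Ci) s (Lm k)) n +
  Cexp (w * INR N) * W n s w (c + INR N).

(** The term shed by [W] at [c + N], multiplied by [exp(w N)], loses its dependence on [N] because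
    [exp(2 pi i N k) = 1]. It is thus the next term of the [hj] sums, provided that [Lp n] and
    [Lm n] are the principal branches of [kap_step]. *)
Lemma form_S_n N n s w c Lp Lm M : strip n w -> (/ 2 < Re (c + INR N))%R ->
  Lp n = Lj Ci + Clog (- (Ci * (w + I2pi * INR n))) ->
  Lm n = Lj (- Ci) + Clog (- (- Ci * (w - I2pi - I2pi * INR n))) ->
  form N (S n) s w c Lp Lm M = form N n s w c Lp Lm M.
Proof.
intros Hw Hc E1 E2; unfold form; rewrite (W_step n) by auto; simpl csum; rewrite E1, E2.
assert (F1 : Cexp (w * INR N) * Cexp (- ((c + INR N) * (w + I2pi * INR n)))
  = Cexp (- (c * (w + I2pi * INR n)))).
{ rewrite <- Cexp_plus.
  replace (w * INR N + - ((c + INR N) * (w + I2pi * INR n)))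
    with (- (c * (w + I2pi * INR n)) - I2pi * (INR N * INR n)) by ring.
  rewrite <- RtoC_mult, <- mult_INR, (INR_IZR_INZ (N * n)), Cexp_minus, Cexp_I2pi_Z; field. }
assert (F2 : Cexp (w * INR N) * Cexp (- ((c + INR N) * (w - I2pi - I2pi * INR n)))
  = Cexp (- (c * (w - I2pi - I2pi * INR n)))).
{ rewrite <- Cexp_plus.
  replace (w * INR N + - ((c + INR N) * (w - I2pi - I2pi * INR n)))
    with (- (c * (w - I2pi - I2pi * INR n)) + I2pi * (INR N * (INR n + 1))) by ring.
  rewrite <- INR_C_S, <- RtoC_mult, <- mult_INR, (INR_IZR_INZ (N * S n)), Cexp_plus, Cexp_I2pi_Z; ring. }
rewrite <- F1, <- F2; ring.
Qed.

(** [W_difference] at [c + N], multiplied by [exp(w N)], trades part of the last term of [form] for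
    the next term of the Lerch series. *)
Lemma form_S_N N n s w c Lp Lm M : strip n w -> (/ 2 < Re (c + INR N))%R ->
  M N = Clog (c + INR N) -> form (S N) n s w c Lp Lm M = form N n s w c Lp Lm M.
Proof.
intros Hw Hc E1; unfold form; simpl csum; rewrite E1, INR_C_S.
pose proof (W_difference s (c + INR N) Hc n w Hw) as HD.
replace (w * (INR N + 1)) with (w * INR N + w) by ring.
replace (w * INR N - s * Clog (c + INR N)) with (w * INR N + - s * Clog (c + INR N)) by ring.
rewrite !Cexp_plus, <- HD.
replace (c + (INR N + 1)) with (c + INR N + 1) by ring; ring.
Qed.

Lemma holo_at_coord2_comp (f : C -> C) s z c l : cder f z l -> holo_at (fun _ z _ => f z) s z c.
Proof.
intro H; apply (holo_at_comp _ _ _ (fun _ z _ => z) f (fun c => c) l 1); auto using holo_at_coord2, der_id.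
Qed.

Lemma holo_at_coord3_comp (f : C -> C) s z c l : cder f c l -> holo_at (fun _ _ c => f c) s z c.
Proof.
intro H; apply (holo_at_comp _ _ _ (fun _ _ c => c) (fun z => z) f 1 l); auto using holo_at_coord3, der_id.
Qed.

Lemma form_holo_at N n s z c (w : C -> C) (Lp Lm M : nat -> C -> C) :
  (exists l, cder w z l) -> (forall k, exists l, cder (Lp k) z l) ->
  (forall k, exists l, cder (Lm k) z l) -> (forall k, exists l, cder (M k) c l) ->
  strip n (w z) -> (/ 2 < Re (c + INR N))%R ->
  holo_at (fun s z c => form N n s (w z) c (fun k => Lp k z) (fun k => Lm k z) (fun k => M k c)) s z c.
Proof.
intros [lw Dw] DLp DLm DM Hw Hc.
pose proof (holo_at_coord2_comp w s z c lw Dw) as Hz.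
assert (HH : forall j L, vert j -> (exists l, cder L z l) -> holo_at (fun s z _ => hj j s (L z)) s z c).
{ intros j L Hj [l D]; apply (holo_at_comp _ _ _ (fun s L _ => hj j s L) L (fun c => c) l 1); auto.
  - apply der_id.
  - apply hj_holo_at; auto. }
unfold form; repeat apply holo_at_plus.
- apply csum_holo_at; intros k Hk; destruct (DM k) as [lM D].
  apply holo_at_Cexp, holo_at_minus; apply holo_at_mult; auto using holo_at_const, holo_at_coord1.
  apply (holo_at_coord3_comp (M k) s z c lM); auto.
- apply csum_holo_at; intros k Hk; apply holo_at_mult; [|apply HH; auto using vert_Ci].
  apply holo_at_Cexp, holo_at_opp, holo_at_mult; [apply holo_at_coord3|].
  apply holo_at_plus; auto using holo_at_const.
- apply csum_holo_at; intros k Hk; apply holo_at_mult; [|apply HH; auto using vert_nCi].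
  apply holo_at_Cexp, holo_at_opp, holo_at_mult; [apply holo_at_coord3|].
  apply holo_at_minus; [apply holo_at_minus|]; auto using holo_at_const.
- apply holo_at_mult; [apply holo_at_Cexp, holo_at_mult; auto using holo_at_const|].
  apply (holo_at_comp _ _ _ (W n) w (fun c => c + INR N) lw 1); auto using cder_shift.
  apply W_holo_at; auto.
Qed.

(** * The Lerch series *)

Definition vanish (u : nat -> C) : Prop :=
  forall eps, (0 < eps)%R -> exists N0, forall N, (N0 <= N)%nat -> (Cmod (u N) < eps)%R.

Lemma vanish_plus u v : vanish u -> vanish v -> vanish (fun N => u N + v N).
Proof.
intros Hu Hv eps He.
destruct (Hu (eps / 2)%R) as [N1 H1]; [lra|]; destruct (Hv (eps / 2)%R) as [N2 H2]; [lra|].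
exists (N1 + N2)%nat; intros N HN; eapply Rle_lt_trans; [apply Cmod_triangle|].
specialize (H1 N ltac:(lia)); specialize (H2 N ltac:(lia)); lra.
Qed.

Lemma vanish_mult_bounded (u : nat -> C) (b : nat -> C) (B : R) :
  (forall N, (Cmod (b N) <= B)%R) -> vanish u -> vanish (fun N => b N * u N).
Proof.
intros HB Hu eps He.
assert (HB0 : (0 <= B)%R) by (eapply Rle_trans; [apply Cmod_ge_0|apply (HB O)]).
destruct (Hu (eps / (B + 1))%R) as [N1 H1]; [apply Rdiv_lt_0_compat; lra|].
exists N1; intros N HN; specialize (H1 N HN); rewrite Cmod_mult.
apply Rle_lt_trans with (B * (eps / (B + 1)))%R.
- apply Rmult_le_compat; auto using Cmod_ge_0; lra.
- replace eps with ((B + 1) * (eps / (B + 1)))%R at 2 by (field; lra).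
  apply Rmult_lt_compat_r; [apply Rdiv_lt_0_compat|]; lra.
Qed.

Lemma vanish_csum (u : nat -> nat -> C) n : (forall k, (k < n)%nat -> vanish (u k)) ->
  vanish (fun N => csum (fun k => u k N) n).
Proof.
induction n; intro H; simpl.
- intros eps He; exists O; intros; rewrite Cmod_0; auto.
- apply vanish_plus; [apply IHn|apply (H n)]; auto.
Qed.

Lemma vanish_power (u : nat -> C) (c : C) (K e : R) : (0 < e)%R ->
  (forall N, (0 < Re (c + INR N))%R -> (Cmod (u N) <= K * exp (- e * ln (Re (c + INR N))))%R) ->
  vanish u.
Proof.
intros He H eps Hp; destruct (exp_small K e eps He Hp) as [T [HT H1]].
destruct (nfloor_ex (Rabs (Re c) + exp T)%R) as [N0 HN0].
{ pose proof (Rabs_pos (Re c)); pose proof (exp_pos T); lra. }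
exists (S N0); intros N HN; apply le_INR in HN; rewrite S_INR in HN.
assert (E : Re (c + INR N) = (Re c + INR N)%R) by reflexivity.
assert (H2 : (exp T < Re (c + INR N))%R).
{ rewrite E; pose proof (Rle_abs (- Re c)) as A; rewrite Rabs_Ropp in A; lra. }
pose proof (exp_pos T).
eapply Rle_lt_trans; [apply H; lra|apply H1].
rewrite <- (ln_exp T); left; apply ln_increasing; auto.
Qed.

(** The argument stays below [pi / 2] in the right half-plane, whence the constant; the power of
    [|x|] is exact. *)
Lemma Cmod_power (s x : C) : (0 < Re x)%R ->
  (Cmod (Cexp (- s * Clog x)) <= exp (Rabs (Im s) * (PI / 2)) * exp (- Re s * ln (Cmod x)))%R.
Proof.
intro Hx; rewrite Cmod_Cexp, <- exp_plus; apply exp_mono.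
replace (Re (- s * Clog x)) with (Im s * Im (Clog x) + - Re s * Re (Clog x))%R
  by (simpl; unfold Re, Im; ring).
rewrite Re_Clog.
pose proof (Im_Clog_bound x Hx); pose proof (Rle_abs (Im s * Im (Clog x))) as H1.
rewrite Rabs_mult in H1; pose proof (Rabs_pos (Im s)).
assert (Rabs (Im s) * Rabs (Im (Clog x)) <= Rabs (Im s) * (PI / 2))%R
  by (apply Rmult_le_compat_l; lra).
lra.
Qed.

Lemma ln_mono (a b : R) : (0 < a)%R -> (a <= b)%R -> (ln a <= ln b)%R.
Proof. intros Ha [H|H]; [left; apply ln_increasing; auto|subst; lra]. Qed.

(** Unlike in [kexp_bounds], the dependence on [a] is explicit, for use as [Re a] tends to infinity.
    It comes from [|a + j y| >= Re a] and [Re s > 0]. *)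
Lemma KI_bound k j s v a : vert j -> (Re (j * v) < 0)%R -> (0 < Re a)%R -> (0 < Re s)%R -> bounded1 k ->
  (Cmod (KI k j s v a) <=
   exp (Rabs (Im s) * (PI / 2)) / (- Re (j * v)) * exp (- Re s * ln (Re a)))%R.
Proof.
intros Hj Hv Ha Hs Hk.
destruct (KI_expdec k j s v a Hj Hv Ha Hk) as [K [e [_ [HC _]]]].
set (B := (exp (Rabs (Im s) * (PI / 2)) * exp (- Re s * ln (Re a)))%R).
assert (HE : expdec (fun y => kexp j s v a y * k y) B (- Re (j * v))).
{ split; [lra|split; auto].
  intros y Hy; rewrite Cmod_mult.
  apply Rle_trans with (Cmod (kexp j s v a y) * 1)%R.
  - apply Rmult_le_compat_l; [apply Cmod_ge_0|apply Hk; auto].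
  - rewrite Rmult_1_r; unfold kexp, Cminus; rewrite Cexp_plus, Cmod_mult, Rmult_comm.
    assert (Hx : (0 < Re (a + j * y))%R) by (rewrite vert_Re; auto).
    replace (- (s * Clog (a + j * y))) with (- s * Clog (a + j * y)) by ring.
    apply Rmult_le_compat; auto using Cmod_ge_0.
    + eapply Rle_trans; [apply Cmod_power; auto|]; unfold B.
      apply Rmult_le_compat_l; [left; apply exp_pos|]; apply exp_mono.
      assert (ln (Re a) <= ln (Cmod (a + j * y)))%R.
      { apply ln_mono; auto; rewrite <- (vert_Re j a y Hj); apply Re_le_Cmod. }
      nra.
    + rewrite Cmod_Cexp; right; f_equal; simpl; unfold Re; ring. }
eapply Rle_trans; [apply (int_half_line_bound _ _ _ HE)|]; unfold B, Rdiv; right; ring.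
Qed.

(** Along such a segment of logarithms [v = exp(u)] stays in [Re v <= 0], where [exp(v y)] remains
    bounded as [y] is translated to the right. *)
Definition left_segment (j L : C) : Prop :=
  forall t : R, (0 <= t <= 1)%R -> (Re (Cexp (Lj j + t * (L - Lj j))) <= 0)%R.

(** [Lj j + Lj j] is a logarithm of [j * j = -1]. Up to the sign of [Im j], imaginary parts on the
    segment stay between [pi / 2] and [3 pi / 2], where the cosine is not positive. *)
Lemma left_segment_Clog j v : vert j -> (Re v < 0)%R ->
  left_segment j (Lj j + Lj j + Clog (- v)) /\ Cexp (Lj j + Lj j + Clog (- v)) = v.
Proof.
intros Hj Hv.
assert (Hv' : (0 < Re (- v))%R) by (simpl; unfold Re in *; lra).
split.
- intros t Ht.
  replace (Lj j + Lj j + Clog (- v) - Lj j) with (Lj j + Clog (- v)) by ring.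
  set (x := Im (Clog (- v))).
  assert (Hx : (Rabs x < PI / 2)%R) by (apply Im_Clog_bound; auto).
  apply Rabs_def2 in Hx; pose proof PI_RGT_0.
  set (u := Lj j + t * (Lj j + Clog (- v))).
  assert (Iu : Im u = (Im j * (PI / 2) + t * (Im j * (PI / 2) + x))%R).
  { unfold u, Lj, x; simpl; unfold Im; ring. }
  assert (cos (Im u) <= 0)%R.
  { rewrite Iu; destruct Hj as [->| ->].
    - change (Im Ci) with 1%R; apply cos_le_0; nra.
    - change (Im (- Ci)) with (- (1))%R; rewrite <- cos_neg; apply cos_le_0; nra. }
  change (exp (Re u) * cos (Im u) <= 0)%R; pose proof (exp_pos (Re u)); nra.
- rewrite !Cexp_plus, Cexp_Lj, Cexp_Clog, vert_sqr by auto; ring.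
Qed.

(** At [v = j] the sum is [exp(v a) Tj j s v a], which is small, but the integral along [j] may
    diverge for other [v] in the left half-plane. With the integrating factor
    [exp(- (s - 1) (u - Lj j))], the derivative along the segment reduces to [a * ypow s v a] up to
    bounded factors, of size [a^(1 - Re s)]. Hence the condition [Re s > 1]. *)
Lemma hj_Pint_vanish j s c L : vert j -> (1 < Re s)%R -> left_segment j L ->
  vanish (fun N => hj j s L + Pint s (Cexp L) (c + INR N)).
Proof.
intros Hj Hs HL.
set (D := L - Lj j).
set (A := exp (Cmod (s - 1) * Cmod D)).
set (B := exp (exp (Cmod (Lj j) + Cmod D) * Cmod c)).
set (E := exp (Rabs (Im s) * (PI / 2))).
set (X := fun N u => Cexp (- (s - 1) * (u - Lj j)) * (hj j s u + Pint s (Cexp u) (c + INR N))).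
assert (P : forall x, (0 < exp x)%R) by apply exp_pos.
assert (H0 : vanish (fun N => X N (Lj j))).
{ apply (vanish_power _ c (exp (Re (j * c)) * E) (Re s)); [lra|]; intros N HN.
  unfold X; replace (Lj j - Lj j) with (RtoC 0) by ring.
  rewrite Cmult_0_r, Cexp_0, Cmult_1_l, Cexp_Lj by auto.
  pose proof (Tj_continuation j s j (c + INR N) Hj (vert_neg j Hj) HN) as HT.
  rewrite vert_sqr in HT by auto; replace (- - (1)) with (RtoC 1) in HT by ring.
  rewrite Clog_1, Cplus_0_r in HT; rewrite <- HT, Cmod_mult, Cmod_Cexp.
  rewrite Rmult_assoc; apply Rmult_le_compat; auto using Cmod_ge_0.
  - left; auto.
  (* The modulus of [exp(j (c + N))] does not depend on [N], as [j N] is imaginary. *)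
  - right; f_equal; rewrite Cmult_plus_distr_l; destruct Hj as [->| ->]; simpl; unfold Re; ring.
  - pose proof (KI_bound (fun _ => j) j s j (c + INR N) Hj (vert_neg j Hj) HN ltac:(lra)
      (bounded1_const j Hj)) as HB.
    assert (E1 : Re (j * j) = (- (1))%R) by (rewrite vert_sqr by auto; reflexivity).
    rewrite E1 in HB; eapply Rle_trans; [exact HB|].
    right; unfold E; field. }
assert (H1 : vanish (fun N => X N L - X N (Lj j))).
{ apply (vanish_power _ c (A * B * E * Cmod D) (Re s - 1)); [lra|]; intros N HN.
  set (al := c + INR N) in *.
  assert (Hal : (0 < Cmod al)%R) by (apply Cmod_gt_0, Re_pos_neq_0; auto).
  set (K := (A * B * E * exp (- (Re s - 1) * ln (Re al)))%R).
  replace (A * B * E * Cmod D * exp (- (Re s - 1) * ln (Re al)))%R with (K * Cmod D * (1 - 0))%R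
    by (unfold K; ring).
  replace (X N L - X N (Lj j)) with (X N (Lj j + 1%R * D) - X N (Lj j + 0%R * D)).
  - apply Cbounded_variation with (f := fun t : R => X N (Lj j + t * D))
      (df := fun t : R => - (Cexp (- (s - 1) * (t * D)) * (al * ypow s (Cexp (Lj j + t * D)) al)) * D);
      [lra|].
    intros t Ht; set (u := Lj j + t * D); split.
    + apply (der_comp _ (X N) (fun t : R => Lj j + t * D)); [|apply rder_line].
      fold u; destruct (Pint_partials s (Cexp u) al HN) as [_ [_ [Pv [D1 E1]]]].
      unfold X; eapply der_eq.
      * apply der_mult.
        -- apply der_Cexp, der_mult; [apply der_const|]; apply der_minus; [apply der_id|apply der_const].
        -- apply der_plus; [apply cder_hj|].
           apply (der_comp _ (fun w => Pint s w al) Cexp); [exact D1|apply cder_Cexp].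
      * cbv beta; fold al.
        replace (Pv * Cexp u) with (Cexp u * Pv) by ring; rewrite E1.
        replace (t * D) with (u - Lj j) by (unfold u; ring); ring.
    + rewrite Cmod_mult; apply Rmult_le_compat_r; [apply Cmod_ge_0|].
      rewrite Cmod_opp, !Cmod_mult; unfold K.
      assert (K1 : (Cmod (Cexp (- (s - 1) * (t * D))) <= A)%R).
      { rewrite Cmod_Cexp; apply exp_mono; eapply Rle_trans; [apply Re_le_Cmod|].
        rewrite !Cmod_mult, Cmod_opp, Cmod_R, Rabs_pos_eq by lra.
        apply Rmult_le_compat_l; [apply Cmod_ge_0|]; pose proof (Cmod_ge_0 D); nra. }
      assert (K2 : (Cmod al * Cmod (ypow s (Cexp u) al) <= B * E * exp (- (Re s - 1) * ln (Re al)))%R).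
      { unfold ypow, Cminus; rewrite Cexp_plus, Cmod_mult.
        replace (- (s * Clog al)) with (- s * Clog al) by ring.
        assert (Q1 : (Cmod (Cexp (Cexp u * al)) <= B)%R).
        { rewrite Cmod_Cexp; apply exp_mono.
          replace (Re (Cexp u * al)) with (Re (Cexp u * c) + Re (Cexp u) * INR N)%R
            by (unfold al; simpl; unfold Re, Im; ring).
          pose proof (HL t Ht) as Q; fold D in Q; fold u in Q; pose proof (pos_INR N).
          pose proof (Re_le_Cmod (Cexp u * c)) as Q2; rewrite Cmod_mult, Cmod_Cexp in Q2.
          assert (Q3 : (exp (Re u) * Cmod c <= exp (Cmod (Lj j) + Cmod D) * Cmod c)%R).
          { apply Rmult_le_compat_r; [apply Cmod_ge_0|]; apply exp_mono.
            eapply Rle_trans; [apply Re_le_Cmod|]; unfold u; eapply Rle_trans; [apply Cmod_triangle|].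
            rewrite Cmod_mult, Cmod_R, Rabs_pos_eq by lra; pose proof (Cmod_ge_0 D); nra. }
          nra. }
        assert (Q2 : (Cmod al * Cmod (Cexp (- s * Clog al)) <= E * exp (- (Re s - 1) * ln (Re al)))%R).
        { apply Rle_trans with (Cmod al * (E * exp (- Re s * ln (Cmod al))))%R.
          - apply Rmult_le_compat_l; [lra|apply Cmod_power; auto].
          - rewrite <- (exp_ln (Cmod al)) at 1 by auto.
            replace (exp (ln (Cmod al)) * (E * exp (- Re s * ln (Cmod al))))%R
              with (E * (exp (ln (Cmod al)) * exp (- Re s * ln (Cmod al))))%R by ring.
            rewrite <- exp_plus; apply Rmult_le_compat_l; [left; apply P|]; apply exp_mono.
            assert (ln (Re al) <= ln (Cmod al))%R by (apply ln_mono; auto; apply Re_le_Cmod).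
            nra. }
        replace (Cmod al * (Cmod (Cexp (Cexp u * al)) * Cmod (Cexp (- s * Clog al))))%R
          with (Cmod (Cexp (Cexp u * al)) * (Cmod al * Cmod (Cexp (- s * Clog al))))%R by ring.
        rewrite (Rmult_assoc B); apply Rmult_le_compat; auto using Cmod_ge_0.
        apply Rmult_le_pos; [lra|apply Cmod_ge_0]. }
      replace (A * B * E * exp (- (Re s - 1) * ln (Re al)))%R
        with (A * (B * E * exp (- (Re s - 1) * ln (Re al))))%R by ring.
      apply Rmult_le_compat; auto using Cmod_ge_0.
      apply Rmult_le_pos; auto using Cmod_ge_0.
  - replace (Lj j + 1%R * D) with L by (unfold D; ring).
    replace (Lj j + 0%R * D) with (Lj j) by ring; auto. }
pose proof (vanish_plus _ _ H0 H1) as H2.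
pose proof (vanish_mult_bounded _ (fun _ => Cexp ((s - 1) * D)) _ (fun _ => Rle_refl _) H2) as H3.
intros eps He; destruct (H3 eps He) as [N0 HN0]; exists N0; intros N HN; specialize (HN0 N HN).
replace (hj j s L + Pint s (Cexp L) (c + INR N))
  with (Cexp ((s - 1) * D) * (X N (Lj j) + (X N L - X N (Lj j)))); auto.
unfold X; fold D; replace (- (s - 1) * D) with (- ((s - 1) * D)) by ring; rewrite Cexp_opp.
field; apply Cexp_neq_0.
Qed.

Lemma kap_vanish j s v c : vert j -> (Re (j * v) < 0)%R -> (0 < Re s)%R ->
  vanish (fun N => kap j s v (c + INR N)).
Proof.
intros Hj Hv Hs; unfold kap.
apply (vanish_mult_bounded (fun N => KI (kK j) j s v (c + INR N - / 2))
  (fun _ => Cexp (- (v / 2))) _ (fun _ => Rle_refl _)).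
apply (vanish_power _ (c - / 2) (exp (Rabs (Im s) * (PI / 2)) / (- Re (j * v))) (Re s) Hs).
intros N HN; replace (c + INR N - / 2) with (c - / 2 + INR N) by ring.
apply (KI_bound (kK j) j s v _ Hj Hv HN Hs (bounded1_kK j Hj)).
Qed.

(** The factor [exp(w N)] turns each [pv] at [c + N] into [exp(-c v)] times [Pint] at [c - 1/2 + N].
    This is paired with the [hj] term of the same index, and [hj_Pint_vanish] applies because the
    prescribed logarithms are ends of left segments. The two [kap] terms vanish separately. *)
Lemma form_series n s w c (Lp Lm M : nat -> C) : (1 < Re s)%R -> (Re w < 0)%R -> strip n w ->
  (forall k, (k < n)%nat -> Lp k = Lj Ci + Lj Ci + Clog (- (w + I2pi * INR k))) ->
  (forall k, (k < n)%nat -> Lm k = Lj (- Ci) + Lj (- Ci) + Clog (- (w - I2pi - I2pi * INR k))) ->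
  vanish (fun N => form N n s w c Lp Lm M - csum (fun l => Cexp (w * INR l - s * M l)) N).
Proof.
intros Hs Hw Hn HLp HLm.
set (b := fun N => Cexp (w * INR N)).
assert (Bb : forall N, (Cmod (b N) <= 1)%R).
{ intro N; unfold b; rewrite Cmod_Cexp, <- exp_0; apply exp_mono.
  replace (Re (w * INR N)) with (Re w * INR N)%R by (simpl; unfold Re; ring).
  pose proof (pos_INR N); nra. }
set (T := fun j L v N => Cexp (- (c * v)) * (hj j s L + Pint s v (c - / 2 + INR N))).
set (u := fun N => csum (fun k => T Ci (Lp k) (w + I2pi * INR k) N) n +
  csum (fun k => T (- Ci) (Lm k) (w - I2pi - I2pi * INR k) N) n +
  (b N * kap Ci s (w + I2pi * INR n) (c + INR N) +
   b N * kap (- Ci) s (w - I2pi - I2pi * INR n) (c + INR N))).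
assert (VT : forall j v, vert j -> (Re v < 0)%R -> vanish (T j (Lj j + Lj j + Clog (- v)) v)).
{ intros j v Hj Hv; unfold T.
  apply (vanish_mult_bounded (fun N => hj j s (Lj j + Lj j + Clog (- v)) + Pint s v (c - / 2 + INR N))
    (fun _ => Cexp (- (c * v))) _ (fun _ => Rle_refl _)).
  destruct (left_segment_Clog j v Hj Hv) as [H1 H2].
  pose proof (hj_Pint_vanish j s (c - / 2) _ Hj Hs H1) as H3; rewrite H2 in H3; auto. }
assert (R1 : forall x : R, Re (w + I2pi * x) = Re w).
{ intro x; unfold I2pi; simpl; unfold Re; ring. }
assert (R2 : forall x : R, Re (w - I2pi - I2pi * x) = Re w).
{ intro x; unfold I2pi; simpl; unfold Re; ring. }
assert (V : vanish u).
{ unfold u; apply vanish_plus; [apply vanish_plus; apply vanish_csum; intros k Hk|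
    apply vanish_plus; apply (vanish_mult_bounded _ b 1 Bb); apply kap_vanish;
      auto using vert_Ci, vert_nCi, strip_Ci, strip_nCi; lra].
  - rewrite HLp by auto; apply VT; [apply vert_Ci|rewrite R1; auto].
  - rewrite HLm by auto; apply VT; [apply vert_nCi|rewrite R2; auto]. }
intros eps He; destruct (V eps He) as [N0 HN0]; exists N0; intros N HN; specialize (HN0 N HN).
replace (form N n s w c Lp Lm M - csum (fun l => Cexp (w * INR l - s * M l)) N) with (u N); auto.
assert (F : forall k : Z, b N * pv s (w + I2pi * IZR k) (c + INR N)
  = Cexp (- (c * (w + I2pi * IZR k))) * Pint s (w + I2pi * IZR k) (c - / 2 + INR N)).
{ intro k; unfold pv, b; rewrite Cmult_assoc, <- Cexp_plus.
  replace (c + INR N - / 2) with (c - / 2 + INR N) by ring; f_equal.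
  replace (w * INR N + - ((c + INR N) * (w + I2pi * IZR k)))
    with (- (c * (w + I2pi * IZR k)) - I2pi * (INR N * IZR k)) by ring.
  rewrite <- RtoC_mult, INR_IZR_INZ, <- mult_IZR, Cexp_minus, Cexp_I2pi_Z; field. }
assert (S1 : csum (fun k => T Ci (Lp k) (w + I2pi * INR k) N) n =
  csum (fun k => Cexp (- (c * (w + I2pi * INR k))) * hj Ci s (Lp k)) n
  + b N * csum (fun k => pv s (w + I2pi * INR k) (c + INR N)) n).
{ rewrite <- csum_scal, <- csum_plus; apply csum_ext; intros k _.
  rewrite (INR_IZR_INZ k), F; unfold T; ring. }
assert (S2 : csum (fun k => T (- Ci) (Lm k) (w - I2pi - I2pi * INR k) N) n =
  csum (fun k => Cexp (- (c * (w - I2pi - I2pi * INR k))) * hj (- Ci) s (Lm k)) n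
  + b N * csum (fun k => pv s (w - I2pi - I2pi * INR k) (c + INR N)) n).
{ rewrite <- csum_scal, <- csum_plus; apply csum_ext; intros k _.
  replace (w - I2pi - I2pi * INR k) with (w + I2pi * IZR (- (Z.of_nat k + 1))).
  - rewrite F; unfold T; ring.
  - rewrite opp_IZR, plus_IZR, <- INR_IZR_INZ, RtoC_opp, RtoC_plus; ring. }
unfold u, form, W; fold (b N); rewrite S1, S2; ring.
Qed.

(** * Continuous logarithms along paths *)

Definition clamp (x : R) : R := Rmax 0 (Rmin 1 x).

Lemma clamp_range x : (0 <= clamp x <= 1)%R.
Proof. unfold clamp; split; [apply Rmax_l|apply Rmax_lub; [lra|apply Rmin_l]]. Qed.

Lemma clamp_id x : (0 <= x <= 1)%R -> clamp x = x.
Proof. intro H; unfold clamp; rewrite Rmin_right, Rmax_right; lra. Qed.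

Lemma clamp_0 x : (x <= 0)%R -> clamp x = 0%R.
Proof. intro H; unfold clamp; rewrite Rmin_right, Rmax_left; lra. Qed.

Lemma clamp_1 x : (1 <= x)%R -> clamp x = 1%R.
Proof. intro H; unfold clamp; rewrite Rmin_left, Rmax_right; lra. Qed.

Lemma clamp_lip x y : (Rabs (clamp x - clamp y) <= Rabs (x - y))%R.
Proof.
destruct (Rle_or_lt x 0); destruct (Rle_or_lt y 0);
destruct (Rle_or_lt 1 x); destruct (Rle_or_lt 1 y); try lra;
rewrite ?(clamp_0 x), ?(clamp_0 y), ?(clamp_1 x), ?(clamp_1 y), ?(clamp_id x), ?(clamp_id y) by lra;
unfold Rabs; repeat destruct Rcase_abs; lra.
Qed.

(** Paths are only relevant on [0, 1]: they are extended by constants. *)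
Definition cont01 (p : R -> C) : Prop := forall t, conR (fun x => p (clamp x)) t.

Definition is_log_of (p l : R -> C) : Prop :=
  cont01 l /\ forall t, (0 <= t <= 1)%R -> Cexp (l t) = p t.

Lemma cont01_intro (p : R -> C) :
  (forall t, (0 <= t <= 1)%R -> forall eps, (0 < eps)%R -> exists delta, (0 < delta)%R /\
     forall t', (0 <= t' <= 1)%R -> (Rabs (t' - t) < delta)%R -> (Cmod (p t - p t') < eps)%R) ->
  cont01 p.
Proof.
intros H t eps He; destruct (H (clamp t) (clamp_range t) eps He) as [r [Hr H1]].
exists r; split; auto; intros x Hx; rewrite Cmod_sub_sym; apply H1; [apply clamp_range|].
rewrite at_RE in Hx; eapply Rle_lt_trans; [apply clamp_lip|auto].
Qed.

Lemma cont01_comp (p : R -> C) (f : R -> R) (K : R) : cont01 p ->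
  (forall x y, (Rabs (f x - f y) <= K * Rabs (x - y))%R) -> (0 < K)%R ->
  forall t, conR (fun x => p (clamp (f x))) t.
Proof.
intros H Hf HK t eps He; destruct (H (f t) eps He) as [r [Hr H1]].
exists (r / K)%R; split; [apply Rdiv_lt_0_compat; auto|]; intros x Hx; apply H1.
rewrite at_RE in *; eapply Rle_lt_trans; [apply Hf|].
replace r with (K * (r / K))%R by (field; lra); apply Rmult_lt_compat_l; auto.
Qed.

Lemma cont01_ext p q : (forall t, (0 <= t <= 1)%R -> p t = q t) -> cont01 p -> cont01 q.
Proof.
intros E H t; unfold conR; rewrite <- E by apply clamp_range.
apply tends_ext with (fun x => p (clamp x)); [intro; apply E, clamp_range|apply H].
Qed.

Lemma is_log_of_ext p q l m : (forall t, (0 <= t <= 1)%R -> p t = q t) ->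
  (forall t, (0 <= t <= 1)%R -> l t = m t) -> is_log_of p l -> is_log_of q m.
Proof.
intros E1 E2 [H1 H2]; split; [eapply cont01_ext; eauto|].
intros t Ht; rewrite <- E1, <- E2; auto.
Qed.

Lemma is_log_of_shift p l a : Cexp a = 1 -> is_log_of p l -> is_log_of p (fun t => l t + a).
Proof.
intros Ha [H1 H2]; split.
- intro t; apply tends_plus; [apply H1|apply tends_const].
- intros t Ht; rewrite Cexp_plus, Ha, H2; auto; ring.
Qed.

(** The indicator function of a locally constant property has derivative 0, hence is constant by the
    mean value theorem. *)
Lemma interval_connected (P : R -> Prop) :
  (forall t, (0 <= t <= 1)%R -> exists delta, (0 < delta)%R /\
     forall t', (0 <= t' <= 1)%R -> (Rabs (t' - t) < delta)%R -> (P t <-> P t')) ->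
  forall a b, (0 <= a <= 1)%R -> (0 <= b <= 1)%R -> P a -> P b.
Proof.
intros H a b Ha Hb Pa.
set (g := fun t => if excluded_middle_informative (P (clamp t)) then 0%R else 1%R).
assert (D : forall t, is_derive g t 0).
{ intro t; apply is_derive_Reals; intros eps He.
  destruct (H (clamp t) (clamp_range t)) as [r [Hr H1]]; exists (mkposreal r Hr); intros h Hh Hhr.
  assert (E : g (t + h)%R = g t).
  { assert (X : P (clamp t) <-> P (clamp (t + h))).
    { apply H1; [apply clamp_range|]; eapply Rle_lt_trans; [apply clamp_lip|].
      replace (t + h - t)%R with h by ring; auto. }
    unfold g; destruct (excluded_middle_informative (P (clamp t)));
    destruct (excluded_middle_informative (P (clamp (t + h)))); tauto. }
  rewrite E; replace ((g t - g t) / h - 0)%R with 0%R by (field; auto); rewrite Rabs_R0; auto. }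
destruct (MVT_gen g a b (fun _ => 0%R)) as [x [_ E]].
- intros; apply D.
- intros x _; apply derivable_continuous_pt; eexists; apply is_derive_Reals, D.
- rewrite Rmult_0_l in E; unfold g in E; rewrite !clamp_id in E by auto.
  destruct (excluded_middle_informative (P a)); [|contradiction].
  destruct (excluded_middle_informative (P b)); auto; lra.
Qed.

Lemma Cexp_eq_near (a b : C) : Cexp a = Cexp b -> (Cmod (a - b) < 1)%R -> a = b.
Proof.
intros H Hm; destruct (Cexp_eq _ _ H) as [k Hk].
replace (a - b) with (2 * PI * IZR k * Ci) in Hm by (rewrite Hk; ring).
rewrite !Cmod_mult, Cmod_Ci, !Cmod_R, Rmult_1_r, (Rabs_pos_eq 2), (Rabs_pos_eq PI), <- abs_IZR in Hm
  by (try lra; pose proof PI_RGT_0; lra).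
pose proof PI2_3_2.
assert (Z.abs k < 1)%Z.
{ apply lt_IZR; destruct (Rlt_or_le (IZR (Z.abs k)) 1); auto; nra. }
assert (k = 0)%Z by lia; subst k; rewrite Hk; ring.
Qed.

(** The difference of two continuous logarithms takes its values in a discrete set, so that their
    equality at [t] is a locally constant property. *)
Lemma is_log_of_unique p l m t0 : is_log_of p l -> is_log_of p m -> (0 <= t0 <= 1)%R -> l t0 = m t0 ->
  forall t, (0 <= t <= 1)%R -> l t = m t.
Proof.
intros [H1 H2] [H3 H4] Ht0 E t Ht.
apply (interval_connected (fun t => l t = m t)) with t0; auto.
clear t0 t Ht Ht0 E; intros t Ht.
destruct (tends_minus _ _ _ _ _ (H1 t) (H3 t) 1%R) as [r [Hr H5]]; [lra|].
exists r; split; auto; intros t' Ht' Hd; specialize (H5 t'); cbv beta in H5.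
rewrite at_RE, !clamp_id in H5 by auto; specialize (H5 Hd).
assert (E : Cexp (l t' - m t') = Cexp (l t - m t)).
{ rewrite !Cexp_minus, !H2, !H4 by auto.
  assert (p t <> 0) by (rewrite <- H2; auto; apply Cexp_neq_0).
  assert (p t' <> 0) by (rewrite <- H2; auto; apply Cexp_neq_0).
  field; auto. }
apply Cexp_eq_near in E; auto; split; intro X.
- replace (l t') with (l t' - m t' + m t') by ring; rewrite E, X; ring.
- replace (l t) with (l t - m t + m t) by ring; rewrite <- E, X; ring.
Qed.

Lemma Re_div_pos (x y : C) : (Cmod (x - y) < Cmod y)%R -> (0 < Re (x / y))%R.
Proof.
intro H; assert (Hy : (0 < Cmod y)%R) by (eapply Rle_lt_trans; [apply Cmod_ge_0|apply H]).
assert (y0 : y <> 0) by (apply Cmod_gt_0; auto).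
apply Re_pos_near with (RtoC 1).
replace (x / y - 1) with ((x - y) / y) by (field; auto).
rewrite Cmod_div by auto; apply Rmult_lt_reg_r with (Cmod y); auto.
unfold Rdiv; rewrite Rmult_assoc, Rinv_l by lra; simpl; lra.
Qed.

(** An explicit lift of a nearby path. It is the source of continuity with respect to the homotopy
    parameter in [lift_square]. *)
Lemma is_log_of_near p q l : cont01 p -> cont01 q -> is_log_of p l ->
  (forall t, (0 <= t <= 1)%R -> (Cmod (q t - p t) < Cmod (p t))%R) ->
  is_log_of q (fun t => l t + Clog (q t / p t)).
Proof.
intros Hp Hq [H1 H2] H; split.
- intro t.
  assert (p0 : p (clamp t) <> 0) by (rewrite <- H2 by apply clamp_range; apply Cexp_neq_0).
  apply tends_plus; [apply H1|]; apply tends_Clog; [apply Re_div_pos, H, clamp_range|].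
  apply tends_mult; [apply Hq|]; apply tends_inv; [auto|apply Hp].
- intros t Ht; rewrite Cexp_plus, Cexp_Clog, H2 by (auto; apply Re_div_pos; auto).
  field; rewrite <- H2 by auto; apply Cexp_neq_0.
Qed.

(** No local lifts are glued. With steps [h = 1 / n] so small that [p] varies by less than its
    modulus, the quotients of [q] at the successive points [min(t, k h)] lie in the right
    half-plane; their product telescopes to [q(t) / q(0)], and the sum of their logarithms is
    continuous in [t]. *)
Lemma is_log_of_exists p l0 : cont01 p -> (forall t, (0 <= t <= 1)%R -> p t <> 0) -> Cexp l0 = p 0%R ->
  exists l, is_log_of p l /\ l 0%R = l0.
Proof.
intros Hp Hp0 H0.
set (q := fun x => p (clamp x)).
assert (q0 : forall x, q x <> 0) by (intro; apply Hp0, clamp_range).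
destruct (con_on_bounded 0 1 (fun x => / q x)) as [K HK]; [lra|intros t Ht; apply tends_inv; auto; apply Hp|].
assert (HK0 : (0 <= K)%R) by (eapply Rle_trans; [apply Cmod_ge_0|apply (HK 0%R); lra]).
(* Translation by [h] is treated as a parameter at [0], so that [joint_uniform] yields uniform
   continuity. *)
assert (J : forall y, joint Rabs (fun h x => q (x + h)%R) 0%R y).
{ intros y eps He; destruct (Hp (y + 0)%R eps He) as [r [Hr H1]].
  exists (r / 2)%R; split; [lra|]; intros [h x] Hq; simpl in *; apply H1.
  rewrite at_RE in *; replace (x + h - (y + 0))%R with (x - y + h)%R by ring.
  eapply Rle_lt_trans; [apply Rabs_triang|].
  pose proof (Rmax_l (Rabs h) (Rabs (x - y))); pose proof (Rmax_r (Rabs h) (Rabs (x - y))); lra. }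
destruct (joint_uniform Rabs 0%R Rabs_R0 _ 0 1 (fun y _ => J y) (/ (K + 1))%R) as [r [Hr HU]];
  [apply Rinv_0_lt_compat; lra|].
destruct (nfloor_ex (/ r)%R) as [n0 Hn0]; [left; apply Rinv_0_lt_compat; auto|].
set (n := S n0); set (h := (/ INR n)%R).
assert (Hn : (0 < INR n)%R) by (apply lt_0_INR; unfold n; lia).
assert (Hh : (0 < h < r)%R).
{ split; [apply Rinv_0_lt_compat; auto|]; unfold h; rewrite <- (Rinv_inv r).
  apply Rinv_lt_contravar; [apply Rmult_lt_0_compat; auto; apply Rinv_0_lt_compat; auto|].
  unfold n; rewrite S_INR; lra. }
assert (HS : forall x y, (0 <= x <= 1)%R -> (Rabs (y - x) <= h)%R -> (Cmod (q y - q x) < Cmod (q x))%R).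
{ intros x y Hx Hy; specialize (HU (y - x)%R x ltac:(lra) Hx); cbv beta in HU.
  replace (x + (y - x))%R with y in HU by ring; rewrite Rplus_0_r in HU.
  assert (0 < Cmod (q x))%R by (apply Cmod_gt_0; auto).
  specialize (HK x Hx); rewrite Cmod_inv in HK by auto.
  eapply Rlt_le_trans; [apply HU|]; rewrite <- (Rinv_inv (Cmod (q x))).
  apply Rinv_le_contravar; [apply Rinv_0_lt_compat; auto|lra]. }
set (a := fun (k : nat) (t : R) => Rmin t (INR k * h)).
assert (HR : forall k t, (0 <= t <= 1)%R -> (0 <= a k t <= 1)%R /\ (Rabs (a (S k) t - a k t) <= h)%R).
{ intros k t Ht; unfold a; rewrite S_INR; pose proof (pos_INR k).
  assert (0 <= INR k * h)%R by (apply Rmult_le_pos; lra).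
  unfold Rmin; split; repeat destruct Rle_dec; try lra; apply Rabs_le; lra. }
assert (Hpos : forall k t, (0 <= t <= 1)%R -> (0 < Re (q (a (S k) t) / q (a k t)))%R).
{ intros k t Ht; destruct (HR k t Ht); apply Re_div_pos, HS; auto. }
assert (Tel : forall m t, (0 <= t <= 1)%R ->
  Cexp (l0 + csum (fun k => Clog (q (a (S k) t) / q (a k t))) m) = q (a m t)).
{ induction m; intros t Ht; simpl csum.
  - rewrite Cplus_0_r, H0; unfold q, a; simpl INR; rewrite Rmult_0_l, Rmin_right, clamp_id; auto; lra.
  - rewrite Cplus_assoc, Cexp_plus, IHm, Cexp_Clog by auto; field; auto. }
exists (fun t => l0 + csum (fun k => Clog (q (a (S k) t) / q (a k t))) n); split; [split|].
- intro t.
  assert (G : forall k, conR (fun x => q (a k (clamp x))) t).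
  { intro k; apply (cont01_comp p (fun x => a k (clamp x)) 1); auto; [|lra].
    intros x y; rewrite Rmult_1_l; eapply Rle_trans; [|apply clamp_lip].
    unfold a, Rmin; repeat destruct Rle_dec; unfold Rabs; repeat destruct Rcase_abs; lra. }
  assert (X : forall m, conR (fun x => csum (fun k => Clog (q (a (S k) (clamp x)) / q (a k (clamp x)))) m) t).
  { induction m; simpl; [apply tends_const|]; apply tends_plus; [apply IHm|].
    apply tends_Clog; [apply Hpos, clamp_range|]; apply tends_mult; [apply G|].
    apply tends_inv; [auto|apply G]. }
  apply tends_plus; [apply tends_const|apply X].
- intros t Ht; rewrite Tel by auto; unfold q, a, h; rewrite Rinv_r, Rmin_left, clamp_id; auto; lra.
- assert (E : forall k, a k 0%R = 0%R).
  { intro k; unfold a; pose proof (pos_INR k); apply Rmin_left; apply Rmult_le_pos; lra. }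
  (* The zero summand is written as a product so that [csum_scal] evaluates the sum. *)
  rewrite (csum_ext _ (fun _ => 0 * 0)).
  + rewrite csum_scal; ring.
  + intros k _; rewrite !E; replace (q 0%R / q 0%R) with (RtoC 1) by (field; auto).
    rewrite Clog_1; ring.
Qed.

(** * Concatenation and reversal of paths *)

(** [concat] with an arbitrary target, so that logarithms along a concatenation are concatenated in
    the same way. *)
Definition cat_fun {X : Type} (g h : R -> X) : R -> X :=
  fun t => if Rle_dec t (1 / 2) then g (2 * t)%R else h (2 * t - 1)%R.

Lemma cat_fun_0 {X} (g h : R -> X) : cat_fun g h 0 = g 0%R.
Proof. unfold cat_fun; destruct (Rle_dec 0 (1 / 2)); [|lra]; f_equal; ring. Qed.

Lemma cat_fun_1 {X} (g h : R -> X) : cat_fun g h 1 = h 1%R.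
Proof. unfold cat_fun; destruct (Rle_dec 1 (1 / 2)); [lra|]; f_equal; ring. Qed.

Lemma cat_fun_map {X Y} (f : X -> Y) (g h : R -> X) t :
  f (cat_fun g h t) = cat_fun (fun t => f (g t)) (fun t => f (h t)) t.
Proof. unfold cat_fun; destruct (Rle_dec t (1 / 2)); auto. Qed.

Lemma cont01_cat_fun l m : cont01 l -> cont01 m -> l 1%R = m 0%R -> cont01 (cat_fun l m).
Proof.
intros Hl Hm E t.
(* A formula without case distinction: at most one of the two clamped halves moves at a time, and
   the corner value, counted twice, is subtracted once. *)
assert (EQ : forall x, cat_fun l m (clamp x) = l (clamp (2 * x)) + m (clamp (2 * x - 1)) - l 1%R).
{ intro x; unfold cat_fun; destruct (Rle_dec (clamp x) (1 / 2)) as [H|H].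
  - assert (x <= 1 / 2)%R by (destruct (Rle_or_lt x 0); [lra|];
      destruct (Rle_or_lt 1 x); [rewrite clamp_1 in H; lra|rewrite clamp_id in H; lra]).
    rewrite (clamp_0 (2 * x - 1)), <- E by lra.
    replace (clamp (2 * x)) with (2 * clamp x)%R; [ring|].
    destruct (Rle_or_lt x 0); [rewrite !clamp_0|rewrite !clamp_id]; lra.
  - assert (1 / 2 < x)%R by (destruct (Rle_or_lt x 0); [rewrite clamp_0 in H; lra|];
      destruct (Rle_or_lt 1 x); [lra|rewrite clamp_id in H; lra]).
    rewrite (clamp_1 (2 * x)) by lra.
    replace (clamp (2 * x - 1)) with (2 * clamp x - 1)%R; [ring|].
    destruct (Rle_or_lt 1 x); [rewrite !clamp_1|rewrite !clamp_id]; lra. }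
assert (T1 : conR (fun x => l (clamp (2 * x))) t).
{ apply (cont01_comp l (fun x => 2 * x)%R 2 Hl); [|lra].
  intros x y; replace (2 * x - 2 * y)%R with (2 * (x - y))%R by ring.
  rewrite Rabs_mult, Rabs_pos_eq; lra. }
assert (T2 : conR (fun x => m (clamp (2 * x - 1))) t).
{ apply (cont01_comp m (fun x => 2 * x - 1)%R 2 Hm); [|lra].
  intros x y; replace (2 * x - 1 - (2 * y - 1))%R with (2 * (x - y))%R by ring.
  rewrite Rabs_mult, Rabs_pos_eq; lra. }
unfold conR; rewrite EQ.
apply tends_ext with (fun x => l (clamp (2 * x)) + m (clamp (2 * x - 1)) - l 1%R).
- intro x; rewrite EQ; auto.
- apply tends_minus; [apply tends_plus; auto|apply tends_const].
Qed.

Lemma is_log_of_cat_fun p q l m : is_log_of p l -> is_log_of q m -> l 1%R = m 0%R -> is_log_of (cat_fun p q) (cat_fun l m).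
Proof.
intros [H1 H2] [H3 H4] E; split; [apply cont01_cat_fun; auto|].
intros t Ht; unfold cat_fun; destruct (Rle_dec t (1 / 2)); [apply H2|apply H4]; lra.
Qed.

Lemma is_log_of_rev p l : is_log_of p l -> is_log_of (fun t => p (1 - t)%R) (fun t => l (1 - t)%R).
Proof.
intros [H1 H2]; split; [|intros t Ht; apply H2; lra].
assert (E : forall x, (1 - clamp x)%R = clamp (1 - x)).
{ intro x; destruct (Rle_or_lt x 0); [rewrite clamp_0, clamp_1; lra|].
  destruct (Rle_or_lt 1 x); [rewrite clamp_1, clamp_0; lra|rewrite !clamp_id; lra]. }
intro t; unfold conR; rewrite E; apply tends_ext with (fun x => l (clamp (1 - x))).
- intro x; rewrite E; auto.
- apply (cont01_comp l (fun x => 1 - x)%R 1 H1); [|lra].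
  intros x y; replace (1 - x - (1 - y))%R with (- (x - y))%R by ring; rewrite Rabs_Ropp; lra.
Qed.

(** ** Variation of the logarithm along a path *)

Definition log_variation (p : R -> C) (d : C) : Prop := exists l, is_log_of p l /\ l 1%R - l 0%R = d.

Lemma is_log_of_align p l m : is_log_of p l -> is_log_of p m -> exists a, Cexp a = 1 /\
  forall t, (0 <= t <= 1)%R -> m t = l t + a.
Proof.
intros Hl Hm; exists (m 0%R - l 0%R).
assert (E : Cexp (m 0%R - l 0%R) = 1).
{ rewrite Cexp_minus, (proj2 Hm), (proj2 Hl) by lra.
  field; rewrite <- (proj2 Hl) by lra; apply Cexp_neq_0. }
split; auto; intros t Ht.
apply (is_log_of_unique p m (fun t => l t + (m 0%R - l 0%R)) 0); auto using is_log_of_shift; [lra|ring].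
Qed.

Lemma log_variation_is_log_of p d l : log_variation p d -> is_log_of p l -> l 1%R = l 0%R + d.
Proof.
intros [m [Hm Hd]] Hl; destruct (is_log_of_align p m l Hm Hl) as [a [_ Ha]].
rewrite !Ha, <- Hd by lra; ring.
Qed.

Lemma log_variation_cat_fun p q d e : log_variation p d -> log_variation q e -> p 1%R = q 0%R -> log_variation (cat_fun p q) (d + e).
Proof.
intros [l [Hl Hd]] [m [Hm He]] E.
assert (H : is_log_of q (fun t => m t + (l 1%R - m 0%R))).
{ apply is_log_of_shift; auto; rewrite Cexp_minus, (proj2 Hm), (proj2 Hl), E by lra.
  field; rewrite <- (proj2 Hm) by lra; apply Cexp_neq_0. }
exists (cat_fun l (fun t => m t + (l 1%R - m 0%R))); split.
- apply is_log_of_cat_fun; auto; ring.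
- rewrite cat_fun_0, cat_fun_1, <- Hd, <- He; ring.
Qed.

Lemma log_variation_rev p d : log_variation p d -> log_variation (fun t => p (1 - t)%R) (- d).
Proof.
intros [l [Hl Hd]]; exists (fun t => l (1 - t)%R); split; [apply is_log_of_rev; auto|].
rewrite Rminus_diag, Rminus_0_r, <- Hd; ring.
Qed.

(** The variation is additive under concatenation and changes sign under reversal; its values
    commute, so it vanishes on commutators. *)
Lemma log_variation_commutator p q d e : log_variation p d -> log_variation q e -> p 0%R = p 1%R -> q 0%R = p 0%R ->
  q 1%R = p 0%R ->
  log_variation (cat_fun (cat_fun p q) (cat_fun (fun t => p (1 - t)%R) (fun t => q (1 - t)%R))) 0.
Proof.
intros Hp Hq E1 E2 E3; replace (RtoC 0) with (d + e + (- d + - e)) by ring.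
apply log_variation_cat_fun; [apply log_variation_cat_fun; auto; congruence| |].
- apply log_variation_cat_fun; auto using log_variation_rev; rewrite Rminus_diag, Rminus_0_r; congruence.
- rewrite cat_fun_1, cat_fun_0, Rminus_0_r; congruence.
Qed.

(** ** Homotopies *)

Definition cont_sq (H : R -> R -> C) : Prop :=
  forall u t, (0 <= u <= 1)%R -> (0 <= t <= 1)%R -> forall eps, (0 < eps)%R ->
  exists delta, (0 < delta)%R /\ forall u' t', (0 <= u' <= 1)%R -> (0 <= t' <= 1)%R ->
    (Rabs (u' - u) < delta)%R -> (Rabs (t' - t) < delta)%R -> (Cmod (H u t - H u' t') < eps)%R.

Lemma cont_sq_slice H u : cont_sq H -> (0 <= u <= 1)%R -> cont01 (H u).
Proof.
intros HH Hu; apply cont01_intro; intros t Ht eps He.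
destruct (HH u t Hu Ht eps He) as [r [Hr H1]]; exists r; split; auto.
intros t' Ht' Hd; apply H1; auto; rewrite Rminus_diag, Rabs_R0; auto.
Qed.

Lemma cont_sq_uniform H u : cont_sq H -> (0 <= u <= 1)%R -> forall eps, (0 < eps)%R ->
  exists delta, (0 < delta)%R /\ forall u' t, (0 <= u' <= 1)%R -> (0 <= t <= 1)%R ->
    (Rabs (u' - u) < delta)%R -> (Cmod (H u' t - H u t) < eps)%R.
Proof.
intros HH Hu eps He.
destruct (joint_uniform (fun u' => Rabs (u' - u)) u) with (F := fun u' t => H (clamp u') (clamp t)) (a := 0%R)
  (b := 1%R) (eps := eps) as [r [Hr H1]]; auto.
- rewrite Rminus_diag; apply Rabs_R0.
- intros t Ht e Hpe; destruct (HH u t Hu Ht e Hpe) as [r [Hr H1]].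
  exists r; split; auto; intros [u' t'] Hq; simpl in *; rewrite at_RE in Hq.
  rewrite (clamp_id u), (clamp_id t), Cmod_sub_sym by auto; apply H1; try apply clamp_range.
  + rewrite <- (clamp_id u) by auto; eapply Rle_lt_trans; [apply clamp_lip|].
    eapply Rle_lt_trans; [apply Rmax_l|apply Hq].
  + rewrite <- (clamp_id t) by auto; eapply Rle_lt_trans; [apply clamp_lip|].
    eapply Rle_lt_trans; [apply Rmax_r|apply Hq].
- exists r; split; auto; intros u' t Hu' Ht Hd; specialize (H1 u' t Hd Ht); cbv beta in H1.
  rewrite !clamp_id in H1; auto.
Qed.

(** Each slice is lifted separately from the same initial value, and choice collects the lifts
    without any continuity in [u]. For [u'] near [u], uniqueness identifies the lift at [u'] with
    the lift at [u] plus the small logarithm of the quotient, which gives joint continuity. *)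
Lemma lift_square H l0 : cont_sq H -> (forall u t, (0 <= u <= 1)%R -> (0 <= t <= 1)%R -> H u t <> 0) ->
  (forall u, (0 <= u <= 1)%R -> H u 0%R = Cexp l0) ->
  exists om, cont_sq om /\ (forall u, (0 <= u <= 1)%R -> is_log_of (H u) (om u) /\ om u 0%R = l0).
Proof.
intros HH H0 HB.
assert (EX : forall u, exists l, (0 <= u <= 1)%R -> is_log_of (H u) l /\ l 0%R = l0).
{ intro u; destruct (classic (0 <= u <= 1)%R) as [Hu|Hu]; [|exists (fun _ => 0); tauto].
  destruct (is_log_of_exists (H u) l0) as [l Hl]; eauto using cont_sq_slice.
  symmetry; apply HB; auto. }
destruct (choice _ EX) as [om Hom]; exists om; split; [|auto].
intros u t Hu Ht eps He.
destruct (Hom u Hu) as [Lu Lu0].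
destruct (con_on_bounded 0 1 (fun x => / H u (clamp x))) as [K HK]; [lra| |].
{ intros x Hx; apply tends_inv; [apply H0; auto; apply clamp_range|]; apply (cont_sq_slice H u HH Hu). }
assert (HK0 : (0 <= K)%R) by (eapply Rle_trans; [apply Cmod_ge_0|apply (HK 0%R); lra]).
destruct (tends_Clog (at_pt 1) (fun x => x) 1 ltac:(simpl; lra) (tends_id 1) (eps / 2)%R) as [r1 [Hr1 H1]];
  [lra|].
set (e := Rmin 1 r1).
assert (Hpe : (0 < e)%R) by (apply Rmin_pos; lra).
assert (Hm1 : (e <= 1)%R) by apply Rmin_l; assert (Hm2 : (e <= r1)%R) by apply Rmin_r.
destruct (cont_sq_uniform H u HH Hu (e / (K + 1))%R) as [r2 [Hr2 H2]]; [apply Rdiv_lt_0_compat; lra|].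
assert (NE : forall u' t', (0 <= u' <= 1)%R -> (0 <= t' <= 1)%R -> (Rabs (u' - u) < r2)%R ->
  (Cmod (H u' t' / H u t' - 1) < e)%R).
{ intros u' t' Hu' Ht' Hd; specialize (H2 u' t' Hu' Ht' Hd); specialize (HK t' Ht').
  rewrite clamp_id in HK by auto; pose proof (H0 u t' Hu Ht').
  replace (H u' t' / H u t' - 1) with ((H u' t' - H u t') * / H u t') by (field; auto).
  rewrite Cmod_mult; apply Rle_lt_trans with (e / (K + 1) * K)%R.
  - apply Rmult_le_compat; auto using Cmod_ge_0; lra.
  - apply Rlt_le_trans with (e / (K + 1) * (K + 1))%R; [|right; field; lra].
    apply Rmult_lt_compat_l; [apply Rdiv_lt_0_compat|]; lra. }
assert (EQ : forall u' t', (0 <= u' <= 1)%R -> (0 <= t' <= 1)%R -> (Rabs (u' - u) < r2)%R ->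
  om u' t' = om u t' + Clog (H u' t' / H u t')).
{ intros u' t' Hu' Ht' Hd; destruct (Hom u' Hu') as [Lu' Lu0'].
  apply (is_log_of_unique (H u') (om u') (fun t' => om u t' + Clog (H u' t' / H u t')) 0); auto; [|lra|].
  - apply is_log_of_near; eauto using cont_sq_slice.
    intros x Hx; specialize (NE u' x Hu' Hx Hd); pose proof (H0 u x Hu Hx) as Hn.
    assert (0 < Cmod (H u x))%R by (apply Cmod_gt_0; auto).
    replace (H u' x - H u x) with ((H u' x / H u x - 1) * H u x) by (field; auto).
    rewrite Cmod_mult; nra.
  - rewrite Lu0', Lu0, !HB by auto; replace (Cexp l0 / Cexp l0) with (RtoC 1)
      by (field; apply Cexp_neq_0); rewrite Clog_1; ring. }
destruct (proj1 Lu t (eps / 2)%R) as [r3 [Hr3 H3]]; [lra|].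
exists (Rmin r2 r3); split; [apply Rmin_pos; auto|]; intros u' t' Hu' Ht' Hd1 Hd2.
assert (D1 : (Rabs (u' - u) < r2)%R) by (eapply Rlt_le_trans; [apply Hd1|apply Rmin_l]).
assert (D2 : (Rabs (t' - t) < r3)%R) by (eapply Rlt_le_trans; [apply Hd2|apply Rmin_r]).
rewrite Cmod_sub_sym, (EQ u' t') by auto.
specialize (H3 t'); rewrite at_RE, !clamp_id in H3 by auto; specialize (H3 D2).
specialize (H1 (H u' t' / H u t')); unfold at_pt in H1; rewrite Clog_1 in H1.
specialize (NE u' t' Hu' Ht' D1); specialize (H1 ltac:(lra)).
replace (om u t' + Clog (H u' t' / H u t') - om u t)
  with ((om u t' - om u t) + (Clog (H u' t' / H u t') - 0)) by ring.
eapply Rle_lt_trans; [apply Cmod_triangle|]; lra.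
Qed.

(** The end points of the lifts form a continuous logarithm of a constant, hence do not move. *)
Lemma lift_square_end H om : cont_sq om ->
  (forall u, (0 <= u <= 1)%R -> is_log_of (H u) (om u)) ->
  (forall u, (0 <= u <= 1)%R -> H u 1%R = H 0%R 1%R) ->
  forall u, (0 <= u <= 1)%R -> om u 1%R = om 0%R 1%R.
Proof.
intros Hc HL HE u Hu.
apply (is_log_of_unique (fun _ => H 0%R 1%R) (fun u => om u 1%R) (fun _ => om 0%R 1%R) 0); auto; [| |lra].
- split.
  + apply cont01_intro; intros v Hv eps He.
    destruct (Hc v 1%R Hv ltac:(lra) eps He) as [r [Hr H1]]; exists r; split; auto.
    intros v' Hv' Hd; apply H1; auto; [lra|]; rewrite Rminus_diag, Rabs_R0; auto.
  + intros v Hv; rewrite (proj2 (HL v Hv)) by lra; apply HE; auto.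
- split; [intro t; apply tends_const|].
  intros t Ht; apply (HL 0%R); lra.
Qed.

Lemma cont_sq_plus_const H a : cont_sq H -> cont_sq (fun u t => H u t + a).
Proof.
intros HH u t Hu Ht eps He; destruct (HH u t Hu Ht eps He) as [r [Hr H1]]; exists r; split; auto.
intros u' t' Hu' Ht' D1 D2; replace (H u t + a - (H u' t' + a)) with (H u t - H u' t') by ring; auto.
Qed.

(** * Coordinates of paths in N *)

Definition ps (p : C3) : C := fst (fst p).
Definition pz (p : C3) : C := snd (fst p).
Definition pc (p : C3) : C := snd p.

Lemma dist3_proj p q r : (dist3 p q < r)%R <->
  (Cmod (ps q - ps p) < r /\ Cmod (pz q - pz p) < r /\ Cmod (pc q - pc p) < r)%R.
Proof. destruct p as [[s z] c], q as [[s' z'] c']; apply dist3_lt. Qed.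

Lemma cont01_elim p t eps : cont01 p -> (0 <= t <= 1)%R -> (0 < eps)%R ->
  exists delta, (0 < delta)%R /\ forall t', (0 <= t' <= 1)%R -> (Rabs (t' - t) < delta)%R ->
    (Cmod (p t' - p t) < eps)%R.
Proof.
intros H Ht He; destruct (H t eps He) as [r [Hr H1]]; exists r; split; auto.
intros t' Ht' Hd; specialize (H1 t'); rewrite at_RE, !clamp_id in H1; auto.
Qed.

Lemma path_in_iff U (g : path) : path_in U g <->
  (forall t, (0 <= t <= 1)%R -> U (g t)) /\ cont01 (fun t => ps (g t)) /\
  cont01 (fun t => pz (g t)) /\ cont01 (fun t => pc (g t)).
Proof.
split.
- intros [HU Hc]; split; [auto|].
  split; [|split]; apply cont01_intro; intros t Ht eps He;
  destruct (Hc t Ht eps He) as [r [Hr H]]; exists r; split; auto;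
  intros t' Ht' Hd; specialize (H t' Ht' Hd); apply dist3_proj in H; rewrite Cmod_sub_sym; apply H.
- intros [HU [H1 [H2 H3]]]; split; auto; intros t Ht eps He.
  destruct (cont01_elim _ t eps H1 Ht He) as [r1 [Hr1 E1]].
  destruct (cont01_elim _ t eps H2 Ht He) as [r2 [Hr2 E2]].
  destruct (cont01_elim _ t eps H3 Ht He) as [r3 [Hr3 E3]].
  exists (Rmin r1 (Rmin r2 r3)); split; [repeat apply Rmin_pos; auto|].
  intros t' Ht' Hd; apply dist3_proj; split; [|split].
  + apply E1; auto; eapply Rlt_le_trans; [apply Hd|apply Rmin_l].
  + apply E2; auto; eapply Rlt_le_trans; [apply Hd|]; eapply Rle_trans; [apply Rmin_r|apply Rmin_l].
  + apply E3; auto; eapply Rlt_le_trans; [apply Hd|]; eapply Rle_trans; [apply Rmin_r|apply Rmin_r].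
Qed.

Lemma concat_cat_fun (g h : path) : concat g h = cat_fun g h.
Proof. reflexivity. Qed.

Lemma cat_fun_range (t : R) : (0 <= t <= 1)%R ->
  (t <= 1 / 2 -> 0 <= 2 * t <= 1)%R /\ (~ t <= 1 / 2 -> 0 <= 2 * t - 1 <= 1)%R.
Proof. intros; split; intros; lra. Qed.

Lemma cont01_cat_fun_map (f : C3 -> C) (g h : path) : cont01 (fun t => f (g t)) -> cont01 (fun t => f (h t)) ->
  g 1%R = h 0%R -> cont01 (fun t => f (concat g h t)).
Proof.
intros Hg Hh E; apply cont01_ext with (cat_fun (fun t => f (g t)) (fun t => f (h t))).
- intros t _; symmetry; apply (cat_fun_map f g h).
- apply cont01_cat_fun; auto; rewrite E; auto.
Qed.

Lemma path_in_concat U g h : path_in U g -> path_in U h -> g 1%R = h 0%R -> path_in U (concat g h).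
Proof.
rewrite !path_in_iff; intros [Ug [G1 [G2 G3]]] [Uh [H1 [H2 H3]]] E.
split; [|split; [|split]]; try (apply cont01_cat_fun_map; auto).
intros t Ht; unfold concat; destruct (cat_fun_range t Ht); destruct (Rle_dec t (1 / 2)); auto.
Qed.

Lemma cont01_rev p : cont01 p -> cont01 (fun t => p (1 - t)%R).
Proof.
intros H; assert (L : is_log_of (fun t => Cexp (p t)) p) by (split; auto).
apply (is_log_of_rev _ _ L).
Qed.

Lemma path_in_rev U g : path_in U g -> path_in U (rev g).
Proof.
rewrite !path_in_iff; intros [Ug [G1 [G2 G3]]]; unfold rev.
split; [intros t Ht; apply Ug; lra|].
split; [|split]; apply cont01_rev in G1; apply cont01_rev in G2; apply cont01_rev in G3; auto.
Qed.

Section PathN.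
Variable (g : path).
Hypothesis (Hg : pathN g).

Lemma pathN_cont_pz : cont01 (fun t => pz (g t)).
Proof. apply path_in_iff in Hg; tauto. Qed.

Lemma pathN_cont_pc (a : C) : cont01 (fun t => pc (g t) + a).
Proof.
apply path_in_iff in Hg; intro t; apply tends_plus; [apply Hg|apply tends_const].
Qed.

Lemma pathN_pz t : (0 <= t <= 1)%R -> pz (g t) <> 0 /\ pz (g t) <> 1.
Proof.
intro Ht; destruct Hg as [H _]; specialize (H t Ht); unfold pz; destruct (g t) as [[s z] c].
simpl in *; tauto.
Qed.

Lemma pathN_pc t (n : nat) : (0 <= t <= 1)%R -> pc (g t) + INR n <> 0.
Proof.
intros Ht E; destruct Hg as [H _]; specialize (H t Ht); unfold pc in E.
destruct (g t) as [[s z] c]; simpl in *; destruct H as [_ [_ H]].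
apply (H (- Z.of_nat n)%Z); rewrite opp_IZR, <- INR_IZR_INZ, RtoC_opp.
replace c with (c + INR n - INR n) by ring; rewrite E; ring.
Qed.

(** A zero of [w + 2 pi i k] would mean [z = 1]: the punctures of the [w]-plane are the points over
    the puncture [z = 1]. *)
Lemma pathN_log w t (k : Z) : is_log_of (fun t => pz (g t)) w -> (0 <= t <= 1)%R ->
  w t + I2pi * IZR k <> 0.
Proof.
intros [_ Hw] Ht E; apply (proj2 (pathN_pz t Ht)); rewrite <- Hw by auto.
rewrite <- Cexp_0, <- E, Cexp_plus, Cexp_I2pi_Z; ring.
Qed.

End PathN.

Lemma is_log_of_cont01_plus p w a : is_log_of p w -> cont01 (fun t => w t + a).
Proof. intros [H _] t; apply tends_plus; [apply H|apply tends_const]. Qed.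

(** * The logarithmic coordinates of a path *)

(** Of the logarithms of the base value [z = -1], the one with imaginary part [pi], in the middle of
    the strip where the original line integral converges. *)
Definition w0 : C := Ci * PI.

Lemma Cexp_w0 : Cexp w0 = RtoC (-1).
Proof.
unfold w0, Cexp; simpl.
replace (0 * PI - 1 * 0)%R with 0%R by ring; replace (0 * 0 + 1 * PI)%R with PI by ring.
rewrite exp_0, cos_PI, sin_PI; apply C_ext; simpl; ring.
Qed.

Definition princ_dir (k : Z) : C := if (0 <=? k)%Z then Ci else - Ci.

(** The branch of [log (w + 2 pi i k)] that is used for large [|k|]. *)
Definition princ (k : Z) (w : C) : C :=
  Lj (princ_dir k) + Clog (- (princ_dir k * (w + I2pi * IZR k))).

Definition princ_dom (k : Z) (w : C) : Prop := (Re (princ_dir k * (w + I2pi * IZR k)) < 0)%R.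

Lemma vert_princ_dir k : vert (princ_dir k).
Proof. unfold princ_dir; destruct (0 <=? k)%Z; [apply vert_Ci|apply vert_nCi]. Qed.

Lemma princ_arg k w : princ_dom k w -> (0 < Re (- (princ_dir k * (w + I2pi * IZR k))))%R.
Proof. unfold princ_dom; intro H; simpl in *; unfold Re in *; simpl in *; lra. Qed.

Lemma Cexp_princ k w : princ_dom k w -> Cexp (princ k w) = w + I2pi * IZR k.
Proof.
intro H; pose proof (vert_princ_dir k) as Hj; pose proof (princ_arg k w H).
unfold princ; rewrite Cexp_plus, Cexp_Lj, Cexp_Clog by auto.
set (j := princ_dir k) in *.
replace (j * - (j * (w + I2pi * IZR k))) with (- (j * j) * (w + I2pi * IZR k)) by ring.
rewrite vert_sqr by auto; ring.
Qed.

(** As [2 pi |k|] exceeds [|Im w|], all but finitely many of the points [w + 2 pi i k] stay in the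
    half-plane of their principal branch while [w] is bounded. *)
Lemma princ_dom_large k w (B : R) : (Cmod w <= B)%R -> (B < Rabs (IZR k))%R -> princ_dom k w.
Proof.
intros Hw Hk; unfold princ_dom, princ_dir; pose proof PI2_3_2.
pose proof (im_le_Cmod w); pose proof (Rle_abs (Im w)).
pose proof (Rle_abs (- Im w)) as A; rewrite Rabs_Ropp in A; pose proof (Cmod_ge_0 w).
destruct (Z.leb_spec 0 k) as [Hk0|Hk0]; apply IZR_le in Hk0 || apply IZR_lt in Hk0.
- rewrite Re_Ci_mult, Im_plus_I2pi; rewrite Rabs_pos_eq in Hk by auto; nra.
- rewrite Re_nCi_mult, Im_plus_I2pi; rewrite Rabs_left in Hk by auto; nra.
Qed.

Lemma princ_dom_w0 k : princ_dom k w0.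
Proof.
unfold princ_dom, princ_dir; pose proof PI_RGT_0.
assert (E : Im w0 = PI) by (unfold w0; simpl; ring).
destruct (Z.leb_spec 0 k) as [Hk0|Hk0].
- rewrite Re_Ci_mult, Im_plus_I2pi, E; apply IZR_le in Hk0; nra.
- rewrite Re_nCi_mult, Im_plus_I2pi, E; assert (k <= -1)%Z as Hk1 by lia; apply IZR_le in Hk1; nra.
Qed.

(** [L k] is a logarithm of a translate of [w], itself a logarithm of [z]. This nesting to depth two
    is the origin of the second derived subgroup. *)
Definition logs (g : path) (w : R -> C) (L : Z -> R -> C) (M : nat -> R -> C) : Prop :=
  is_log_of (fun t => pz (g t)) w /\
  (forall k, is_log_of (fun t => w t + I2pi * IZR k) (L k)) /\
  (forall n, is_log_of (fun t => pc (g t) + INR n) (M n)).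

Definition based (w : R -> C) (L : Z -> R -> C) (M : nat -> R -> C) : Prop :=
  w 0%R = w0 /\ (forall k, L k 0%R = princ k w0) /\ (forall n, M n 0%R = Clog (RtoC (1 / 2) + INR n)).

Lemma half_INR_pos n : (0 < Re (RtoC (1 / 2) + INR n))%R.
Proof. simpl; pose proof (pos_INR n); lra. Qed.

Lemma logs_exist g : cover_pt g -> exists w L M, logs g w L M /\ based w L M.
Proof.
intros [Hg H0].
destruct (is_log_of_exists (fun t => pz (g t)) w0) as [w [Hw Hw0]].
- apply pathN_cont_pz; auto.
- intros t Ht; apply pathN_pz; auto.
- rewrite H0, Cexp_w0; reflexivity.
- assert (EL : forall k, exists l, is_log_of (fun t => w t + I2pi * IZR k) l /\ l 0%R = princ k w0).
  { intro k; apply is_log_of_exists.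
    - apply is_log_of_cont01_plus with (1 := Hw).
    - intros t Ht; apply pathN_log with g; auto.
    - rewrite Hw0; apply Cexp_princ, princ_dom_w0. }
  assert (EM : forall n : nat, exists l, is_log_of (fun t => pc (g t) + INR n) l /\ l 0%R = Clog (RtoC (1 / 2) + INR n)).
  { intro n; apply is_log_of_exists.
    - apply pathN_cont_pc; auto.
    - intros t Ht; apply pathN_pc; auto.
    - rewrite H0; apply Cexp_Clog, half_INR_pos. }
  destruct (choice _ EL) as [L HL]; destruct (choice _ EM) as [M HM].
  exists w, L, M; repeat split; auto; try apply HL; try apply HM; apply Hw.
Qed.

Lemma logs_unique g w L M w' L' M' : logs g w L M -> logs g w' L' M' -> based w L M -> based w' L' M' ->
  forall t, (0 <= t <= 1)%R -> w t = w' t /\ (forall k, L k t = L' k t) /\ (forall n, M n t = M' n t).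
Proof.
intros [H1 [H2 H3]] [H1' [H2' H3']] [B1 [B2 B3]] [B1' [B2' B3']].
assert (Ew : forall t, (0 <= t <= 1)%R -> w t = w' t).
{ intros t Ht; apply (is_log_of_unique _ w w' 0 H1 H1'); auto; [lra|congruence]. }
intros t Ht; split; [auto|split].
- intro k; apply (is_log_of_unique (fun t => w t + I2pi * IZR k) (L k) (L' k) 0); auto; [|lra|congruence].
  apply is_log_of_ext with (fun t => w' t + I2pi * IZR k) (L' k); auto.
  intros x Hx; rewrite Ew; auto.
- intro n; apply (is_log_of_unique (fun t => pc (g t) + INR n) (M n) (M' n) 0); auto; [lra|congruence].
Qed.

(** Both truncations of [form] are taken equal. The lower logarithms have index [- k - 1], since
    [Lm k] belongs to [w - 2 pi i (k + 1)]. *)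
Definition formZ (N : nat) (s w c : C) (L : Z -> C) (M : nat -> C) : C :=
  form N N s w c (fun k => L (Z.of_nat k)) (fun k => L (- Z.of_nat k - 1)%Z) M.

Lemma princ_nat k w : princ (Z.of_nat k) w = Lj Ci + Clog (- (Ci * (w + I2pi * INR k))).
Proof.
unfold princ, princ_dir; rewrite <- INR_IZR_INZ.
destruct (Z.leb_spec 0 (Z.of_nat k)); [auto|lia].
Qed.

Lemma princ_neg k w :
  princ (- Z.of_nat k - 1)%Z w = Lj (- Ci) + Clog (- (- Ci * (w - I2pi - I2pi * INR k))).
Proof.
unfold princ, princ_dir; destruct (Z.leb_spec 0 (- Z.of_nat k - 1)); [lia|].
rewrite minus_IZR, opp_IZR, <- INR_IZR_INZ, RtoC_minus, RtoC_opp.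
replace (w + I2pi * (- INR k - 1%R)) with (w - I2pi - I2pi * INR k) by ring; auto.
Qed.

Definition stable_at (N0 : nat) (w c : C) (L : Z -> C) (M : nat -> C) : Prop :=
  strip N0 w /\ (/ 2 < Re (c + INR N0))%R /\
  (forall k, (N0 <= k)%nat -> M k = Clog (c + INR k) /\
     L (Z.of_nat k) = princ (Z.of_nat k) w /\ L (- Z.of_nat k - 1)%Z = princ (- Z.of_nat k - 1)%Z w).

(** Each step raises [n] and then [N] by one; both recursions ask for principal branches at the new
    index, which [stable_at] grants from [N0] on. *)
Lemma formZ_stable N0 s w c L M : stable_at N0 w c L M ->
  forall N, (N0 <= N)%nat -> formZ N s w c L M = formZ N0 s w c L M.
Proof.
intros [Hs [Hc H]] N HN; unfold formZ.
set (Lp := fun k => L (Z.of_nat k)); set (Lm := fun k => L (- Z.of_nat k - 1)%Z).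
assert (Hst : forall N, (N0 <= N)%nat -> strip N w).
{ intros N' HN'; induction HN'; auto using strip_S. }
assert (Hre : forall N, (N0 <= N)%nat -> (/ 2 < Re (c + INR N))%R).
{ intros N' HN'; apply le_INR in HN'; simpl in *; unfold Re in *; lra. }
induction HN as [|N HN IH]; [reflexivity|].
destruct (H N HN) as [E1 [E2 E3]].
rewrite form_S_n, form_S_N; auto.
- rewrite <- princ_nat; auto.
- rewrite <- princ_neg; auto.
Qed.

Lemma nat_above (B : R) : exists N : nat, (B < INR N)%R.
Proof.
destruct (nfloor_ex (Rabs B) (Rabs_pos B)) as [N HN]; exists (S N); rewrite S_INR.
pose proof (Rle_abs B); lra.
Qed.

(** A logarithm that starts on the principal branch remains on it as long as its argument stays in
    the corresponding half-plane. The bound is therefore required along the whole path; its margin 1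
    gives [Re (c + n) > 1] for [n >= N0]. *)
Lemma logs_stable g w L M (N0 : nat) : g 0%R = x0' -> pathN g -> logs g w L M -> based w L M ->
  (forall t, (0 <= t <= 1)%R -> (Cmod (w t) < INR N0 - 1 /\ Cmod (pc (g t)) < INR N0 - 1)%R) ->
  stable_at N0 (w 1%R) (pc (g 1%R)) (fun k => L k 1%R) (fun n => M n 1%R).
Proof.
intros H0 Hg [H1 [H2 H3]] [B1 [B2 B3]] HB.
assert (HN : (1 < INR N0)%R).
{ destruct (HB 0%R ltac:(lra)) as [A _]; pose proof (Cmod_ge_0 (w 0%R)); lra. }
assert (PL : forall k t, (INR N0 - 1 <= Rabs (IZR k))%R -> (0 <= t <= 1)%R -> L k t = princ k (w t)).
{ intros k t Hk Ht.
  assert (D : forall t, (0 <= t <= 1)%R -> princ_dom k (w t)).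
  { intros x Hx; destruct (HB x Hx) as [A _]; apply princ_dom_large with (Cmod (w x)); lra. }
  apply (is_log_of_unique (fun t => w t + I2pi * IZR k) (L k) (fun t => princ k (w t)) 0); auto; [|lra|].
  - split; [|intros x Hx; apply Cexp_princ; auto].
    intro x; unfold princ; apply tends_plus; [apply tends_const|].
    apply tends_Clog; [apply princ_arg, D, clamp_range|].
    apply tends_opp, tends_mult; [apply tends_const|].
    apply tends_plus; [apply H1|apply tends_const].
  - rewrite B1, B2; auto. }
assert (RC : forall t n, (0 <= t <= 1)%R -> (N0 <= n)%nat -> (1 < Re (pc (g t) + INR n))%R).
{ intros t n Ht Hn; destruct (HB t Ht) as [_ A]; apply le_INR in Hn.
  pose proof (re_le_Cmod (pc (g t))); pose proof (Rle_abs (- Re (pc (g t)))) as A1.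
  rewrite Rabs_Ropp in A1; change (1 < Re (pc (g t)) + INR n)%R; lra. }
assert (PM : forall n, (N0 <= n)%nat -> M n 1%R = Clog (pc (g 1%R) + INR n)).
{ intros n Hn.
  apply (is_log_of_unique (fun t => pc (g t) + INR n) (M n) (fun t => Clog (pc (g t) + INR n)) 0); auto; try lra.
  - split.
    + intro x; apply tends_Clog; [|apply pathN_cont_pc; auto].
      pose proof (RC (clamp x) n (clamp_range x) Hn); lra.
    + intros x Hx; apply Cexp_Clog; pose proof (RC x n Hx Hn); lra.
  - rewrite B3, H0; reflexivity. }
destruct (HB 1%R ltac:(lra)) as [A1 _].
split; [|split].
- pose proof (im_le_Cmod (w 1%R)); pose proof PI2_3_2; pose proof (Rle_abs (Im (w 1%R))).
  pose proof (Rle_abs (- Im (w 1%R))) as A2; rewrite Rabs_Ropp in A2; unfold strip; nra.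
- pose proof (RC 1%R N0 ltac:(lra) (le_n _)); lra.
- intros k Hk; split; [auto|]; apply le_INR in Hk; split; apply PL; try lra.
  + rewrite <- INR_IZR_INZ, Rabs_pos_eq; lra.
  + rewrite minus_IZR, opp_IZR, <- INR_IZR_INZ, Rabs_left; lra.
Qed.

(** The eventual value of [formZ N] does not refer to any bound on the path, which makes it
    independent of the choices made to compute it. *)
Definition is_value (g : path) (y : C) : Prop := exists w L M, logs g w L M /\ based w L M /\
  exists N0, forall N, (N0 <= N)%nat ->
    formZ N (ps (g 1%R)) (w 1%R) (pc (g 1%R)) (fun k => L k 1%R) (fun n => M n 1%R) = y.

Lemma logs_stable_exists g w L M : cover_pt g -> logs g w L M -> based w L M ->
  exists N0, stable_at N0 (w 1%R) (pc (g 1%R)) (fun k => L k 1%R) (fun n => M n 1%R).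
Proof.
intros [Hg H0] H1 H2.
destruct (con_on_bounded 0 1 (fun x => w (clamp x))) as [K1 HK1]; [lra|intros t _; apply H1|].
destruct (con_on_bounded 0 1 (fun x => pc (g (clamp x)) + 0)) as [K2 HK2];
  [lra|intros t _; apply (pathN_cont_pc g Hg 0)|].
destruct (nat_above (Rmax K1 K2 + 1)) as [N0 HN0].
pose proof (Rmax_l K1 K2); pose proof (Rmax_r K1 K2).
exists N0; apply logs_stable; auto.
intros t Ht; specialize (HK1 t Ht); specialize (HK2 t Ht); rewrite clamp_id, ?Cplus_0_r in * by auto; lra.
Qed.

Lemma is_value_stable g w L M N0 : logs g w L M -> based w L M ->
  stable_at N0 (w 1%R) (pc (g 1%R)) (fun k => L k 1%R) (fun n => M n 1%R) ->
  is_value g (formZ N0 (ps (g 1%R)) (w 1%R) (pc (g 1%R)) (fun k => L k 1%R) (fun n => M n 1%R)).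
Proof. intros H1 H2 HS; exists w, L, M; split; [auto|split; [auto|exists N0; apply formZ_stable; auto]]. Qed.

Lemma is_value_exists g : cover_pt g -> exists y, is_value g y.
Proof.
intro Hg; destruct (logs_exist g Hg) as [w [L [M [H1 H2]]]].
destruct (logs_stable_exists g w L M Hg H1 H2) as [N0 H].
eexists; eapply is_value_stable; eauto.
Qed.

(** The value depends on a path only through its end point and the end values of its logarithms;
    homotopy invariance reduces to comparing these. *)
Lemma is_value_transfer g h w L M w' L' M' y : is_value g y -> g 1%R = h 1%R ->
  logs g w L M -> based w L M -> logs h w' L' M' -> based w' L' M' ->
  w 1%R = w' 1%R -> (forall k, L k 1%R = L' k 1%R) -> (forall n, M n 1%R = M' n 1%R) -> is_value h y.
Proof.
intros [u [A [B [G1 [G2 [N0 G3]]]]]] E1 H1 H2 H3 H4 Ew EL EM.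
exists w', L', M'; split; [auto|split; [auto|exists N0]].
intros N HN; rewrite <- (G3 N HN), <- E1.
destruct (logs_unique _ _ _ _ _ _ _ G1 H1 G2 H2 1%R ltac:(lra)) as [U1 [U2 U3]].
rewrite <- Ew, <- U1.
f_equal; apply functional_extensionality; intro; congruence.
Qed.

Lemma is_value_unique g y y' : is_value g y -> is_value g y' -> y = y'.
Proof.
intros [w [L [M [G1 [G2 [N0 G3]]]]]] H.
assert (H' : is_value g y') by auto.
destruct H as [w' [L' [M' [G1' [G2' [N0' G3']]]]]].
destruct (logs_unique _ _ _ _ _ _ _ G1 G1' G2 G2' 1%R ltac:(lra)) as [U1 [U2 U3]].
rewrite <- (G3 (N0 + N0')%nat), <- (G3' (N0 + N0')%nat) by lia.
rewrite U1; f_equal; apply functional_extensionality; auto.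
Qed.

Lemma homotopic_squares g h : homotopic g h -> exists H : R -> R -> C3,
  (forall u, (0 <= u <= 1)%R -> pathN (H u)) /\
  cont_sq (fun u t => pz (H u t)) /\ cont_sq (fun u t => pc (H u t)) /\
  (forall t, (0 <= t <= 1)%R -> H 0%R t = g t /\ H 1%R t = h t) /\
  (forall u, (0 <= u <= 1)%R -> H u 0%R = g 0%R /\ H u 1%R = g 1%R).
Proof.
intros [Hg [Hh [E0 [E1 [H [HN [HC [HE HB]]]]]]]]; exists H.
assert (HS : forall f : C3 -> C, (forall p q, (Cmod (f p - f q) <= dist3 p q)%R) ->
  cont_sq (fun u t => f (H u t))).
{ intros f Hf u t Hu Ht eps He; destruct (HC u t Hu Ht eps He) as [r [Hr H1]].
  exists r; split; auto; intros u' t' Hu' Ht' D1 D2.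
  eapply Rle_lt_trans; [apply Hf|auto]. }
assert (Sz : cont_sq (fun u t => pz (H u t))).
{ apply HS; intros [[s z] c] [[s' z'] c']; unfold dist3, pz; simpl.
  eapply Rle_trans; [|apply Rmax_r]; apply Rmax_l. }
assert (Sc : cont_sq (fun u t => pc (H u t))).
{ apply HS; intros [[s z] c] [[s' z'] c']; unfold dist3, pc; simpl.
  eapply Rle_trans; [|apply Rmax_r]; apply Rmax_r. }
split; [|auto].
intros u Hu; apply path_in_iff; split; [intros; apply HN; auto|].
split; [|split; [apply (cont_sq_slice _ u Sz Hu)|apply (cont_sq_slice _ u Sc Hu)]].
apply (cont_sq_slice (fun u t => ps (H u t))); auto.
apply HS; intros [[s z] c] [[s' z'] c']; unfold dist3, ps; simpl; apply Rmax_l.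
Qed.

(** The square of [z] is lifted to [w], and the end of the lift is fixed. The translates of [w] thus
    form squares with fixed ends avoiding 0, and can be lifted a second time. *)
Lemma is_value_homotopic g h y : cover_pt g -> homotopic g h -> is_value g y -> is_value h y.
Proof.
intros [_ H0] Hh Hy; pose proof Hh as [_ [_ [E0 [E1 _]]]].
destruct (homotopic_squares g h Hh) as [H [HP [Sz [Sc [HE HB]]]]].
assert (HB0 : forall u, (0 <= u <= 1)%R -> H u 0%R = x0').
{ intros u Hu; rewrite (proj1 (HB u Hu)); auto. }
assert (HB1 : forall u, (0 <= u <= 1)%R -> H u 1%R = H 0%R 1%R).
{ intros u Hu; rewrite (proj2 (HB u Hu)), (proj2 (HB 0%R ltac:(lra))); auto. }
destruct (lift_square (fun u t => pz (H u t)) w0 Sz) as [w [Cw Hw]];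
  [intros u t Hu Ht; apply (pathN_pz (H u)); auto|intros u Hu; rewrite HB0, Cexp_w0; auto|].
assert (Ew : forall u, (0 <= u <= 1)%R -> w u 1%R = w 0%R 1%R).
{ apply (lift_square_end (fun u t => pz (H u t))); auto.
  - intros; apply Hw; auto.
  - intros u Hu; rewrite HB1; auto. }
assert (EL : forall k, exists L, (forall u, (0 <= u <= 1)%R ->
   is_log_of (fun t => w u t + I2pi * IZR k) (L u) /\ L u 0%R = princ k w0) /\ L 1%R 1%R = L 0%R 1%R).
{ intro k; destruct (lift_square (fun u t => w u t + I2pi * IZR k) (princ k w0)) as [L [CL HL]].
  - apply cont_sq_plus_const; auto.
  - intros u t Hu Ht; apply (pathN_log (H u)); auto; apply Hw; auto.
  - intros u Hu; rewrite (proj2 (Hw u Hu)); symmetry; apply Cexp_princ, princ_dom_w0.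
  - exists L; split; auto.
    apply (lift_square_end (fun u t => w u t + I2pi * IZR k)); auto; [intros; apply HL; auto| |lra].
    intros u Hu; rewrite Ew; auto. }
assert (EM : forall n : nat, exists M, (forall u, (0 <= u <= 1)%R ->
   is_log_of (fun t => pc (H u t) + INR n) (M u) /\ M u 0%R = Clog (RtoC (1 / 2) + INR n)) /\
   M 1%R 1%R = M 0%R 1%R).
{ intro n; destruct (lift_square (fun u t => pc (H u t) + INR n) (Clog (RtoC (1 / 2) + INR n))) as [M [CM HM]].
  - apply cont_sq_plus_const; auto.
  - intros u t Hu Ht; apply (pathN_pc (H u)); auto.
  - intros u Hu; rewrite HB0, Cexp_Clog by (auto using half_INR_pos); auto.
  - exists M; split; auto.
    apply (lift_square_end (fun u t => pc (H u t) + INR n)); auto; [intros; apply HM; auto| |lra].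
    intros u Hu; rewrite HB1; auto. }
destruct (choice _ EL) as [L HL]; destruct (choice _ EM) as [M HM].
assert (LG : forall u (f : path), (0 <= u <= 1)%R -> (forall t, (0 <= t <= 1)%R -> H u t = f t) ->
  logs f (w u) (fun k => L k u) (fun n => M n u) /\ based (w u) (fun k => L k u) (fun n => M n u)).
{ intros u f Hu Ef; split; [split; [|split]|split; [|split]].
  - apply is_log_of_ext with (fun t => pz (H u t)) (w u); auto; [|apply Hw; auto].
    intros t Ht; rewrite Ef; auto.
  - intro k; apply HL; auto.
  - intro n; apply is_log_of_ext with (fun t => pc (H u t) + INR n) (M n u); auto; [|apply HM; auto].
    intros t Ht; rewrite Ef; auto.
  - apply Hw; auto.
  - intro k; apply HL; auto.
  - intro n; apply HM; auto. }
destruct (LG 0%R g) as [G1 G2]; [lra|intros; apply HE; auto|].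
destruct (LG 1%R h) as [G3 G4]; [lra|intros; apply HE; auto|].
apply (is_value_transfer g h _ _ _ _ _ _ y Hy E1 G1 G2 G3 G4).
- symmetry; apply Ew; lra.
- intro k; symmetry; apply HL.
- intro n; symmetry; apply HM.
Qed.

Lemma logs_concat g h w L M w' L' M' : logs g w L M -> logs h w' L' M' ->
  w 1%R = w' 0%R -> (forall k, L k 1%R = L' k 0%R) -> (forall n, M n 1%R = M' n 0%R) ->
  logs (concat g h) (cat_fun w w') (fun k => cat_fun (L k) (L' k)) (fun n => cat_fun (M n) (M' n)).
Proof.
intros [H1 [H2 H3]] [H1' [H2' H3']] Ew EL EM; split; [|split].
- apply is_log_of_ext with (cat_fun (fun t => pz (g t)) (fun t => pz (h t))) (cat_fun w w'); auto.
  + intros t _; symmetry; apply (cat_fun_map pz g h).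
  + apply is_log_of_cat_fun; auto.
- intro k; apply is_log_of_ext with (cat_fun (fun t => w t + I2pi * IZR k) (fun t => w' t + I2pi * IZR k))
    (cat_fun (L k) (L' k)); auto.
  + intros t _; symmetry; apply (cat_fun_map (fun x => x + I2pi * IZR k) w w').
  + apply is_log_of_cat_fun; auto.
- intro n; apply is_log_of_ext with (cat_fun (fun t => pc (g t) + INR n) (fun t => pc (h t) + INR n))
    (cat_fun (M n) (M' n)); auto.
  + intros t _; symmetry; apply (cat_fun_map (fun x => pc x + INR n) g h).
  + apply is_log_of_cat_fun; auto.
Qed.

(** * Invariance under the second derived subgroup *)

Definition log_closed (g : path) : Prop := loopN g /\ log_variation (fun t => pz (g t)) 0 /\
  forall n : nat, log_variation (fun t => pc (g t) + INR n) 0.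

(** Stated for every lift [w] of [z], so that the base value of the logarithm need not be carried
    through the induction. *)
Definition iter_log_closed (g : path) : Prop := log_closed g /\
  forall w, is_log_of (fun t => pz (g t)) w -> forall k : Z, log_variation (fun t => w t + I2pi * IZR k) 0.

Lemma log_variation_ext p q d : (forall t, (0 <= t <= 1)%R -> p t = q t) -> log_variation p d -> log_variation q d.
Proof. intros E [l [H1 H2]]; exists l; split; auto; eapply is_log_of_ext; eauto. Qed.

(** One of the four rotations by multiples of a right angle brings a nonzero number into the right
    half-plane, where [Clog] is an inverse. *)
Lemma Cexp_surjective (z : C) : z <> 0 -> exists l, Cexp l = z.
Proof.
intro Hz.
assert (A : forall a, (0 < Re (Cexp (- a) * z))%R -> exists l, Cexp l = z).
{ intros a Ha; exists (a + Clog (Cexp (- a) * z)).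
  rewrite Cexp_plus, Cexp_Clog, Cexp_opp by auto; field; apply Cexp_neq_0. }
assert (E1 : Cexp (- Lj Ci) = - Ci).
{ rewrite Cexp_opp, Cexp_Lj by apply vert_Ci; apply C_ext; simpl; field. }
assert (E2 : Cexp (- Lj (- Ci)) = Ci).
{ rewrite Cexp_opp, Cexp_Lj by apply vert_nCi; apply C_ext; simpl; field. }
assert (E3 : Cexp (- w0) = - (1)).
{ rewrite Cexp_opp, Cexp_w0; apply C_ext; simpl; field. }
destruct (Rlt_or_le 0 (Re z)) as [H1|H1].
{ apply (A 0); replace (- 0) with (RtoC 0) by ring; rewrite Cexp_0, Cmult_1_l; auto. }
destruct (Rlt_or_le (Re z) 0) as [H2|H2].
{ apply (A w0); rewrite E3; simpl in *; unfold Re in *; lra. }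
destruct (Rlt_or_le 0 (Im z)) as [H3|H3].
{ apply (A (Lj Ci)); rewrite E1, Re_nCi_mult; auto. }
destruct (Rlt_or_le (Im z) 0) as [H4|H4].
{ apply (A (Lj (- Ci))); rewrite E2, Re_Ci_mult; lra. }
exfalso; apply Hz, C_ext; simpl; lra.
Qed.

Lemma log_variation_exists p : cont01 p -> (forall t, (0 <= t <= 1)%R -> p t <> 0) -> exists d, log_variation p d.
Proof.
intros Hp H0; destruct (Cexp_surjective (p 0%R)) as [l0 Hl0]; [apply H0; lra|].
destruct (is_log_of_exists p l0) as [l [Hl _]]; auto.
eexists; exists l; split; eauto.
Qed.

Lemma log_variation_homotopy H d : cont_sq H ->
  (forall u t, (0 <= u <= 1)%R -> (0 <= t <= 1)%R -> H u t <> 0) ->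
  (forall u, (0 <= u <= 1)%R -> H u 0%R = H 0%R 0%R /\ H u 1%R = H 0%R 1%R) ->
  log_variation (H 0%R) d -> log_variation (H 1%R) d.
Proof.
intros HC H0 HB Hd; destruct (Cexp_surjective (H 0%R 0%R)) as [l0 Hl0]; [apply H0; lra|].
destruct (lift_square H l0 HC H0) as [om [Com Hom]].
{ intros u Hu; rewrite Hl0; apply HB; auto. }
destruct (Hom 0%R ltac:(lra)) as [L0 B0]; destruct (Hom 1%R ltac:(lra)) as [L1 B1].
exists (om 1%R); split; auto.
assert (E : om 1%R 1%R = om 0%R 1%R).
{ apply (lift_square_end H om Com); [intros; apply Hom; auto|intros; apply HB; auto|lra]. }
rewrite E.
rewrite (log_variation_is_log_of _ _ _ Hd L0), B0, B1; ring.
Qed.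

Lemma cont01_const a : cont01 (fun _ => a).
Proof. intro t; apply tends_const. Qed.

Lemma cst_loop : loopN (cst x0').
Proof.
split; [|split; reflexivity].
apply path_in_iff; split;
  [|split; [apply (cont01_const (ps x0'))|split; [apply (cont01_const (pz x0'))|apply (cont01_const (pc x0'))]]].
intros t _; unfold cst, x0', inN; repeat split.
- intro E; apply RtoC_inj in E; lra.
- intro E; apply RtoC_inj in E; lra.
- intros k E; apply RtoC_inj in E.
  assert (0 < k)%Z by (apply lt_IZR; lra); assert (k < 1)%Z by (apply lt_IZR; lra); lia.
Qed.

Lemma loop_concat g h : loopN g -> loopN h -> loopN (concat g h).
Proof.
intros [G0 [G1 G2]] [H0 [H1 H2]]; split; [apply path_in_concat; auto; congruence|].
rewrite concat_cat_fun, cat_fun_0, cat_fun_1; auto.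
Qed.

Lemma loop_rev g : loopN g -> loopN (rev g).
Proof.
intros [G0 [G1 G2]]; split; [apply path_in_rev; auto|].
unfold rev; rewrite Rminus_diag, Rminus_0_r; auto.
Qed.

Lemma loop_commutator g h : loopN g -> loopN h -> loopN (commutator g h).
Proof. intros; unfold commutator; auto using loop_concat, loop_rev. Qed.

Lemma commutator_map (f : C3 -> C) g h t : f (commutator g h t)
  = cat_fun (cat_fun (fun t => f (g t)) (fun t => f (h t)))
       (cat_fun (fun t => f (g (1 - t)%R)) (fun t => f (h (1 - t)%R))) t.
Proof.
unfold commutator, concat, cat_fun, rev; destruct (Rle_dec t (1 / 2));
[destruct (Rle_dec (2 * t) (1 / 2))|destruct (Rle_dec (2 * t - 1) (1 / 2))]; auto.
Qed.

Lemma log_variation_commutator_loops (f : C3 -> C) l g h : loopN l -> loopN g -> loopN h ->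
  (exists d, log_variation (fun t => f (g t)) d) -> (exists d, log_variation (fun t => f (h t)) d) ->
  log_variation (fun t => f (l t)) 0 -> log_variation (fun t => f (concat l (commutator g h) t)) 0.
Proof.
intros [L0 [L1 L2]] Hg Hh [d Hd] [e He] Hl.
destruct (loop_commutator g h Hg Hh) as [_ [C1 _]].
destruct Hg as [_ [G1 G2]], Hh as [_ [H1 H2]].
apply log_variation_ext with (cat_fun (fun t => f (l t)) (fun t => f (commutator g h t))).
{ intros t _; symmetry; apply (cat_fun_map f l (commutator g h)). }
replace (RtoC 0) with (RtoC 0 + 0) by ring; apply log_variation_cat_fun; auto; [|rewrite L2, C1; auto].
apply log_variation_ext with (cat_fun (cat_fun (fun t => f (g t)) (fun t => f (h t)))
       (cat_fun (fun t => f (g (1 - t)%R)) (fun t => f (h (1 - t)%R)))).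
{ intros t _; symmetry; apply commutator_map. }
apply (log_variation_commutator (fun t => f (g t)) (fun t => f (h t)) d e); auto; congruence.
Qed.

Lemma log_variation_pz g : pathN g -> exists d, log_variation (fun t => pz (g t)) d.
Proof.
intro Hg; apply log_variation_exists; [apply pathN_cont_pz; auto|].
intros t Ht; apply pathN_pz; auto.
Qed.

Lemma log_variation_pc g (n : nat) : pathN g -> exists d, log_variation (fun t => pc (g t) + INR n) d.
Proof.
intro Hg; apply log_variation_exists; [apply pathN_cont_pc; auto|].
intros t Ht; apply pathN_pc; auto.
Qed.

Lemma log_variation_const_path (a : C) : a <> 0 -> log_variation (fun _ => a) 0.
Proof.
intro Ha; destruct (Cexp_surjective a Ha) as [l Hl]; exists (fun _ => l); split; [|ring].
split; [intro t; apply tends_const|auto].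
Qed.

Lemma log_closed_homotopic g h : homotopic g h -> log_closed g -> log_closed h.
Proof.
intros Hh [[G0 [G1 G2]] [Pz Pc]].
pose proof Hh as [_ [Hh2 [E0 [E1 _]]]].
destruct (homotopic_squares g h Hh) as [H [HP [Sz [Sc [HE HB]]]]].
split; [split; [auto|split; congruence]|]; split.
- apply log_variation_ext with (fun t => pz (H 1%R t)); [intros t Ht; rewrite (proj2 (HE t Ht)); auto|].
  apply (log_variation_homotopy (fun u t => pz (H u t))); auto.
  + intros u t Hu Ht; apply (pathN_pz (H u)); auto.
  + intros u Hu; destruct (HB u Hu) as [-> ->]; destruct (HB 0%R ltac:(lra)) as [-> ->]; auto.
  + apply log_variation_ext with (fun t => pz (g t)); auto; intros t Ht; rewrite (proj1 (HE t Ht)); auto.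
- intro n.
  apply log_variation_ext with (fun t => pc (H 1%R t) + INR n); [intros t Ht; rewrite (proj2 (HE t Ht)); auto|].
  apply (log_variation_homotopy (fun u t => pc (H u t) + INR n)).
  + apply cont_sq_plus_const; auto.
  + intros u t Hu Ht; apply (pathN_pc (H u)); auto.
  + intros u Hu; destruct (HB u Hu) as [-> ->]; destruct (HB 0%R ltac:(lra)) as [-> ->]; auto.
  + apply log_variation_ext with (fun t => pc (g t) + INR n); auto; intros t Ht; rewrite (proj1 (HE t Ht)); auto.
Qed.

Lemma iter_log_closed_homotopic g h : homotopic g h -> iter_log_closed g -> iter_log_closed h.
Proof.
intros Hh [HQ1 HQ2]; split; [apply log_closed_homotopic with g; auto|].
destruct (homotopic_squares g h Hh) as [H [HP [Sz [Sc [HE HB]]]]].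
intros w Hw k.
assert (E0 : forall u, (0 <= u <= 1)%R -> pz (H u 0%R) = Cexp (w 0%R)).
{ intros u Hu; rewrite (proj2 Hw), (proj1 (HB u Hu)) by lra.
  rewrite <- (proj2 (HE 0%R ltac:(lra))), (proj1 (HB 1%R ltac:(lra))); auto. }
destruct (lift_square (fun u t => pz (H u t)) (w 0%R)) as [om [Com Hom]];
  [exact Sz|intros u t Hu Ht; apply (pathN_pz (H u)); auto|exact E0|].
assert (EE : forall u, (0 <= u <= 1)%R -> om u 1%R = om 0%R 1%R).
{ apply (lift_square_end (fun u t => pz (H u t))); auto.
  - intros; apply Hom; auto.
  - intros u Hu; rewrite (proj2 (HB u Hu)), (proj2 (HB 0%R ltac:(lra))); auto. }
assert (E1 : forall t, (0 <= t <= 1)%R -> om 1%R t = w t).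
{ destruct (Hom 1%R ltac:(lra)) as [L1 B1].
  apply (is_log_of_unique (fun t => pz (h t)) _ _ 0); auto; [|lra].
  apply is_log_of_ext with (fun t => pz (H 1%R t)) (om 1%R); auto.
  intros t Ht; rewrite (proj2 (HE t Ht)); auto. }
apply log_variation_ext with (fun t => om 1%R t + I2pi * IZR k); [intros t Ht; rewrite E1; auto|].
apply (log_variation_homotopy (fun u t => om u t + I2pi * IZR k)).
- apply cont_sq_plus_const; auto.
- intros u t Hu Ht; apply (pathN_log (H u)); auto; apply Hom; auto.
- intros u Hu; rewrite EE by auto.
  destruct (Hom u Hu) as [_ ->]; destruct (Hom 0%R ltac:(lra)) as [_ ->]; auto.
- apply HQ2; destruct (Hom 0%R ltac:(lra)) as [L0 B0].
  apply is_log_of_ext with (fun t => pz (H 0%R t)) (om 0%R); auto.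
  intros t Ht; rewrite (proj1 (HE t Ht)); auto.
Qed.

(** The variations of [log z] and of [log (c + n)] are homomorphisms into an abelian group, so that
    commutators of arbitrary loops contribute nothing. *)
Lemma derived1_log_closed g : derived1 g -> log_closed g.
Proof.
induction 1 as [|l a b Hl IH Ha Hb|l l' Hl IH Hh].
- split; [apply cst_loop|]; split; [|intro n].
  + apply (log_variation_const_path (RtoC (-1))); intro E; apply RtoC_inj in E; lra.
  + apply (log_variation_const_path (RtoC (1 / 2) + INR n)), Re_pos_neq_0, half_INR_pos.
- destruct IH as [Ll [Pz Pc]]; split; [auto using loop_concat, loop_commutator|]; split.
  + apply (log_variation_commutator_loops pz); auto; apply log_variation_pz; [apply Ha|apply Hb].
  + intro n; apply (log_variation_commutator_loops (fun p => pc p + INR n)); auto;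
    apply log_variation_pc; [apply Ha|apply Hb].
- apply log_closed_homotopic with l; auto.
Qed.

Lemma log_closed_log g l0 : log_closed g -> Cexp l0 = pz x0' ->
  exists w, is_log_of (fun t => pz (g t)) w /\ w 0%R = l0 /\ w 1%R = l0.
Proof.
intros [[G0 [G1 G2]] [Pz _]] Hl0.
destruct (is_log_of_exists (fun t => pz (g t)) l0) as [w [Hw Hw0]].
- apply pathN_cont_pz; auto.
- intros t Ht; apply pathN_pz; auto.
- rewrite G1; auto.
- exists w; split; [auto|split; auto].
  rewrite (log_variation_is_log_of _ _ _ Pz Hw), Hw0; ring.
Qed.

(** Loops of the first derived subgroup lift to closed paths in the [w]-plane. Their commutator
    lifts to the commutator of the lifts, and the variation around each puncture [- 2 pi i k]
    cancels for the same reason as on the first level. *)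
Lemma derived2_iter_log_closed g : derived2 g -> iter_log_closed g.
Proof.
induction 1 as [|l a b Hl IH Ha Hb|l l' Hl IH Hh].
- split; [apply (derived1_log_closed (cst x0')); constructor|].
  intros w Hw k; destruct (log_variation_const_path (w 0%R + I2pi * IZR k)) as [m Hm].
  + apply (pathN_log (cst x0')); auto; [apply cst_loop|lra].
  + exists m; destruct Hm as [Hm Hd]; split; auto.
    apply is_log_of_ext with (fun _ => w 0%R + I2pi * IZR k) m; auto.
    intros t Ht; f_equal.
    apply (is_log_of_unique (fun _ => pz x0') (fun _ => w 0%R) w 0); auto; [|lra].
    split; [intro; apply tends_const|intros x Hx; apply (proj2 Hw 0%R); lra].
- destruct IH as [[Ll [Pz Pc]] HQ2].
  apply derived1_log_closed in Ha; apply derived1_log_closed in Hb.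
  assert (La : loopN a) by apply Ha; assert (Lb : loopN b) by apply Hb.
  split.
  { split; [auto using loop_concat, loop_commutator|]; split.
    + apply (log_variation_commutator_loops pz); auto; apply log_variation_pz; [apply La|apply Lb].
    + intro n; apply (log_variation_commutator_loops (fun p => pc p + INR n)); auto;
      apply log_variation_pc; [apply La|apply Lb]. }
  intros w Hw k.
  assert (H0 : Cexp (w 0%R) = pz x0').
  { rewrite (proj2 Hw), concat_cat_fun, cat_fun_0 by lra; destruct Ll as [_ [-> _]]; auto. }
  destruct (log_closed_log l (w 0%R) (conj Ll (conj Pz Pc)) H0) as [wl [Hwl [Wl0 Wl1]]].
  destruct (log_closed_log a (w 0%R) Ha H0) as [wa [Hwa [Wa0 Wa1]]].
  destruct (log_closed_log b (w 0%R) Hb H0) as [wb [Hwb [Wb0 Wb1]]].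
  (* The pieces fit together because [wa] and [wb] are closed with the same end points. *)
  set (wc := cat_fun (cat_fun wa wb) (cat_fun (fun t => wa (1 - t)%R) (fun t => wb (1 - t)%R))).
  assert (Hwc : is_log_of (fun t => pz (commutator a b t)) wc).
  { apply is_log_of_ext with (cat_fun (cat_fun (fun t => pz (a t)) (fun t => pz (b t)))
       (cat_fun (fun t => pz (a (1 - t)%R)) (fun t => pz (b (1 - t)%R)))) wc; auto.
    - intros t _; symmetry; apply commutator_map.
    - unfold wc; apply is_log_of_cat_fun; [apply is_log_of_cat_fun; auto; congruence| |].
      + apply is_log_of_cat_fun; auto using is_log_of_rev.
        * apply (is_log_of_rev _ _ Hwa).
        * apply (is_log_of_rev _ _ Hwb).
        * rewrite Rminus_diag, Rminus_0_r; congruence.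
      + rewrite cat_fun_1, cat_fun_0, Rminus_0_r; congruence. }
  assert (E : forall t, (0 <= t <= 1)%R -> cat_fun wl wc t = w t).
  { apply (is_log_of_unique (fun t => pz (concat l (commutator a b) t)) _ _ 0); auto; [|lra|].
    - apply is_log_of_ext with (cat_fun (fun t => pz (l t)) (fun t => pz (commutator a b t))) (cat_fun wl wc); auto.
      + intros t _; symmetry; apply (cat_fun_map pz l (commutator a b)).
      + apply is_log_of_cat_fun; auto; unfold wc; rewrite !cat_fun_0; congruence.
    - rewrite cat_fun_0; auto. }
  destruct (log_variation_exists (fun t => wa t + I2pi * IZR k)) as [d Hd].
  { apply is_log_of_cont01_plus with (1 := Hwa). }
  { intros t Ht; apply (pathN_log a); auto; apply La. }
  destruct (log_variation_exists (fun t => wb t + I2pi * IZR k)) as [e He].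
  { apply is_log_of_cont01_plus with (1 := Hwb). }
  { intros t Ht; apply (pathN_log b); auto; apply Lb. }
  apply log_variation_ext with (cat_fun (fun t => wl t + I2pi * IZR k) (cat_fun
    (cat_fun (fun t => wa t + I2pi * IZR k) (fun t => wb t + I2pi * IZR k))
    (cat_fun (fun t => wa (1 - t)%R + I2pi * IZR k) (fun t => wb (1 - t)%R + I2pi * IZR k)))).
  { intros t Ht; rewrite <- E by auto; unfold wc, cat_fun; repeat destruct Rle_dec; auto. }
  replace (RtoC 0) with (RtoC 0 + 0) by ring; apply log_variation_cat_fun.
  + apply HQ2; auto.
  + apply (log_variation_commutator _ _ d e Hd He); congruence.
  + rewrite !cat_fun_0; congruence.
- apply iter_log_closed_homotopic with l; auto.
Qed.

(** After [tau] every logarithm is back at its base value, so that the logarithms along [g] can be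
    appended unchanged and the end values agree. *)
Lemma is_value_derived2 tau g y : derived2 tau -> cover_pt g -> is_value g y -> is_value (concat tau g) y.
Proof.
intros Ht Hg [w [L [M [G1 [G2 [N0 G3]]]]]].
destruct (derived2_iter_log_closed tau Ht) as [[[T0 [T1 T2]] [Pz Pc]] HQ2].
destruct (logs_exist tau (conj T0 T1)) as [w' [L' [M' [H1 [B1 [B2 B3]]]]]].
destruct G2 as [C1 [C2 C3]].
pose proof H1 as [H11 [H12 H13]].
exists (cat_fun w' w), (fun k => cat_fun (L' k) (L k)), (fun n => cat_fun (M' n) (M n)); split; [|split].
- apply logs_concat; auto.
  + rewrite (log_variation_is_log_of _ _ _ Pz H11), B1, C1; ring.
  + intro k; rewrite (log_variation_is_log_of _ _ _ (HQ2 w' H11 k) (H12 k)), B2, C2; ring.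
  + intro n; rewrite (log_variation_is_log_of _ _ _ (Pc n) (H13 n)), B3, C3; ring.
- split; [|split]; intros; rewrite cat_fun_0; auto.
- exists N0; intros N HN; rewrite <- (G3 N HN), concat_cat_fun, !cat_fun_1.
  f_equal; apply functional_extensionality; intro; apply cat_fun_1.
Qed.

(** [epsilon] makes the function total on all maps from [R] to [C3]; where [is_value g] is
    inhabited, [Ztilde_eq] determines the value. *)
Definition Ztilde (g : path) : C := epsilon (inhabits (RtoC 0)) (is_value g).

Lemma Ztilde_eq g y : is_value g y -> Ztilde g = y.
Proof.
intro H; apply (is_value_unique g); auto.
unfold Ztilde; apply (epsilon_spec (inhabits (RtoC 0)) (is_value g)); exists y; auto.
Qed.

Lemma Ztilde_is_value g : cover_pt g -> is_value g (Ztilde g).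
Proof. intro H; destruct (is_value_exists g H) as [y Hy]; rewrite (Ztilde_eq g y); auto. Qed.

(** * Local holomorphy *)

(** All translates of [a] by [I2pi * k] have the same exponential. One of them very close to 0 would
    bring that exponential closer to 1 than it is. The gap provides one radius for infinitely many
    logarithms. *)
Lemma lattice_gap (a : C) : Cexp a <> 1 ->
  exists e, (0 < e)%R /\ forall k, (e <= Cmod (a + I2pi * IZR k))%R.
Proof.
intro Ha; apply Cmod_pos_sub in Ha.
destruct (tends_Cexp _ _ _ (tends_id 0) _ Ha) as [e [He H]]; exists e; split; auto.
intro k; destruct (Rle_or_lt e (Cmod (a + I2pi * IZR k))) as [Hk|Hk]; auto; exfalso.
specialize (H (a + I2pi * IZR k)); unfold at_pt in H.
replace (a + I2pi * IZR k - 0) with (a + I2pi * IZR k) in H by ring; specialize (H Hk).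
rewrite Cexp_0, Cexp_plus, Cexp_I2pi_Z, Cmult_1_r in H; lra.
Qed.

Lemma integer_gap (c : C) : (forall k : Z, c <> IZR k) ->
  exists e, (0 < e)%R /\ forall k : Z, (e <= Cmod (c + IZR k))%R.
Proof.
intro Hc; pose proof PI_RGT_0.
destruct (lattice_gap (I2pi * c)) as [e [He Hk]].
- intro E; destruct (Cexp_eq_1 _ E) as [k Hk]; apply (Hc k).
  replace c with (/ I2pi * (I2pi * c)) by (field; apply I2pi_neq_0).
  replace (I2pi * c) with (I2pi * IZR k) by (rewrite Hk; unfold I2pi; rewrite RtoC_mult; ring).
  field; apply I2pi_neq_0.
- exists (e / (2 * PI))%R; split; [apply Rdiv_lt_0_compat; lra|]; intro k.
  specialize (Hk k); replace (I2pi * c + I2pi * IZR k) with (I2pi * (c + IZR k)) in Hk by ring.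
  rewrite Cmod_mult in Hk.
  assert (EI : Cmod I2pi = (2 * PI)%R).
  { unfold I2pi; rewrite Cmod_mult, Cmod_Ci, Cmod_R, Rabs_pos_eq by lra; ring. }
  rewrite EI in Hk.
  apply Rmult_le_reg_l with (2 * PI)%R; [lra|].
  replace (2 * PI * (e / (2 * PI)))%R with e by (field; lra); auto.
Qed.

(** For [l] a logarithm of [p], the branch on the disc [|x - p| < |p|] that continues the value
    [l]. *)
Definition log_branch (l p x : C) : C := l + Clog (x / p).

Lemma log_branch_refl l (p : C) : p <> 0 -> log_branch l p p = l.
Proof. intro Hp; unfold log_branch, Cdiv; rewrite Cinv_r, Clog_1 by auto; ring. Qed.

Lemma Cexp_log_branch l p x : Cexp l = p -> (Cmod (x - p) < Cmod p)%R -> Cexp (log_branch l p x) = x.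
Proof.
intros Hl Hx; unfold log_branch; rewrite Cexp_plus, Hl, Cexp_Clog by (apply Re_div_pos; auto).
field; rewrite <- Hl; apply Cexp_neq_0.
Qed.

Lemma cder_log_branch l p x : (Cmod (x - p) < Cmod p)%R -> exists d, cder (log_branch l p) x d.
Proof.
intro Hx; eexists; unfold log_branch; apply der_plus; [apply der_const|].
apply (der_Clog _ (fun x => x / p)); [apply Re_div_pos; auto|].
apply der_mult; [apply der_id|apply der_const].
Qed.

Lemma is_log_of_log_branch l p (f : R -> C) : Cexp l = p -> cont01 f ->
  (forall t, (0 <= t <= 1)%R -> (Cmod (f t - p) < Cmod p)%R) -> is_log_of f (fun t => log_branch l p (f t)).
Proof.
intros Hl Hf H; split; [|intros t Ht; apply Cexp_log_branch; auto].
intro t; unfold log_branch; apply tends_plus; [apply tends_const|].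
apply tends_Clog; [apply Re_div_pos, H, clamp_range|].
apply tends_mult; [apply Hf|apply tends_const].
Qed.

(** The difficulty is uniformity: one radius must serve the local branches of all the logarithms,
    and one truncation must serve all short extensions [d]. The local function [F] is then a single
    [formZ N0] in these branches. *)
Lemma Ztilde_local g : cover_pt g -> exists r, (0 < r)%R /\
  (forall q, (dist3 (g 1%R) q < r)%R -> inN q) /\
  exists F : C3 -> C, holo3 (fun q => dist3 (g 1%R) q < r)%R F /\
    forall d, path_in (fun q => dist3 (g 1%R) q < r)%R d -> d 0%R = g 1%R ->
      Ztilde (concat g d) = F (d 1%R).
Proof.
intros [Hg H0].
destruct (logs_exist g (conj Hg H0)) as [w [L [M [HL HB]]]].
pose proof HL as [HL1 [HL2 HL3]].
assert (P1 : inN (g 1%R)) by (apply Hg; lra).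
assert (T1 : (0 <= 1 <= 1)%R) by lra.
set (z1 := pz (g 1%R)) in *; set (c1 := pc (g 1%R)) in *; set (w1 := w 1%R) in *.
assert (Ew1 : Cexp w1 = z1) by (apply HL1; auto).
destruct (pathN_pz g Hg 1 T1) as [Hz0 Hz1]; fold z1 in Hz0, Hz1.
assert (Hc1 : forall k : Z, c1 <> IZR k).
{ unfold c1, pc; destruct (g 1%R) as [[s z] c]; apply P1. }
destruct (lattice_gap w1) as [e [He HLw]]; [rewrite Ew1; auto|].
destruct (integer_gap c1 Hc1) as [ec [Hec HLc]].
assert (TL : tends (at_pt z1) (log_branch w1 z1) w1).
{ destruct (cder_log_branch w1 z1 z1) as [l D].
  - rewrite Cmod_zero_sub; apply Cmod_gt_0; auto.
  - apply tends_eq with (log_branch w1 z1 z1); [apply (der_tends _ _ _ _ D)|apply log_branch_refl; auto]. }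
destruct (TL e He) as [r1 [Hr1 HT]].
(* [r1] keeps [w] within [e] of [w1], [ec] keeps [c] off the integers, and the last two radii keep
   [z] off [0] and [1]. *)
set (r := Rmin (Rmin r1 ec) (Rmin (Cmod z1) (Cmod (z1 - 1)))).
assert (Hr : (0 < r)%R).
{ repeat apply Rmin_pos; auto; [apply Cmod_gt_0; auto|apply Cmod_pos_sub; auto]. }
assert (R1 : (r <= r1)%R) by (eapply Rle_trans; [apply Rmin_l|apply Rmin_l]).
assert (R2 : (r <= ec)%R) by (eapply Rle_trans; [apply Rmin_l|apply Rmin_r]).
assert (R3 : (r <= Cmod z1)%R) by (eapply Rle_trans; [apply Rmin_r|apply Rmin_l]).
assert (R4 : (r <= Cmod (z1 - 1))%R) by (eapply Rle_trans; [apply Rmin_r|apply Rmin_r]).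
clearbody r.
assert (Bz : forall q, (dist3 (g 1%R) q < r)%R -> (Cmod (pz q - z1) < r /\ Cmod (pc q - c1) < r)%R).
{ intros q Hq; apply dist3_proj in Hq; tauto. }
assert (BN : forall q, (dist3 (g 1%R) q < r)%R -> inN q).
{ intros q Hq; destruct (Bz q Hq) as [Q1 Q2]; destruct q as [[s z] c]; unfold pz, pc in *; simpl in *.
  split; [|split].
  - apply Cmod_sub_lt_neq with z1; lra.
  - intro E; subst z; rewrite Cmod_sub_sym in Q1; lra.
  - intros k E; specialize (HLc (- k)%Z); rewrite opp_IZR, RtoC_opp in HLc.
    subst c; rewrite Cmod_sub_sym in Q2; unfold Cminus in Q2; lra. }
exists r; split; [auto|split; [exact BN|]].
set (wl := log_branch w1 z1).
set (Ll := fun k z => log_branch (L k 1%R) (w1 + I2pi * IZR k) (wl z + I2pi * IZR k)).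
set (Ml := fun (n : nat) c => log_branch (M n 1%R) (c1 + INR n) (c + INR n)).
assert (NW : forall z, (Cmod (z - z1) < r)%R -> (Cmod (wl z - w1) < e)%R).
{ intros z Hz; apply HT; unfold at_pt; lra. }
assert (NL : forall z k, (Cmod (z - z1) < r)%R ->
  (Cmod (wl z + I2pi * IZR k - (w1 + I2pi * IZR k)) < Cmod (w1 + I2pi * IZR k))%R).
{ intros z k Hz; replace (wl z + I2pi * IZR k - (w1 + I2pi * IZR k)) with (wl z - w1) by ring.
  pose proof (NW z Hz); pose proof (HLw k); lra. }
assert (NM : forall c (n : nat), (Cmod (c - c1) < r)%R ->
  (Cmod (c + INR n - (c1 + INR n)) < Cmod (c1 + INR n))%R).
{ intros c n Hc; replace (c + INR n - (c1 + INR n)) with (c - c1) by ring.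
  rewrite INR_IZR_INZ; pose proof (HLc (Z.of_nat n)); lra. }
destruct (con_on_bounded 0 1 (fun x => w (clamp x))) as [K1 HK1]; [lra|intros t _; apply HL1|].
destruct (con_on_bounded 0 1 (fun x => pc (g (clamp x)) + 0)) as [K2 HK2];
  [lra|intros t _; apply (pathN_cont_pc g Hg 0)|].
(* [N0] dominates the path [g] and the ball around its end together, hence is valid for every
   [concat g d]. *)
destruct (nat_above (Rmax (K1 + e) (K2 + r) + 1)) as [N0 HN0].
pose proof (Rmax_l (K1 + e) (K2 + r)); pose proof (Rmax_r (K1 + e) (K2 + r)).
assert (B1 : forall t, (0 <= t <= 1)%R -> (Cmod (w t) <= K1)%R).
{ intros t Ht; specialize (HK1 t Ht); rewrite clamp_id in HK1; auto. }
assert (B2 : forall t, (0 <= t <= 1)%R -> (Cmod (pc (g t)) <= K2)%R).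
{ intros t Ht; specialize (HK2 t Ht); rewrite clamp_id, Cplus_0_r in HK2; auto. }
assert (B3 : forall z, (Cmod (z - z1) < r)%R -> (Cmod (wl z) < INR N0 - 1)%R).
{ intros z Hz; pose proof (NW z Hz); pose proof (Cmod_triangle_rev (wl z) w1).
  pose proof (B1 1%R T1) as HB1; fold w1 in HB1; lra. }
assert (B4 : forall c, (Cmod (c - c1) < r)%R -> (Cmod c < INR N0 - 1)%R).
{ intros c Hc; pose proof (Cmod_triangle_rev c c1); pose proof (B2 1%R T1) as HB2; fold c1 in HB2; lra. }
exists (fun q => formZ N0 (ps q) (wl (pz q)) (pc q) (fun k => Ll k (pz q)) (fun n => Ml n (pc q))).
split.
- apply (holo_at_holo3 _ (fun s z c => formZ N0 s (wl z) c (fun k => Ll k z) (fun n => Ml n c))).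
  intros s z c Hq; destruct (Bz _ Hq) as [Q1 Q2]; change (pz (s, z, c)) with z in Q1;
  change (pc (s, z, c)) with c in Q2.
  assert (DW : exists l, cder wl z l) by (apply cder_log_branch; lra).
  assert (DL : forall k, exists l, cder (Ll k) z l).
  { intro k; destruct DW as [l D]; destruct (cder_log_branch (L k 1%R) _ _ (NL z k Q1)) as [l' D'].
    eexists; unfold Ll; apply (der_comp _ (log_branch (L k 1%R) (w1 + I2pi * IZR k))
      (fun z => wl z + I2pi * IZR k)); [exact D'|].
    apply der_plus; [exact D|apply der_const]. }
  unfold formZ; apply (form_holo_at N0 N0 s z c wl (fun k => Ll (Z.of_nat k))
    (fun k => Ll (- Z.of_nat k - 1)%Z) Ml); auto.
  + intro n; destruct (cder_log_branch (M n 1%R) _ _ (NM c n Q2)) as [l' D'].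
    eexists; unfold Ml; apply (der_comp _ (log_branch (M n 1%R) (c1 + INR n)) (fun c => c + INR n));
      [exact D'|apply cder_shift].
  + pose proof (B3 z Q1); pose proof (im_le_Cmod (wl z)); pose proof PI2_3_2.
    pose proof (Rle_abs (Im (wl z))); pose proof (Rle_abs (- Im (wl z))) as A2.
    rewrite Rabs_Ropp in A2; pose proof (Cmod_ge_0 (wl z)); unfold strip; nra.
  + pose proof (B4 c Q2); pose proof (re_le_Cmod c); pose proof (Rle_abs (- Re c)) as A2.
    rewrite Rabs_Ropp in A2; change (/ 2 < Re c + INR N0)%R; pose proof (Cmod_ge_0 c); lra.
- intros d Hd Ed; apply Ztilde_eq.
  assert (Hd' := Hd); apply path_in_iff in Hd'; destruct Hd' as [DU [DS [DZ DC]]].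
  assert (HdN : pathN d).
  { apply path_in_iff; split; auto. }
  assert (HgN : pathN (concat g d)) by (apply path_in_concat; auto).
  set (wd := fun t => wl (pz (d t))).
  set (Ld := fun k t => Ll k (pz (d t))).
  set (Md := fun n t => Ml n (pc (d t))).
  assert (QZ : forall t, (0 <= t <= 1)%R -> (Cmod (pz (d t) - z1) < r)%R) by (intros; apply Bz; auto).
  assert (QC : forall t, (0 <= t <= 1)%R -> (Cmod (pc (d t) - c1) < r)%R) by (intros; apply Bz; auto).
  assert (Lw : is_log_of (fun t => pz (d t)) wd).
  { apply (is_log_of_log_branch w1 z1 (fun t => pz (d t))); auto; intros t Ht; specialize (QZ t Ht); lra. }
  assert (wd0 : wd 0%R = w1).
  { unfold wd; rewrite Ed; apply log_branch_refl; auto. }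
  assert (LG : logs d wd Ld Md).
  { split; [auto|split].
    - intro k; apply (is_log_of_log_branch (L k 1%R) (w1 + I2pi * IZR k) (fun t => wd t + I2pi * IZR k)).
      + apply (HL2 k); auto.
      + apply is_log_of_cont01_plus with (1 := Lw).
      + intros t Ht; apply NL; auto.
    - intro n; apply (is_log_of_log_branch (M n 1%R) (c1 + INR n) (fun t => pc (d t) + INR n)).
      + apply (HL3 n); auto.
      + apply pathN_cont_pc; auto.
      + intros t Ht; apply NM; auto. }
  assert (LC := logs_concat g d w L M wd Ld Md HL LG).
  assert (LC' : logs (concat g d) (cat_fun w wd) (fun k => cat_fun (L k) (Ld k)) (fun n => cat_fun (M n) (Md n))).
  { apply LC.
    - rewrite wd0; auto.
    - intro k; unfold Ld, Ll; change (wl (pz (d 0%R))) with (wd 0%R); rewrite wd0.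
      symmetry; apply log_branch_refl, (pathN_log g Hg w 1 k); auto.
    - intro n; unfold Md, Ml; rewrite Ed.
      symmetry; apply log_branch_refl, (pathN_pc g Hg 1 n); auto. }
  assert (BC : based (cat_fun w wd) (fun k => cat_fun (L k) (Ld k)) (fun n => cat_fun (M n) (Md n))).
  { destruct HB as [X1 [X2 X3]]; split; [|split]; intros; rewrite cat_fun_0; auto. }
  assert (SC : stable_at N0 (cat_fun w wd 1%R) (pc (concat g d 1%R))
    (fun k => cat_fun (L k) (Ld k) 1%R) (fun n => cat_fun (M n) (Md n) 1%R)).
  { apply (logs_stable (concat g d) (cat_fun w wd) (fun k => cat_fun (L k) (Ld k)) (fun n => cat_fun (M n) (Md n))); auto.
    - rewrite concat_cat_fun, cat_fun_0; auto.
    - intros t Ht; rewrite concat_cat_fun; unfold cat_fun; destruct (cat_fun_range t Ht) as [C1 C2].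
      destruct (Rle_dec t (1 / 2)) as [D|D].
      + specialize (C1 D); pose proof (B1 _ C1); pose proof (B2 _ C1); lra.
      + specialize (C2 D); split; [apply B3, QZ; auto|apply B4, QC; auto]. }
  pose proof (is_value_stable _ _ _ _ _ LC' BC SC) as V.
  rewrite concat_cat_fun, !cat_fun_1 in V.
  assert (E1 : (fun k => cat_fun (L k) (Ld k) 1%R) = (fun k => Ll k (pz (d 1%R))))
    by (apply functional_extensionality; intro; rewrite cat_fun_1; auto).
  assert (E2 : (fun n => cat_fun (M n) (Md n) 1%R) = (fun n => Ml n (pc (d 1%R))))
    by (apply functional_extensionality; intro; rewrite cat_fun_1; auto).
  rewrite E1, E2 in V; exact V.
Qed.

(** * Comparison with the Lerch series *)

(** A branch of [log (w + 2 pi i k)] available for every [k] on the whole half-plane [Re w < 0], and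
    the one for which [form_series] shows that the extra terms vanish. *)
Definition left_log (k : Z) (w : C) : C :=
  Lj (princ_dir k) + Lj (princ_dir k) + Clog (- (w + I2pi * IZR k)).

Lemma Re_plus_I2pi (w : C) (x : R) : Re (w + I2pi * x) = Re w.
Proof. unfold I2pi; simpl; unfold Re; ring. Qed.

Lemma Cexp_left_log k w : (Re w < 0)%R -> Cexp (left_log k w) = w + I2pi * IZR k.
Proof.
intro H; apply (left_segment_Clog (princ_dir k) (w + I2pi * IZR k)); [apply vert_princ_dir|].
rewrite Re_plus_I2pi; auto.
Qed.

(** Both are logarithms of the same number. Their imaginary parts are within [pi / 2] of [Im (Lj j)]
    and of [2 Im (Lj j)], hence differ by less than [3 pi / 2], which excludes a nonzero multiple of
    [2 pi]. *)
Lemma princ_left_log k w : princ_dom k w -> (Re w < 0)%R -> princ k w = left_log k w.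
Proof.
intros Hk Hw; pose proof PI_RGT_0.
destruct (Cexp_eq (princ k w) (left_log k w)) as [m Hm].
{ rewrite Cexp_princ, Cexp_left_log; auto. }
assert (E : Im (princ k w) = (Im (left_log k w) + 2 * PI * IZR m)%R).
{ rewrite Hm; change (Im (left_log k w + 2 * PI * IZR m * Ci))
    with (Im (left_log k w) + Im (2 * PI * IZR m * Ci))%R; f_equal; simpl; ring. }
unfold princ, left_log in E.
set (j := princ_dir k) in *; set (v := w + I2pi * IZR k) in *.
pose proof (Im_Clog_bound _ (princ_arg k w Hk)) as B1; fold j v in B1.
assert (Hv : (0 < Re (- v))%R).
{ assert (Re v < 0)%R by (unfold v; rewrite Re_plus_I2pi; auto).
  simpl in *; unfold Re in *; lra. }
pose proof (Im_Clog_bound _ Hv) as B2.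
apply Rabs_def2 in B1; apply Rabs_def2 in B2.
assert (EL : (Im (Lj j) = Im j * (PI / 2))%R) by (unfold Lj; simpl; unfold Im; ring).
assert (Hj : (Im j = 1 \/ Im j = -1)%R).
{ destruct (vert_princ_dir k) as [Ej|Ej]; fold j in Ej; rewrite Ej; simpl; auto. }
assert (E2 : (Im (Clog (- (j * v))) = Im (Lj j) + Im (Clog (- v)) + 2 * PI * IZR m)%R).
{ simpl in E |- *; unfold Im in *; lra. }
rewrite EL in E2.
assert (m < 1)%Z by (apply lt_IZR; destruct Hj as [Hj|Hj]; rewrite Hj in E2; nra).
assert (-1 < m)%Z by (apply lt_IZR; destruct Hj as [Hj|Hj]; rewrite Hj in E2; nra).
assert (m = 0)%Z by lia; subst m; rewrite Hm; ring.
Qed.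

(** Along this path [log z = w0 - t] stays on the line [Im w = pi], so that every logarithm of
    [w + 2 pi i k] keeps its principal branch; [c] is fixed, while [s] moves from [1/2] to [2]. *)
Definition path0 : path := fun t => (RtoC (1 / 2 + 3 / 2 * t), RtoC (- exp (- t)), RtoC (1 / 2)).

Lemma conR_cont01 p : (forall t, conR p t) -> cont01 p.
Proof.
intro H; apply cont01_intro; intros t Ht eps He; destruct (H t eps He) as [r [Hr H1]].
exists r; split; auto; intros t' Ht' Hd; rewrite Cmod_sub_sym; apply H1; rewrite at_RE; auto.
Qed.

Lemma path0_cover : cover_pt path0.
Proof.
split.
- apply path_in_iff; split; [|split; [|split]].
  + intros t Ht; unfold path0, inN; pose proof (exp_pos (- t)); split; [|split].
    * intro E; apply RtoC_inj in E; lra.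
    * intro E; apply RtoC_inj in E; lra.
    * intros k E; apply RtoC_inj in E.
      assert (0 < k)%Z by (apply lt_IZR; lra); assert (k < 1)%Z by (apply lt_IZR; lra); lia.
  + apply conR_cont01; intro t; apply (conR_RtoC (fun t => 1 / 2 + 3 / 2 * t)%R); auto_derive; auto.
  + apply conR_cont01; intro t; apply (conR_RtoC (fun t => - exp (- t))%R); auto_derive; auto.
  + apply (cont01_const (RtoC (1 / 2))).
- unfold path0, x0'; rewrite Ropp_0, exp_0.
  replace (1 / 2 + 3 / 2 * 0)%R with (1 / 2)%R by lra; replace (- (1))%R with (-1)%R by lra; auto.
Qed.

Lemma path0_D0 : inD0 (path0 1%R).
Proof.
unfold path0, inD0; rewrite Cmod_R, Rabs_Ropp, Rabs_pos_eq by (left; apply exp_pos).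
split; [simpl; lra|split; [|simpl; lra]].
apply Rlt_le_trans with (exp 0); [apply exp_increasing; lra|rewrite exp_0; lra].
Qed.

Lemma path0_logs : logs path0 (fun t => w0 - t) (fun k t => princ k (w0 - t))
    (fun n _ => Clog (RtoC (1 / 2) + INR n)) /\
  based (fun t => w0 - t) (fun k t => princ k (w0 - t)) (fun n _ => Clog (RtoC (1 / 2) + INR n)).
Proof.
assert (CR : cont01 (fun t => w0 - t)).
{ apply conR_cont01; intro t; apply tends_minus; [apply tends_const|].
  eapply rder_conR, der_id. }
assert (PD : forall k t, princ_dom k (w0 - RtoC t)).
{ intros k t; unfold princ_dom; pose proof (princ_dom_w0 k) as H; unfold princ_dom in H.
  destruct (vert_princ_dir k) as [E|E]; rewrite E in *;
  rewrite ?Re_Ci_mult, ?Re_nCi_mult, Im_plus_I2pi in *;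
  replace (Im (w0 - t)) with (Im w0) by (simpl; unfold Im; ring); auto. }
assert (E0 : w0 - 0%R = w0) by ring.
split; [split; [|split]|split; [|split]].
- split; auto; intros t Ht; rewrite Cexp_minus, Cexp_w0; unfold path0, pz; simpl.
  unfold Cexp; simpl; rewrite cos_0, sin_0, exp_Ropp.
  pose proof (exp_pos t); apply C_ext; simpl; field; lra.
- intro k; split; [|intros t Ht; apply Cexp_princ, PD].
  intro t; unfold princ; apply tends_plus; [apply tends_const|].
  apply tends_Clog; [apply princ_arg, PD|].
  apply tends_opp, tends_mult; [apply tends_const|]; apply tends_plus; [apply CR|apply tends_const].
- intro n; split; [apply cont01_const|].
  intros t Ht; apply Cexp_Clog, half_INR_pos.
- auto.
- intro k; rewrite E0; auto.
- auto.
Qed.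

(** Only [N] grows here while [n] stays equal to [N0], since the limit in [form_series] is taken at
    fixed [n]. *)
Lemma form_stable_N N0 s w c L M : stable_at N0 w c L M -> forall N, (N0 <= N)%nat ->
  form N N0 s w c (fun k => L (Z.of_nat k)) (fun k => L (- Z.of_nat k - 1)%Z) M = formZ N0 s w c L M.
Proof.
intros [Hs [Hc H]] N HN; induction HN as [|N HN IH]; [reflexivity|].
rewrite form_S_N; auto.
- apply le_INR in HN; simpl in *; unfold Re in *; lra.
- apply (H N HN).
Qed.

Lemma Cpown_Cexp w n : Cpown (Cexp w) n = Cexp (w * INR n).
Proof.
induction n as [|n IH]; [simpl; rewrite Cmult_0_r, Cexp_0; auto|].
rewrite INR_C_S, Cmult_plus_distr_l, Cexp_plus, Cmult_1_r, <- IH; simpl; ring.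
Qed.

Lemma is_series_vanish (a : nat -> C) (l : C) : vanish (fun N => l - csum a N) ->
  @is_series C_AbsRing C_NormedModule a l.
Proof.
intro H.
(* [sum_n] includes the term of index [N], whereas [csum] stops before it. *)
assert (E : forall N, @sum_n (NormedModule.AbelianGroup C_AbsRing C_NormedModule) a N = csum a (S N)).
{ induction N as [|N IH].
  - rewrite sum_O; simpl; ring.
  - rewrite sum_Sn, IH; reflexivity. }
apply (filterlim_locally_ball_norm (K := C_AbsRing)); intro eps.
destruct (H eps (cond_pos eps)) as [N0 HN0]; exists N0; intros N HN.
rewrite E; unfold ball_norm.
change (Cmod (csum a (S N) - l) < eps)%R; rewrite Cmod_sub_sym; apply HN0; lia.
Qed.

(** In the domain of the series [Re w < 0] and [Re (c + n) > 0], so the explicit branches [left_log]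
    and [Clog] follow the path [d]; by [princ_left_log] they match the end values along [path0]. The
    value is constant in [N], while its difference from the partial sums tends to 0. *)
Lemma Ztilde_series d : path_in (fun q => inN q /\ inD0 q) d -> d 0%R = path0 1%R ->
  @is_series C_AbsRing C_NormedModule (lerch_term (ps (d 1%R)) (pz (d 1%R)) (pc (d 1%R)))
    (Ztilde (concat path0 d)).
Proof.
intros Hd Ed.
apply path_in_iff in Hd; destruct Hd as [DU [DS [DZ DC]]].
assert (HdN : pathN d) by (apply path_in_iff; split; [intros; apply DU; auto|auto]).
destruct path0_logs as [L0 B0].
assert (DD : forall t, (0 <= t <= 1)%R -> (1 < Re (ps (d t)) /\ Cmod (pz (d t)) < 1 /\ 0 < Re (pc (d t)))%R).
{ intros t Ht; destruct (DU t Ht) as [_ H]; unfold ps, pz, pc; destruct (d t) as [[s z] c].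
  simpl in *; tauto. }
destruct (is_log_of_exists (fun t => pz (d t)) (w0 - 1%R)) as [wd [Lw wd0]].
{ exact DZ. }
{ intros t Ht; apply (pathN_pz d); auto. }
{ rewrite Ed; apply (proj1 L0); lra. }
assert (Rw : forall t, (0 <= t <= 1)%R -> (Re (wd t) < 0)%R).
{ intros t Ht; apply exp_lt_inv; rewrite exp_0, <- Cmod_Cexp, (proj2 Lw) by auto.
  apply (DD t Ht). }
set (Ld := fun k t => left_log k (wd t)).
set (Md := fun (n : nat) t => Clog (pc (d t) + INR n)).
assert (RC : forall t (n : nat), (0 <= t <= 1)%R -> (0 < Re (pc (d t) + INR n))%R).
{ intros t n Ht; destruct (DD t Ht) as [_ [_ H]]; pose proof (pos_INR n).
  change (0 < Re (pc (d t)) + INR n)%R; lra. }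
assert (LG : logs d wd Ld Md).
{ split; [auto|split].
  - intro k; split; [|intros t Ht; apply Cexp_left_log; auto].
    intro t; unfold Ld, left_log; apply tends_plus; [apply tends_const|].
    apply tends_Clog.
    + pose proof (Rw (clamp t) (clamp_range t)) as H; rewrite <- (Re_plus_I2pi _ (IZR k)) in H.
      simpl in *; unfold Re in *; lra.
    + apply tends_opp, tends_plus; [apply Lw|apply tends_const].
  - intro n; split; [|intros t Ht; apply Cexp_Clog; auto].
    intro t; unfold Md; apply tends_Clog; [apply RC, clamp_range|apply pathN_cont_pc; auto]. }
assert (LC : logs (concat path0 d) (cat_fun (fun t => w0 - t) wd)
  (fun k => cat_fun (fun t => princ k (w0 - t)) (Ld k))
  (fun n => cat_fun (fun _ => Clog (RtoC (1 / 2) + INR n)) (Md n))).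
{ apply logs_concat; auto.
  - intro k; unfold Ld; rewrite wd0; apply princ_left_log.
    + unfold princ_dom; pose proof (princ_dom_w0 k) as H; unfold princ_dom in H.
      destruct (vert_princ_dir k) as [E|E]; rewrite E in *;
      rewrite ?Re_Ci_mult, ?Re_nCi_mult, Im_plus_I2pi in *;
      replace (Im (w0 - 1%R)) with (Im w0) by (simpl; unfold Im; ring); auto.
    + unfold w0; simpl; lra.
  - intro n; unfold Md; rewrite Ed; reflexivity. }
assert (BC : based (cat_fun (fun t => w0 - t) wd)
  (fun k => cat_fun (fun t => princ k (w0 - t)) (Ld k))
  (fun n => cat_fun (fun _ => Clog (RtoC (1 / 2) + INR n)) (Md n))).
{ destruct B0 as [X1 [X2 X3]]; split; [|split]; intros; rewrite cat_fun_0; auto. }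
assert (CV : cover_pt (concat path0 d)).
{ destruct path0_cover as [C1 C2]; split; [apply path_in_concat; auto|].
  rewrite concat_cat_fun, cat_fun_0; auto. }
destruct (logs_stable_exists _ _ _ _ CV LC BC) as [N0 SC].
rewrite (Ztilde_eq _ _ (is_value_stable _ _ _ _ _ LC BC SC)).
rewrite concat_cat_fun, !cat_fun_1 in *.
destruct (DD 1%R ltac:(lra)) as [Ds [Dz Dc]].
set (s := ps (d 1%R)) in *; set (c := pc (d 1%R)) in *.
set (LL := fun k => cat_fun (fun t => princ k (w0 - t)) (Ld k) 1%R) in *.
set (MM := fun n => cat_fun (fun _ => Clog (RtoC (1 / 2) + INR n)) (Md n) 1%R) in *.
assert (EM : forall n, MM n = Clog (c + INR n)) by (intro n; unfold MM; rewrite cat_fun_1; auto).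
assert (EL : forall k, LL k = left_log k (wd 1%R)) by (intro k; unfold LL; rewrite cat_fun_1; auto).
apply is_series_vanish.
assert (V : vanish (fun N => form N N0 s (wd 1%R) c (fun k => LL (Z.of_nat k))
    (fun k => LL (- Z.of_nat k - 1)%Z) MM - csum (fun l => Cexp (wd 1%R * INR l - s * MM l)) N)).
{ apply form_series; auto; [apply Rw; lra|apply SC| |].
  - intros k _; rewrite EL; unfold left_log, princ_dir.
    destruct (Z.leb_spec 0 (Z.of_nat k)); [|lia]; rewrite <- INR_IZR_INZ; auto.
  - intros k _; rewrite EL; unfold left_log, princ_dir.
    destruct (Z.leb_spec 0 (- Z.of_nat k - 1)); [lia|].
    rewrite minus_IZR, opp_IZR, <- INR_IZR_INZ, RtoC_minus, RtoC_opp.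
    replace (wd 1%R + I2pi * (- INR k - 1%R)) with (wd 1%R - I2pi - I2pi * INR k) by ring; auto. }
intros eps He; destruct (V eps He) as [N1 HN1]; exists (N0 + N1)%nat; intros N HN.
specialize (HN1 N ltac:(lia)).
rewrite (form_stable_N N0 s _ _ _ _ SC) in HN1 by lia.
rewrite (csum_ext _ (fun l => Cexp (wd 1%R * INR l - s * MM l))); auto.
intros k _; unfold lerch_term; rewrite <- (proj2 Lw), Cpown_Cexp by lra.
unfold Defs.Cpow; rewrite EM, <- Cexp_plus; f_equal.
replace (INR k + c) with (c + INR k) by ring; ring.
Qed.

Theorem theorem2p1 :
  exists Zt : path -> C,
    holo_on_cover Zt /\ continues_lerch Zt /\
    (forall tau g, derived2 tau -> cover_pt g -> Zt (concat tau g) = Zt g).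
Proof.
exists Ztilde; split; [split|split].
- intros g h Hg Hh; symmetry; apply Ztilde_eq, is_value_homotopic with g; auto using Ztilde_is_value.
- apply Ztilde_local.
- exists path0; split; [apply path0_cover|split; [apply path0_D0|]].
  intros d Hd Ed; pose proof (Ztilde_series d Hd Ed) as H.
  unfold ps, pz, pc in H; destruct (d 1%R) as [[s z] c]; exact H.
- intros tau g Ht Hg; apply Ztilde_eq, is_value_derived2; auto using Ztilde_is_value.
Qed.
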